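(* Let $\Gamma$ be a groupoid and $R=\bigoplus_{\gamma\in\Gamma}R_\gamma$ a $\Gamma$-graded ring. The following statements are equivalent. (1) $R$ is a gr-simple pfm ring. (2) $R$ is a gr-prime pfm ring. (3) There exist $e_0,e\in\Gamma_0$, a $\Gamma$-graded division ring $D$ with $\operatorname{supp}(D)\subseteq e_0\Gamma e_0$, a non-empty set $I$ and a $d$-finite sequence $\overline{\sigma}=(\sigma_i)_{i\in I}\in(e_0\Gamma)^I$ such that $R\cong_{gr}\mathrm{M}_I(D)(\overline{\sigma})$ and $I_e:=\{i\in I:d(\sigma_i)=e\}$ has exactly one element. (4) $R$ is a gr-simple ring and there exists $e\in\Gamma_0$ such that $R(e)$ is a gr-simple $R$-module. (5) There exists $e\in\Gamma_0$ such that $R(e)$ is a gr-simple $R$-module and $R_R$ is gr-isomorphic to a direct sum of shifts of $R(e)$. (6) $R$ is a gr-simple $\Gamma_0$-artinian ring and there exists $e\in\Gamma_0$ such that $R_e$ is a division ring. (7) $R$ is a right gr-primitive right $\Gamma_0$-artinian ring and there exists $e\in\Gamma_0$ such that $R_e$ is a division ring.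
   Context: A groupoid $\Gamma$ is a small category with all morphisms invertible, identified with its set of morphisms; $\Gamma_0$ is its set of objects (identified with identity morphisms). For $\gamma:e\to f$ write $d(\gamma)=e$, $r(\gamma)=f$; $\delta\gamma$ is defined iff $d(\delta)=r(\gamma)$. $e\Gamma=\{\gamma:r(\gamma)=e\}$, $e\Gamma f=\{\gamma:r(\gamma)=e,d(\gamma)=f\}$. A $\Gamma$-graded ring is an associative ring $R=\bigoplus_{\gamma\in\Gamma}R_\gamma$ (additive subgroups) with $R_\gamma R_\delta\subseteq R_{\gamma\delta}$ if $\gamma\delta$ is defined and $R_\gamma R_\delta=0$ otherwise (generally, components indexed by undefined products are $\{0\}$), always assumed object unital: for each $e\in\Gamma_0$, $R_e$ is a unital ring with identity $1_e$ (possibly $1_e=0$) and $1_{r(\gamma)}a=a=a1_{d(\gamma)}$ for $a\in R_\gamma$. $\operatorname{supp}(R)=\{\gamma:R_\gamma\neq0\}$. A $\Gamma$-graded $R$-module is a right $R$-module $M=\bigoplus_\gamma M_\gamma$ with $M_\gamma R_\delta\subseteq M_{\gamma\delta}$ (zero if undefined) and $MR=M$. $\cong_{gr}$ (of rings or modules) means there is a degree-preserving isomorphism. For $\sigma\in\Gamma$, the shift $M(\sigma)$ is the graded module with $M(\sigma)_\gamma=M_{\sigma\gamma}$ ($0$ if $\sigma\gamma$ is undefined); in particular $M(e)=\bigoplus_{r(\gamma)=e}M_\gamma$ for $e\in\Gamma_0$, and $R(e)=1_eR$. A graded module is gr-simple if nonzero with only graded submodules $0$ and itself. $R$ is gr-simple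 if $R\ne0$ and its only graded (two-sided) ideals are $0,R$; gr-prime if $IJ\neq0$ for all nonzero graded ideals $I,J$; right $\Gamma_0$-artinian if for each $e\in\Gamma_0$, $R(e)$ satisfies the descending chain condition on graded right submodules (for gr-simple rings this is left-right symmetric and the word ''right'' is dropped). $R$ is right gr-primitive if there is a gr-simple right $R$-module $M$ that is faithful: $\{a\in R:Ma=0\}=0$. A graded $R$-module $M$ is pseudo-free if it has a pseudo-basis: a sequence of (nonzero) homogeneous elements $x_i\in M_{\gamma_i}$ $(i\in I)$ generating $M$ such that the only $(a_i)\in\bigoplus_i1_{d(\gamma_i)}R$ with $\sum x_ia_i=0$ is $(a_i)=0$. $R$ is a pfm (pseudo-free module) ring if every $\Gamma$-graded right $R$-module is pseudo-free. A $\Gamma$-graded division ring is a $\Gamma$-graded ring $D\neq0$ such that each nonzero $a\in D_\gamma$ has $a^{-1}\in D_{\gamma^{-1}}$ with $aa^{-1}=1_{r(\gamma)}$, $a^{-1}a=1_{d(\gamma)}$. A sequence $(\sigma_i)_{i\in I}\in(e_0\Gamma)^I$ is $d$-finite if for each $f\in\Gamma_0$ only finitely many $i$ satisfy $d(\sigma_i)=f$. For such a sequence and $D$ with $\operatorname{supp}(D)\subseteq e_0\Gamma e_0$, $\mathrm{M}_I(D)(\overline{\sigma})$ is the ring of $I\times I$ matrices over $D$ with finitely many nonzero entries, graded by letting the $\gamma$-component be the matrices with $(i,j)$ entry in $D_{\sigma_i\gamma\sigma_j^{-1}}$ ($\{0\}$ if undefined).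
   Formalization: In (2), gr-prime is taken to include R ≠ 0; without this the zero ring would vacuously be a gr-prime pfm ring while not being gr-simple, so (2) would not imply (1). *)

(* Defs.v *)
From HB Require Import structures.
From mathcomp Require Import all_boot all_order all_algebra finmap.
From mathcomp Require Import boolp classical_sets functions cardinality fsbigop.

Set Implicit Arguments.
Unset Strict Implicit.
Unset Printing Implicit Defensive.

Import GRing.Theory.

Local Open Scope classical_set_scope.
Local Open Scope ring_scope.

(* The groupoid coerces to its set of morphisms; an object e is seen as a
   morphism through the identity [gid e].  [gcomp s t] is the composite "s after
   t": it is meaningful only when [gdom s = gcod t] and takes an unspecified
   value otherwise.  Classically every type carries a choiceType structure, which
   is only needed here to sum over G. *)
Record groupoid := Groupoid {
  gobj : choiceType;
  gmor :> choiceType;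
  gdom : gmor -> gobj;
  gcod : gmor -> gobj;
  gid : gobj -> gmor;
  gcomp : gmor -> gmor -> gmor;
  ginv : gmor -> gmor;
  gdom_id : forall e, gdom (gid e) = e;
  gcod_id : forall e, gcod (gid e) = e;
  gdom_comp : forall s t, gdom s = gcod t -> gdom (gcomp s t) = gdom t;
  gcod_comp : forall s t, gdom s = gcod t -> gcod (gcomp s t) = gcod s;
  gcompA : forall s t u, gdom s = gcod t -> gdom t = gcod u ->
    gcomp s (gcomp t u) = gcomp (gcomp s t) u;
  gcomp1m : forall s, gcomp (gid (gcod s)) s = s;
  gcompm1 : forall s, gcomp s (gid (gdom s)) = s;
  gdom_inv : forall s, gdom (ginv s) = gcod s;
  gcod_inv : forall s, gcod (ginv s) = gdom s;
  gcompVm : forall s, gcomp (ginv s) s = gid (gdom s);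
  gcompmV : forall s, gcomp s (ginv s) = gid (gcod s)
}.

Definition pcomp (G : groupoid) (s t : G) : option G :=
  if gdom s == gcod t then Some (gcomp s t) else None.

Definition subgroup (V : zmodType) (A : set V) : Prop :=
  A 0 /\ forall x y, A x -> A y -> A (x - y).

(* The component at an undefined product is {0}. *)
Definition ocomponent (I : Type) (V : zmodType) (A : I -> set V)
    (o : option I) : set V :=
  if o is Some i then A i else [set 0].

Definition decomposition (I : choiceType) (V : zmodType) (A : I -> set V)
    (v : V) (f : I -> V) : Prop :=
  [/\ forall i, A i (f i), finite_set [set i | f i != 0]
    & v = \sum_(i \in [set: I]) f i].

Definition internal_sum (I : choiceType) (V : zmodType) (A : I -> set V) :
  set V := [set v | exists f, decomposition A v f].

Definition internal_direct_sum (I : choiceType) (V : zmodType)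
    (A : I -> set V) : Prop :=
  forall v, exists! f, decomposition A v f.

(* The product AB of two subgroups, i.e. the subgroup of finite sums of products. *)
Definition set_product (U V W : zmodType) (mul : U -> V -> W)
    (A : set U) (B : set V) : set W :=
  [set w | exists s : seq (U * V),
     (forall p, p \in s -> A p.1 /\ B p.2) /\
     w = \sum_(p <- s) mul p.1 p.2].

(* The ring need not have a global identity; [gr_one e] is the identity 1_e of
   the component at e, possibly 0. *)
Record grRing (G : groupoid) := GrRing {
  gr_sort :> zmodType;
  gr_mul : gr_sort -> gr_sort -> gr_sort;
  gr_one : gobj G -> gr_sort;
  gr_comp : G -> set gr_sort;
  gr_mulA : associative gr_mul;
  gr_mulDl : left_distributive gr_mul +%R;
  gr_mulDr : right_distributive gr_mul +%R;
  gr_comp_subgroup : forall g, subgroup (gr_comp g);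
  gr_comp_direct : internal_direct_sum gr_comp;
  gr_comp_mul : forall g h a b, gr_comp g a -> gr_comp h b ->
    ocomponent gr_comp (pcomp g h) (gr_mul a b);
  gr_one_comp : forall e, gr_comp (gid e) (gr_one e);
  gr_mul1r : forall g a, gr_comp g a -> gr_mul (gr_one (gcod g)) a = a;
  gr_mulr1 : forall g a, gr_comp g a -> gr_mul a (gr_one (gdom g)) = a
}.

Record grModule (G : groupoid) (R : grRing G) := GrModule {
  gm_sort :> zmodType;
  gm_act : gm_sort -> R -> gm_sort;
  gm_comp : G -> set gm_sort;
  gm_actA : forall m a b, gm_act m (gr_mul a b) = gm_act (gm_act m a) b;
  gm_actDl : forall m n a, gm_act (m + n) a = gm_act m a + gm_act n a;
  gm_actDr : forall m a b, gm_act m (a + b) = gm_act m a + gm_act m b;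
  gm_comp_subgroup : forall g, subgroup (gm_comp g);
  gm_comp_direct : internal_direct_sum gm_comp;
  gm_comp_act : forall g h m a, gm_comp g m -> gr_comp h a ->
    ocomponent gm_comp (pcomp g h) (gm_act m a);
  gm_act_full : set_product gm_act [set: gm_sort] [set: R] = [set: gm_sort]
}.

Section SumTheory.
Variables (I : choiceType) (V : zmodType).
Implicit Types (A : I -> set V) (P : set V).

Lemma subgroupN P x : subgroup P -> P x -> P (- x).
Proof. by move=> [P0 PB] Px; rewrite -sub0r; apply: PB. Qed.

Lemma subgroupD P x y : subgroup P -> P x -> P y -> P (x + y).
Proof.
move=> sP Px Py; rewrite -[y]opprK; case: (sP) => _; apply=> //.
exact: subgroupN.
Qed.

Lemma subgroup_sum (J : Type) (s : seq J) (Q : pred J) P (f : J -> V) :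
  subgroup P -> (forall j, Q j -> P (f j)) -> P (\sum_(j <- s | Q j) f j).
Proof.
move=> sP Pf; apply: (big_ind P) => //; first by case: sP.
by move=> x y; exact: subgroupD.
Qed.

Lemma fsum_eq (X : {fset I}) (f : I -> V) :
  (forall i, f i != 0 -> i \in X) ->
  \sum_(i \in [set: I]) f i = \sum_(i <- X) f i.
Proof.
move=> fX; apply: fsbigTE => i iX; apply/eqP; apply: contraNT iX; exact: fX.
Qed.

Lemma finite_set_sub (S : set I) : finite_set S ->
  exists X : {fset I}, forall i, S i -> i \in X.
Proof. by move=> /finite_fsetP[X ->]; exists X. Qed.

Lemma finite_set_sub2 (S T : set I) : finite_set S -> finite_set T ->
  exists X : {fset I}, forall i, S i \/ T i -> i \in X.
Proof.
move=> fS fT; have [|X XP] := @finite_set_sub (S `|` T).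
  by rewrite finite_setU.
by exists X => i /XP.
Qed.

Lemma fsum_closed P (f : I -> V) : subgroup P -> (forall i, P (f i)) ->
  P (\sum_(i \in [set: I]) f i).
Proof. by move=> sP Pf; apply: subgroup_sum. Qed.

Lemma internal_sum_ind A P : subgroup P -> (forall i, A i `<=` P) ->
  internal_sum A `<=` P.
Proof.
by move=> sP AP v [f [Af _ ->]]; apply: fsum_closed => // i; exact: AP.
Qed.

Lemma internal_sum_comp A : (forall i, subgroup (A i)) ->
  forall i, A i `<=` internal_sum A.
Proof.
move=> sA i v Aiv; exists (fun j => if j == i then v else 0); split.
- by move=> j; case: eqP => [->//|_]; case: (sA j).
- apply: (sub_finite_set _ (finite_set1 i)) => j /=.
  by case: (j =P i) => // _; rewrite eqxx.
- rewrite (fsum_eq (X := [fset i]%fset)); last first.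
    by move=> j; rewrite inE; case: (j == i); rewrite ?eqxx.
  by rewrite big_seq_fset1 eqxx.
Qed.

Lemma internal_sum_subgroup A : (forall i, subgroup (A i)) ->
  subgroup (internal_sum A).
Proof.
move=> sA; split.
  exists (fun=> 0); split; first by move=> i; case: (sA i).
    by apply: (sub_finite_set _ (@finite_set0 I)) => i /=; rewrite eqxx.
  by rewrite (fsum_eq (X := fset0)) ?big_seq_fset0// => i; rewrite eqxx.
move=> x y [f [Af ff ->]] [g [Ag fg ->]].
have [X XP] := finite_set_sub2 ff fg.
exists (fun i => f i - g i); split.
- by move=> i; case: (sA i) => _; apply.
- apply: (sub_finite_set _ (finite_fset X)) => i /= fgi; apply: XP => /=.
  case: (eqVneq (f i) 0) fgi => [->|]; last by left.
  by rewrite sub0r oppr_eq0; right.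
- have fX i : f i != 0 -> i \in X by move=> fi; apply: XP; left.
  have gX i : g i != 0 -> i \in X by move=> gi; apply: XP; right.
  have fgX i : f i - g i != 0 -> i \in X.
    move=> fgi; apply: XP => /=.
    case: (eqVneq (f i) 0) fgi => [->|]; last by left.
    by rewrite sub0r oppr_eq0; right.
  by rewrite (fsum_eq fX) (fsum_eq gX) (fsum_eq fgX) sumrB.
Qed.

Lemma internal_direct_sumI A : (forall i, subgroup (A i)) ->
  (forall v, internal_sum A v) ->
  (forall f, decomposition A 0 f -> forall i, f i = 0) ->
  internal_direct_sum A.
Proof.
move=> sA span indep v; have [f fv] := span v; exists f; split => // g gv.
case: fv gv => [Af ff vf] [Ag fg vg].
have [X XP] := finite_set_sub2 ff fg.
have h i : f i - g i != 0 -> i \in X.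
  move=> fgi; apply: XP => /=.
  case: (eqVneq (f i) 0) fgi => [->|]; last by left.
  by rewrite sub0r oppr_eq0; right.
apply/funext => i; apply/eqP; rewrite -subr_eq0; apply/eqP.
apply: (indep (fun i => f i - g i)); split.
- by move=> j; case: (sA j) => _; apply.
- exact: (sub_finite_set h (finite_fset X)).
- have fX j : f j != 0 -> j \in X by move=> fj; apply: XP; left.
  have gX j : g j != 0 -> j \in X by move=> gj; apply: XP; right.
  by rewrite (fsum_eq h) sumrB -(fsum_eq fX) -(fsum_eq gX) -vf -vg subrr.
Qed.

Lemma internal_direct_sum_indep A (J : choiceType) (h : J -> option I)
    (f : J -> V) :
  (forall i, subgroup (A i)) -> internal_direct_sum A ->
  (forall j k i, h j = Some i -> h k = Some i -> j = k) ->
  (forall j, ocomponent A (h j) (f j)) ->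
  finite_set [set j | f j != 0] -> \sum_(j \in [set: J]) f j = 0 ->
  forall j, f j = 0.
Proof.
move=> sA dA hinj Af ff f0 j.
case hj: (h j) => [i|]; last by have := Af j; rewrite hj.
have [X XP] : exists X : {fset J}, forall j, f j != 0 -> j \in X.
  by case/finite_fsetP: ff => X XE; exists X => k fk; have : [set` X] k
    by rewrite -XE.
pose X' := (j |` X)%fset.
have fX' : \sum_(k <- X') f k = 0.
  rewrite -[RHS]f0; apply/esym/fsbigTE => k; rewrite !inE negb_or => /andP[_ kX].
  by apply/eqP; apply: contraNT kX; exact: XP.
pose g i := \sum_(k <- X' | h k == Some i) f k.
have gA : decomposition A 0 g.
  split.
  - move=> i'; apply: subgroup_sum => // k /eqP hk.
    by have := Af k; rewrite hk.
  - apply: (sub_finite_set _ (finite_fset [fset odflt i (h k) | k in X']%fset)).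
    move=> i' /=; apply: contraNT => i'X; rewrite /g big_seq_cond big1//.
    move=> k /andP[kX /eqP hk]; exfalso; case/negP: i'X.
    by apply/imfsetP; exists k => //; rewrite hk.
  - rewrite (fsum_eq (X := [fset odflt i (h k) | k in X']%fset)); last first.
      move=> i'; apply: contraNT => i'X; rewrite /g big_seq_cond big1//.
      move=> k /andP[kX /eqP hk]; exfalso; case/negP: i'X.
      by apply/imfsetP; exists k => //; rewrite hk.
    rewrite /g (exchange_big_dep xpredT)//= -[LHS]fX' big_seq [RHS]big_seq.
    apply: eq_bigr => k kX; case hk: (h k) => [i'|]; last first.
      have -> : f k = 0 by have := Af k; rewrite hk.
      by rewrite big1_eq.
    have i'X : i' \in [fset odflt i (h k) | k in X']%fset.
      by apply/imfsetP; exists k => //; rewrite hk.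
    rewrite big_mkcond (bigD1_seq i') ?fset_uniq//= eqxx big1 ?addr0// => i'' ne.
    by case: eqP => // -[eq]; rewrite eq eqxx in ne.
have : g = fun=> 0.
  have [f' [_ uf']] := dA 0; rewrite -(uf' _ gA); apply: uf'.
  split; first by move=> i'; case: (sA i').
    by apply: (sub_finite_set _ (@finite_set0 I)) => i' /=; rewrite eqxx.
  by rewrite (fsum_eq (X := fset0)) ?big_seq_fset0// => i'; rewrite eqxx.
move/(congr1 (fun g => g i)); rewrite /g.
rewrite big_mkcond (bigD1_seq j) ?fset_uniq//=; last by rewrite !inE eqxx.
rewrite hj eqxx big1 ?addr0// => k kj; case: eqP => // hk.
by rewrite (hinj _ _ _ hk hj) eqxx in kj.
Qed.

End SumTheory.

Lemma fsum_morph (I : choiceType) (V W : zmodType) (phi : V -> W) (f : I -> V) :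
  {morph phi : x y / x + y} -> finite_set [set i | f i != 0] ->
  phi (\sum_(i \in [set: I]) f i) = \sum_(i \in [set: I]) phi (f i).
Proof.
move=> phiD ff; have phi0 : phi 0 = 0.
  by apply: (addrI (phi 0)); rewrite -phiD !addr0.
have [X XP] := finite_set_sub ff.
rewrite (fsum_eq XP) (fsum_eq (X := X)); first exact: big_morph.
by move=> i; apply: contraNT => /(contraNN (XP i))/negbNE/eqP->; rewrite phi0.
Qed.

Lemma set_product_subgroup (U V W : zmodType) (mul : U -> V -> W)
    (A : set U) (B : set V) :
  (forall x y b, mul (x + y) b = mul x b + mul y b) -> subgroup A ->
  subgroup (set_product mul A B).
Proof.
move=> mulD sA.
have mul0 b : mul 0 b = 0.
  by apply: (addrI (mul 0 b)); rewrite -mulD !addr0.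
have mulN x b : mul (- x) b = - mul x b.
  by apply/eqP; rewrite -addr_eq0 -mulD addNr mul0.
split; first by exists [::]; split => //; rewrite big_nil.
move=> _ _ [s [sP ->]] [t [tP ->]].
exists (s ++ [seq (- p.1, p.2) | p <- t]); split.
  move=> p; rewrite mem_cat => /orP[/sP//|/mapP[q /tP[Aq Bq] ->]]/=.
  by split => //; exact: subgroupN.
by rewrite big_cat big_map/= -sumrN; congr (_ + _); apply: eq_bigr => p _.
Qed.

Lemma set_product_mem (U V W : zmodType) (mul : U -> V -> W)
    (A : set U) (B : set V) x b :
  A x -> B b -> set_product mul A B (mul x b).
Proof.
move=> Ax Bb; exists [:: (x, b)]; rewrite big_seq1; split => // p.
by rewrite inE => /eqP->.
Qed.

Section GroupoidTheory.
Variable G : groupoid.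
Implicit Types s t u v w : G.

Lemma pcomp_eq s t u : pcomp s t = Some u -> gdom s = gcod t /\ gcomp s t = u.
Proof. by rewrite /pcomp; case: eqP => // st [<-]. Qed.

Lemma pcomp_def s t : gdom s = gcod t -> pcomp s t = Some (gcomp s t).
Proof. by rewrite /pcomp => ->; rewrite eqxx. Qed.

Lemma gcompKV s t : gdom s = gcod t -> gcomp (ginv s) (gcomp s t) = t.
Proof.
by move=> st; rewrite gcompA ?gdom_inv// gcompVm st gcomp1m.
Qed.

Lemma gcompVK s t : gdom s = gcod t -> gcomp (gcomp s t) (ginv t) = s.
Proof.
by move=> st; rewrite -gcompA ?gcod_inv// gcompmV -st gcompm1.
Qed.

Lemma pcomp_inj s t t' u : pcomp s t = Some u -> pcomp s t' = Some u -> t = t'.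
Proof.
move=> /pcomp_eq[st <-] /pcomp_eq[st' e].
by rewrite -(gcompKV st) -e gcompKV.
Qed.

Lemma pcomp_injl s s' t u : pcomp s t = Some u -> pcomp s' t = Some u -> s = s'.
Proof.
move=> /pcomp_eq[st <-] /pcomp_eq[st' e].
by rewrite -(gcompVK st) -e gcompVK.
Qed.

Lemma gcomp_mid s t u v w :
  gdom s = gcod t -> gdom t = gdom u -> gdom u = gcod v -> gdom v = gcod w ->
  gcomp (gcomp s (gcomp t v)) w =
  gcomp (gcomp (gcomp s t) (ginv u)) (gcomp (gcomp u v) w).
Proof.
move=> st tu uv vw; have tv : gdom t = gcod v by rewrite tu.
have std : gdom (gcomp s t) = gcod v by rewrite gdom_comp.
rewrite -[gcomp (gcomp u v) w](gcompA uv vw).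
rewrite -[RHS]gcompA; first last.
- by rewrite gdom_inv gcod_comp// gcod_comp.
- by rewrite gcod_inv std uv.
by rewrite gcompKV ?gcod_comp// (gcompA std vw) (gcompA st tv).
Qed.

End GroupoidTheory.

Section ModuleTheory.
Variables (G : groupoid) (R : grRing G) (M : grModule R).
Implicit Types (m : M) (a : R).

Lemma gm_act0l a : gm_act 0 a = 0 :> M.
Proof. by apply: (addrI (gm_act 0 a)); rewrite -gm_actDl !addr0. Qed.

Lemma gm_act0r m : gm_act m 0 = 0.
Proof. by apply: (addrI (gm_act m 0)); rewrite -gm_actDr !addr0. Qed.

Lemma gm_actNl m a : gm_act (- m) a = - gm_act m a.
Proof. by apply/eqP; rewrite -addr_eq0 -gm_actDl addNr gm_act0l. Qed.

Lemma gm_actNr m a : gm_act m (- a) = - gm_act m a.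
Proof. by apply/eqP; rewrite -addr_eq0 -gm_actDr addNr gm_act0r. Qed.

Lemma gr_span a : internal_sum (@gr_comp _ R) a.
Proof. by have [f [df _]] := gr_comp_direct a; exists f. Qed.

Lemma gm_span m : internal_sum (@gm_comp _ _ M) m.
Proof. by have [f [df _]] := gm_comp_direct m; exists f. Qed.

Lemma gm_act_ind (A : G -> set M) (P : set M) :
  subgroup P ->
  (forall g h m a, A g m -> gr_comp h a -> P (gm_act m a)) ->
  forall m a, internal_sum A m -> P (gm_act m a).
Proof.
move=> sP hP m a; have [P0 PB] := sP.
apply: (internal_sum_ind (P := [set m | P (gm_act m a)])).
  split => [|x y Px Py] /=; first by rewrite gm_act0l.
  by rewrite gm_actDl gm_actNl; apply: PB.
move=> g {}m Am /=; have := gr_span a.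
apply: (internal_sum_ind (P := [set a | P (gm_act m a)])).
  split => [|x y Px Py] /=; first by rewrite gm_act0r.
  by rewrite gm_actDr gm_actNr; apply: PB.
by move=> h {}a ha /=; apply: hP Am ha.
Qed.

Lemma gm_act1 g m : gm_comp g m -> gm_act m (gr_one R (gdom g)) = m.
Proof.
pose B g := [set m : M | gm_comp g m /\ gm_act m (gr_one R (gdom g)) = m].
have sB g' : subgroup (B g').
  have [c0 cB] := gm_comp_subgroup M g'.
  split; first by split => //; rewrite gm_act0l.
  move=> x y [cx ex] [cy ey]; split; first exact: cB.
  by rewrite gm_actDl gm_actNl ex ey.
have sum_B := internal_sum_subgroup sB.
have BT x : internal_sum B x.
  have : set_product (@gm_act _ _ M) setT setT x by rewrite gm_act_full.
  move=> [s [_ ->]]; apply: subgroup_sum => // -[y a] _ /=.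
  apply: (gm_act_ind sum_B _ _ (gm_span y)) => h k {}y {}a hy ka.
  have := gm_comp_act hy ka; case hk: (pcomp h k) => [l|] /= ly; last first.
    by rewrite ly; case: sum_B.
  apply: (internal_sum_comp sB (i := l)); split => //.
  have [hkE <-] := pcomp_eq hk.
  by rewrite gdom_comp// -gm_actA (gr_mulr1 ka).
move=> gm; have [f [df uf]] := gm_comp_direct m.
have [f1 [Bf1 ff1 mf1]] := BT m.
have [f2 [Af2 ff2 mf2]] : internal_sum
    (fun k => [set x | k = g /\ gm_comp g x] `|` [set 0]) m.
  exists (fun k => if k == g then m else 0); split.
  - by move=> k; case: eqP => [->|_]; [left|right].
  - apply: (sub_finite_set _ (finite_set1 g)) => k /=.
    by case: (k =P g) => // _; rewrite eqxx.
  - rewrite (fsum_eq (X := [fset g]%fset)) ?big_seq_fset1 ?eqxx// => k.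
    by rewrite inE; case: (k == g); rewrite ?eqxx.
have e1 : f = f1 by apply: uf; split => // k; case: (Bf1 k).
have e2 : f = f2.
  apply: uf; split => // k; case: (Af2 k) => [[->]//|->].
  by case: (gm_comp_subgroup M k).
have : f2 g = m.
  rewrite mf2 (fsum_eq (X := [fset g]%fset)) ?big_seq_fset1// => k.
  by rewrite inE; case: (Af2 k) => [[->]|->]; rewrite ?eqxx.
by rewrite -e2 e1 => <-; case: (Bf1 g).
Qed.

End ModuleTheory.

Section RegularModule.
Variables (G : groupoid) (R : grRing G).

Let act_full : set_product (@gr_mul _ R) setT setT = setT.
Proof.
apply/seteqP; split => // a _.
apply: (internal_sum_ind _ _ (gr_span a)).
  apply: set_product_subgroup => //; exact: gr_mulDl.
by move=> g x gx; rewrite -(gr_mulr1 gx); apply: set_product_mem.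
Qed.

Definition regular : grModule R :=
  GrModule (@gr_mulA _ R) (@gr_mulDl _ R) (@gr_mulDr _ R)
    (@gr_comp_subgroup _ R) (@gr_comp_direct _ R) (@gr_comp_mul _ R) act_full.

End RegularModule.

Section Shift.
Variables (G : groupoid) (R : grRing G) (M : grModule R) (s : G).

Definition shift_family (g : G) : set M :=
  ocomponent (@gm_comp _ _ M) (pcomp s g).

(* The underlying group of M(s): the sum of the M_(sg) inside M. *)
Definition shift_pred : {pred M} :=
  [pred m | `[< internal_sum shift_family m >]].

Lemma shift_family_subgroup g : subgroup (shift_family g).
Proof.
rewrite /shift_family; case: pcomp => [h|]; first exact: gm_comp_subgroup.
by split => //= _ _ -> ->; rewrite subr0.
Qed.

Lemma shift_pred_closed : zmod_closed shift_pred.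
Proof.
have [S0 SB] := internal_sum_subgroup shift_family_subgroup.
split; first exact/asboolP.
by move=> x y /asboolP Sx /asboolP Sy; apply/asboolP/SB.
Qed.

HB.instance Definition _ := GRing.isZmodClosed.Build M shift_pred
  shift_pred_closed.

Record shift_sort : Type :=
  ShiftSort { shift_val :> M; shift_valP : shift_val \in shift_pred }.

HB.instance Definition _ := [isSub for shift_val].
HB.instance Definition _ := [Choice of shift_sort by <:].
HB.instance Definition _ := [SubChoice_isSubZmodule of shift_sort by <:].

Lemma shift_act_family g h m a : shift_family g m -> gr_comp h a ->
  ocomponent shift_family (pcomp g h) (gm_act m a).
Proof.
rewrite /shift_family; case sg: (pcomp s g) => [k|] /=; last first.
  move=> -> _; rewrite gm_act0l; case: pcomp => [l|] //=.
  by case: (shift_family_subgroup l).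
have [sgd <-] := pcomp_eq sg => km ha; have := gm_comp_act km ha.
rewrite /pcomp gdom_comp//; case: (gdom g =P gcod h) => //= gh.
by rewrite gcod_comp// sgd eqxx gcompA.
Qed.

Lemma shift_act_closed m a : m \in shift_pred -> gm_act m a \in shift_pred.
Proof.
move=> /asboolP Sm; apply/asboolP; have sS := shift_family_subgroup.
have sumS := internal_sum_subgroup sS.
apply: (gm_act_ind sumS _ _ Sm) => g h {Sm}m {}a gm ha.
have := shift_act_family gm ha; case: pcomp => [k|/= ->]; last by case: sumS.
exact: (internal_sum_comp sS).
Qed.

Definition shift_act (m : shift_sort) (a : R) : shift_sort :=
  ShiftSort (shift_act_closed a (shift_valP m)).

Definition shift_comp (g : G) : set shift_sort :=
  [set m | shift_family g (shift_val m)].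

Let valD (x y : shift_sort) : shift_val (x + y) = shift_val x + shift_val y.
Proof. by []. Qed.

Let valB (x y : shift_sort) : shift_val (x - y) = shift_val x - shift_val y.
Proof. by []. Qed.

Let val0 : shift_val 0 = 0. Proof. by []. Qed.

Lemma shift_actA m a b :
  shift_act m (gr_mul a b) = shift_act (shift_act m a) b.
Proof. by apply/val_inj; rewrite /= gm_actA. Qed.

Lemma shift_actDl m n a : shift_act (m + n) a = shift_act m a + shift_act n a.
Proof. by apply/val_inj; rewrite /= gm_actDl. Qed.

Lemma shift_actDr m a b : shift_act m (a + b) = shift_act m a + shift_act m b.
Proof. by apply/val_inj; rewrite /= gm_actDr. Qed.

Lemma shift_comp_subgroup g : subgroup (shift_comp g).
Proof.
have [S0 SB] := shift_family_subgroup g.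
by split => [|x y Sx Sy]; [exact: S0|exact: SB].
Qed.

Lemma shift_span m : internal_sum shift_comp m.
Proof.
have sC := internal_sum_subgroup shift_comp_subgroup.
have : exists n : shift_sort, shift_val n = shift_val m /\
    internal_sum shift_comp n.
  have /asboolP := shift_valP m; apply: (internal_sum_ind
    (P := [set v | exists n : shift_sort, shift_val n = v /\
                   internal_sum shift_comp n])).
    split; first by exists 0; split => //; case: sC.
    move=> _ _ [x [<- Sx]] [y [<- Sy]]; exists (x - y); split => //.
    by case: sC => _; apply.
  move=> g v gv.
  have Sv : v \in shift_pred.
    by apply/asboolP; exact: (internal_sum_comp shift_family_subgroup gv).
  exists (ShiftSort Sv); split => //.
  exact: (internal_sum_comp shift_comp_subgroup (i := g)).
by move=> [n [/val_inj <-]].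
Qed.

Lemma shift_comp_direct : internal_direct_sum shift_comp.
Proof.
apply: internal_direct_sumI.
- exact: shift_comp_subgroup.
- exact: shift_span.
- move=> f [Sf ff f0] i; apply/val_inj.
  have fsupp : finite_set [set j | shift_val (f j) != 0].
    by apply: sub_finite_set ff => j /=; apply: contraNN => /eqP->.
  apply: (internal_direct_sum_indep (@gm_comp_subgroup _ _ M)
    (@gm_comp_direct _ _ M) (h := pcomp s) (f := fun j => shift_val (f j))).
  + by move=> j k l; exact: pcomp_inj.
  + exact: Sf.
  + exact: fsupp.
  + by rewrite -(fsum_morph valD ff) -f0.
Qed.

Lemma shift_comp_act g h m a : shift_comp g m -> gr_comp h a ->
  ocomponent shift_comp (pcomp g h) (shift_act m a).
Proof.
move=> gm ha; have := shift_act_family gm ha.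
by case: pcomp => [k //|/= e]; apply/val_inj.
Qed.

Lemma shift_act_full : set_product shift_act setT setT = setT.
Proof.
apply/seteqP; split => // m _.
apply: (internal_sum_ind _ _ (shift_span m)).
  apply: set_product_subgroup => //; exact: shift_actDl.
move=> g x gx.
have -> : x = shift_act x (gr_one R (gdom g)).
  apply/val_inj => /=; move: gx; rewrite /shift_comp /shift_family /=.
  case sg: (pcomp s g) => [k|] /=; last by move=> ->; rewrite gm_act0l.
  by have [sgd <-] := pcomp_eq sg => /gm_act1; rewrite gdom_comp.
exact: set_product_mem.
Qed.

Definition shift : grModule R :=
  GrModule shift_actA shift_actDl shift_actDr shift_comp_subgroup
    shift_comp_direct shift_comp_act shift_act_full.

End Shift.

Section FinSuppFamily.
Variables (J : choiceType) (N : J -> zmodType).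

Record fsfam : Type := FsFam {
  fsval :> forall j, N j;
  fsvalP : finite_set [set j | fsval j != 0]
}.

HB.instance Definition _ := gen_eqMixin fsfam.
HB.instance Definition _ := gen_choiceMixin fsfam.

Lemma fsfamP (f g : fsfam) : (forall j, f j = g j) -> f = g.
Proof.
case: f g => [f fP] [g gP] /= fg.
have E : f = g by apply/functional_extensionality_dep.
by case: _ / E gP => gP; congr FsFam; exact: Prop_irrelevance.
Qed.

Let zeroP : finite_set [set j | (0 : N j) != 0].
Proof. by apply: (sub_finite_set _ (@finite_set0 J)) => j /=; rewrite eqxx. Qed.

Let oppP (f : fsfam) : finite_set [set j | - f j != 0].
Proof. by apply: sub_finite_set (fsvalP f) => j /=; rewrite oppr_eq0. Qed.

Let addP (f g : fsfam) : finite_set [set j | f j + g j != 0].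
Proof.
have [X XP] := finite_set_sub2 (fsvalP f) (fsvalP g).
apply: (sub_finite_set _ (finite_fset X)) => j /= fg; apply: XP => /=.
case: (eqVneq (f j) 0) fg => [->|]; last by left.
by rewrite add0r; right.
Qed.

Definition fs_zero : fsfam := FsFam zeroP.
Definition fs_opp (f : fsfam) : fsfam := FsFam (oppP f).
Definition fs_add (f g : fsfam) : fsfam := FsFam (addP f g).

Let fs_addA : associative fs_add.
Proof. by move=> f g h; apply: fsfamP => j /=; rewrite addrA. Qed.
Let fs_addC : commutative fs_add.
Proof. by move=> f g; apply: fsfamP => j /=; rewrite addrC. Qed.
Let fs_add0 : left_id fs_zero fs_add.
Proof. by move=> f; apply: fsfamP => j /=; rewrite add0r. Qed.
Let fs_addN : left_inverse fs_zero fs_opp fs_add.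
Proof. by move=> f; apply: fsfamP => j /=; rewrite addNr. Qed.

HB.instance Definition _ :=
  GRing.isZmodule.Build fsfam fs_addA fs_addC fs_add0 fs_addN.

Lemma fsval0 j : (0 : fsfam) j = 0. Proof. by []. Qed.
Lemma fsvalD (f g : fsfam) j : (f + g) j = f j + g j. Proof. by []. Qed.
Lemma fsvalN (f : fsfam) j : (- f) j = - f j. Proof. by []. Qed.
Lemma fsval_sum (T : Type) (r : seq T) (F : T -> fsfam) j :
  (\sum_(i <- r) F i) j = \sum_(i <- r) F i j.
Proof. by elim/big_rec2: _ => // i x y _ <-. Qed.

Let singleP j (x : N j) :
  finite_set [set k | @dfwith J N (fun=> 0) j x k != 0].
Proof.
apply: (sub_finite_set _ (finite_set1 j)) => k /=.
by case: dfwithP => // i _; rewrite eqxx.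
Qed.

Definition fs_single j (x : N j) : fsfam := FsFam (singleP x).

Lemma fs_singleD j (x y : N j) :
  fs_single (x + y) = fs_single x + fs_single y.
Proof.
apply: fsfamP => k; rewrite fsvalD /=.
case: (eqVneq j k) => [<-|jk]; first by rewrite !dfwith_in.
by rewrite !dfwith_out// addr0.
Qed.

Lemma fs_single0 j : fs_single (0 : N j) = 0.
Proof.
by apply: (addrI (fs_single (0 : N j))); rewrite -fs_singleD !addr0.
Qed.

Lemma fs_singleN j (x : N j) : fs_single (- x) = - fs_single x.
Proof. by apply/eqP; rewrite -addr_eq0 -fs_singleD addNr fs_single0. Qed.

Lemma fs_single_sum (f : fsfam) (X : {fset J}) :
  (forall j, f j != 0 -> j \in X) -> f = \sum_(j <- X) fs_single (f j).
Proof.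
move=> XP; apply: fsfamP => j; rewrite fsval_sum.
case: (boolP (j \in X)) => jX.
  rewrite (bigD1_seq j)//= ?fset_uniq// dfwith_in big1 ?addr0// => k kj.
  by rewrite dfwith_out.
rewrite big_seq big1; last first.
  by move=> k kX; rewrite /= dfwith_out//; apply: contraNneq jX => <-.
by apply/eqP; apply: contraNT jX; exact: XP.
Qed.

Lemma fsfam_ind (P : set fsfam) : subgroup P ->
  (forall j (x : N j), P (fs_single x)) -> forall f, P f.
Proof.
move=> sP Ps f; have [X XP] := finite_set_sub (fsvalP f).
by rewrite (fs_single_sum XP); apply: subgroup_sum.
Qed.

End FinSuppFamily.

Section DirectSum.
Variables (G : groupoid) (R : grRing G) (J : choiceType) (N : J -> grModule R).

Local Notation carrier := (fsfam (fun j => gm_sort (N j) : zmodType)).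

Let actP (f : carrier) (a : R) : finite_set [set j | gm_act (f j) a != 0].
Proof.
apply: sub_finite_set (fsvalP f) => j /=; apply: contraNN => /eqP->.
by rewrite gm_act0l.
Qed.

Definition dsum_act (f : carrier) (a : R) : carrier := FsFam (actP f a).

Definition dsum_comp (g : G) : set carrier :=
  [set f | forall j, gm_comp g (f j)].

Lemma dsum_actA f a b : dsum_act f (gr_mul a b) = dsum_act (dsum_act f a) b.
Proof. by apply: fsfamP => j; rewrite /= gm_actA. Qed.

Lemma dsum_actDl f g a : dsum_act (f + g) a = dsum_act f a + dsum_act g a.
Proof. by apply: fsfamP => j; rewrite fsvalD /= gm_actDl. Qed.

Lemma dsum_actDr f a b : dsum_act f (a + b) = dsum_act f a + dsum_act f b.
Proof. by apply: fsfamP => j; rewrite fsvalD /= gm_actDr. Qed.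

Lemma dsum_comp_subgroup g : subgroup (dsum_comp g).
Proof.
split => [j|x y hx hy j]; first by case: (gm_comp_subgroup (N j) g).
by case: (gm_comp_subgroup (N j) g) => _; apply.
Qed.

Lemma dsum_single g j (x : N j) : gm_comp g x -> dsum_comp g (fs_single x).
Proof.
move=> gx k /=; case: dfwithP => // i _.
by case: (gm_comp_subgroup (N i) g).
Qed.

Lemma dsum_ind (P : set carrier) : subgroup P ->
  (forall g j (x : N j), gm_comp g x -> P (fs_single x)) -> forall f, P f.
Proof.
move=> sP Ps; have [P0 PB] := sP; apply: fsfam_ind => // j x.
apply: (internal_sum_ind (P := [set x | P (fs_single x)]) _ _ (gm_span x)).
  split => [|y z Py Pz] /=; first by rewrite fs_single0.
  by rewrite fs_singleD fs_singleN; exact: PB.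
by move=> g y; exact: Ps.
Qed.

Lemma dsum_comp_direct : internal_direct_sum dsum_comp.
Proof.
apply: internal_direct_sumI.
- exact: dsum_comp_subgroup.
- apply: dsum_ind; first exact: internal_sum_subgroup dsum_comp_subgroup.
  move=> g j x gx; apply: (internal_sum_comp dsum_comp_subgroup (i := g)).
  exact: dsum_single.
- move=> f [Sf ff f0] i; apply: fsfamP => j.
  have fsupp : finite_set [set i | f i j != 0].
    by apply: sub_finite_set ff => k /=; apply: contraNN => /eqP->.
  apply: (internal_direct_sum_indep (@gm_comp_subgroup _ _ (N j))
    (@gm_comp_direct _ _ (N j)) (h := Some) (f := fun i => f i j)) => //.
  + by move=> k l m [->] [->].
  + by move=> k; exact: Sf.
  + rewrite -(fsum_morph (phi := fun f : carrier => f j) _ ff) -?f0//.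
Qed.

Lemma dsum_comp_act g h f a : dsum_comp g f -> gr_comp h a ->
  ocomponent dsum_comp (pcomp g h) (dsum_act f a).
Proof.
move=> gf ha.
have H j : ocomponent (@gm_comp _ _ (N j)) (pcomp g h) (gm_act (f j) a).
  exact: gm_comp_act.
by case: pcomp H => [k|] H //=; apply: fsfamP.
Qed.

Lemma dsum_act_full : set_product dsum_act setT setT = setT.
Proof.
apply/seteqP; split => // f _; apply: dsum_ind.
  apply: set_product_subgroup => //; exact: dsum_actDl.
move=> g j x gx.
have -> : fs_single x = dsum_act (fs_single x) (gr_one R (gdom g)).
  apply: fsfamP => k /=; case: dfwithP => [|i _]; first by rewrite gm_act1.
  by rewrite gm_act0l.
exact: set_product_mem.
Qed.

Definition direct_sum : grModule R :=
  GrModule dsum_actA dsum_actDl dsum_actDr dsum_comp_subgroup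
    dsum_comp_direct dsum_comp_act dsum_act_full.

End DirectSum.

Section RingTheory.
Variables (G : groupoid) (R : grRing G).
Implicit Types a b : R.

Lemma gr_mul0r a : gr_mul 0 a = 0.
Proof. exact: (gm_act0l (regular R)). Qed.

Lemma gr_mulr0 a : gr_mul a 0 = 0.
Proof. exact: (gm_act0r (M := regular R)). Qed.

Lemma gr_comp_ocomp (o : option G) : subgroup (ocomponent (@gr_comp _ R) o).
Proof.
case: o => [g|] /=; first exact: gr_comp_subgroup.
by split => // _ _ -> ->; rewrite subr0.
Qed.

Lemma gr_mul_suml (T : Type) (r : seq T) (F : T -> R) a :
  gr_mul (\sum_(i <- r) F i) a = \sum_(i <- r) gr_mul (F i) a.
Proof.
apply: (big_morph (fun x => gr_mul x a)); last exact: gr_mul0r.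
by move=> x y; rewrite gr_mulDl.
Qed.

Lemma gr_mul_sumr (T : Type) (r : seq T) (F : T -> R) a :
  gr_mul a (\sum_(i <- r) F i) = \sum_(i <- r) gr_mul a (F i).
Proof.
apply: (big_morph (fun x => gr_mul a x)); last exact: gr_mulr0.
by move=> x y; rewrite gr_mulDr.
Qed.

End RingTheory.

Definition gr_supp (G : groupoid) (R : grRing G) : set G :=
  [set g | @gr_comp _ R g <> [set 0]].

Definition d_finite (G : groupoid) (I : choiceType) (s : I -> G) : Prop :=
  forall f : gobj G, finite_set [set i | gdom (s i) = f].

Section MatrixRing.
Variables (G : groupoid) (D : grRing G) (e0 : gobj G).
Hypothesis suppD : gr_supp D `<=` [set g | gcod g = e0 /\ gdom g = e0].
Variables (I : choiceType) (s : I -> G).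
Hypothesis scod : forall i, gcod (s i) = e0.
Hypothesis sfin : d_finite s.

Local Notation mx := (fsfam (fun _ : I * I => gr_sort D : zmodType)).

(* The product (s i) g (s j)^-1 when it is defined. *)
Definition mx_degree (i j : I) (g : G) : option G :=
  obind (fun t => pcomp t (ginv (s j))) (pcomp (s i) g).

Definition mx_comp (g : G) : set mx :=
  [set a | forall i j, ocomponent (@gr_comp _ D) (mx_degree i j g) (a (i, j))].

Definition mx_mul_fun (a b : mx) (p : I * I) : D :=
  \sum_(k \in [set: I]) gr_mul (a (p.1, k)) (b (k, p.2)).

Definition mx_one_fun (e : gobj G) (p : I * I) : D :=
  if (p.1 == p.2) && (gdom (s p.1) == e) then gr_one D e0 else 0.

Let idx_bound (a : mx) : exists X : {fset I}, forall i j,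
  a (i, j) != 0 -> (i \in X) && (j \in X).
Proof.
have [Y YP] := finite_set_sub (fsvalP a).
exists ([fset p.1 | p in Y] `|` [fset p.2 | p in Y])%fset => i j aij.
have ijY := YP _ aij; rewrite !inE.
by apply/andP; split; apply/orP; [left|right]; apply/imfsetP; exists (i, j).
Qed.

Let mx_mulE (a b : mx) (X : {fset I}) :
  (forall i j, a (i, j) != 0 -> j \in X) \/
  (forall i j, b (i, j) != 0 -> i \in X) ->
  forall i j, mx_mul_fun a b (i, j) =
    \sum_(k <- X) gr_mul (a (i, k)) (b (k, j)).
Proof.
move=> XP i j; apply: fsum_eq => k abk; case: XP => [aX|bX].
  by apply: (aX i); apply: contraNneq abk => ->; rewrite gr_mul0r.
by apply: (bX k j); apply: contraNneq abk => ->; rewrite gr_mulr0.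
Qed.

Let mx_mulP (a b : mx) : finite_set [set p | mx_mul_fun a b p != 0].
Proof.
have [X XP] := idx_bound a; have [Y YP] := idx_bound b.
apply: (sub_finite_set _ (finite_fset (X `*` Y)%fset)) => -[i j] /=.
rewrite (@mx_mulE a b X) => [|]; last by left => k l /XP/andP[].
apply: contraNT; rewrite inE /= negb_and => H.
rewrite big1// => k _; case/orP: H => [iX|jY].
  rewrite (_ : a (i, k) = 0) ?gr_mul0r//; apply/eqP; apply: contraNT iX.
  by move=> /XP/andP[].
rewrite (_ : b (k, j) = 0) ?gr_mulr0//; apply/eqP; apply: contraNT jY.
by move=> /YP/andP[].
Qed.

Definition mx_mul (a b : mx) : mx := FsFam (mx_mulP a b).

Let mx_oneP (e : gobj G) : finite_set [set p | mx_one_fun e p != 0].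
Proof.
apply: (sub_finite_set _ (finite_setX (sfin e) (sfin e))) => -[i j].
rewrite /mx_one_fun /=; case: (i =P j) => [<-|_] /=; last by rewrite eqxx.
by case: (gdom (s i) =P e) => [se _|_]; last by rewrite eqxx.
Qed.

Definition mx_one (e : gobj G) : mx := FsFam (mx_oneP e).

Lemma mx_mulA : associative mx_mul.
Proof.
move=> a b c; apply: fsfamP => -[i j] /=.
have [X XP] := idx_bound a; have [Y YP] := idx_bound c.
rewrite (@mx_mulE a (mx_mul b c) X); last by left => k l /XP/andP[].
rewrite (@mx_mulE (mx_mul a b) c Y); last by right => k l /YP/andP[].
under eq_bigr => k _.
  rewrite /= (@mx_mulE b c Y); last by right => ? ? /YP/andP[].
  rewrite gr_mul_sumr; over.
under [RHS]eq_bigr => k _.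
  rewrite /= (@mx_mulE a b X); last by left => ? ? /XP/andP[].
  rewrite gr_mul_suml; over.
rewrite exchange_big; apply: eq_bigr => l _; apply: eq_bigr => k _.
by rewrite gr_mulA.
Qed.

Lemma mx_mulDl : left_distributive mx_mul +%R.
Proof.
move=> a b c; apply: fsfamP => -[i j]; rewrite fsvalD /=.
have [X XP] := idx_bound c.
have H : forall k l, c (k, l) != 0 -> k \in X by move=> k l /XP/andP[].
rewrite !(@mx_mulE _ c X); try by right.
by rewrite -big_split; apply: eq_bigr => k _; rewrite fsvalD gr_mulDl.
Qed.

Lemma mx_mulDr : right_distributive mx_mul +%R.
Proof.
move=> a b c; apply: fsfamP => -[i j]; rewrite fsvalD /=.
have [X XP] := idx_bound a.
have H : forall k l, a (k, l) != 0 -> l \in X by move=> k l /XP/andP[].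
rewrite !(@mx_mulE a _ X); try by left.
by rewrite -big_split; apply: eq_bigr => k _; rewrite fsvalD gr_mulDr.
Qed.

Lemma mx_degreeP i j g h : mx_degree i j g = Some h ->
  [/\ gdom (s i) = gcod g, gdom g = gdom (s j)
    & h = gcomp (gcomp (s i) g) (ginv (s j))].
Proof.
rewrite /mx_degree; case sg: pcomp => [t|//] /= /pcomp_eq[].
have [sgd <-] := pcomp_eq sg; rewrite gdom_comp// gcod_inv => gj <-.
by split.
Qed.

Lemma mx_degree_def i j g : gdom (s i) = gcod g -> gdom g = gdom (s j) ->
  mx_degree i j g = Some (gcomp (gcomp (s i) g) (ginv (s j))).
Proof.
move=> ig gj; rewrite /mx_degree (pcomp_def ig) /= pcomp_def//.
by rewrite gdom_comp// gcod_inv.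
Qed.

Lemma mx_degree_inj i j g g' h :
  mx_degree i j g = Some h -> mx_degree i j g' = Some h -> g = g'.
Proof.
rewrite /mx_degree; case sg: pcomp => [t|//] /= th.
case sg': pcomp => [t'|//] /= th'.
by apply: pcomp_inj sg _; rewrite (pcomp_injl th th').
Qed.

Lemma mx_comp_subgroup g : subgroup (mx_comp g).
Proof.
split => [|x y gx gy] i j; have [H0 HB] := gr_comp_ocomp D (mx_degree i j g).
  exact: H0.
exact: HB.
Qed.

Let suppD0 h (x : D) : gr_comp h x -> x <> 0 -> gcod h = e0 /\ gdom h = e0.
Proof. by move=> hx x0; apply: suppD => /seteqP[/(_ _ hx)]. Qed.

Lemma mx_single g i j h (x : D) : mx_degree i j g = Some h -> gr_comp h x ->
  mx_comp g (@fs_single (I * I)%type (fun=> gr_sort D : zmodType) (i, j) x).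
Proof.
move=> gh hx k l /=; case: (eqVneq (i, j) (k, l)) => [[<- <-]|ne].
  by rewrite dfwith_in gh.
by rewrite dfwith_out//; case: (gr_comp_ocomp D (mx_degree k l g)).
Qed.

Lemma mx_comp_direct : internal_direct_sum mx_comp.
Proof.
have sumC := internal_sum_subgroup mx_comp_subgroup.
apply: internal_direct_sumI; first exact: mx_comp_subgroup.
  apply: fsfam_ind => // -[i j] x; have := gr_span x.
  apply: (internal_sum_ind
    (P := [set x | internal_sum mx_comp (fs_single x)])).
    have [S0 SB] := sumC.
    split => [|y z Sy Sz] /=; first by rewrite fs_single0.
    by rewrite fs_singleD fs_singleN; exact: SB.
  move=> h y hy /=; have [->|y0] := eqVneq y 0.
    by rewrite fs_single0; case: sumC.
  have [hc hd] := suppD0 hy (elimN eqP y0).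
  have ih : gdom (ginv (s i)) = gcod h by rewrite gdom_inv scod hc.
  pose g := gcomp (gcomp (ginv (s i)) h) (s j).
  have hj : gdom (gcomp (ginv (s i)) h) = gcod (s j).
    by rewrite gdom_comp// scod hd.
  apply: (internal_sum_comp mx_comp_subgroup (i := g)).
  apply: (mx_single (h := h)) => //.
  have ig : gdom (s i) = gcod g by rewrite /g !gcod_comp// gcod_inv.
  rewrite mx_degree_def//; last by rewrite /g gdom_comp.
  congr Some; rewrite /g gcompA//; last by rewrite gcod_comp// gcod_inv.
  rewrite gcompVK; last by rewrite gdom_comp// gcod_comp// gcod_inv.
  by rewrite gcompA ?gcod_inv// gcompmV scod -hc gcomp1m.
move=> f [Cf ff f0] g; apply: fsfamP => -[i j].
have fsupp : finite_set [set k | f k (i, j) != 0].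
  by apply: sub_finite_set ff => k /=; apply: contraNN => /eqP->.
apply: (internal_direct_sum_indep (@gr_comp_subgroup _ D)
  (@gr_comp_direct _ D) (h := mx_degree i j) (f := fun k => f k (i, j))) => //.
- by move=> k l h; exact: mx_degree_inj.
- by move=> k; exact: Cf.
- by rewrite -(fsum_morph (phi := fun a : mx => a (i, j)) _ ff) -?f0.
Qed.

Lemma mx_comp_mul g h a b : mx_comp g a -> mx_comp h b ->
  ocomponent mx_comp (pcomp g h) (mx_mul a b).
Proof.
move=> ga hb.
have term i j k : gr_mul (a (i, k)) (b (k, j)) <> 0 -> exists u,
    [/\ pcomp g h = Some u & exists2 v, mx_degree i j u = Some v &
        gr_comp v (gr_mul (a (i, k)) (b (k, j)))].
  have := ga i k; case gik: (mx_degree i k g) => [x|] /= => [ax|->]; last first.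
    by rewrite gr_mul0r.
  have := hb k j; case hkj: (mx_degree k j h) => [y|] /= => [by_|->]; last first.
    by rewrite gr_mulr0.
  have [ig gk xE] := mx_degreeP gik; have [kh hj yE] := mx_degreeP hkj.
  have gh : gdom g = gcod h by rewrite gk.
  move=> _; exists (gcomp g h); split; first exact: pcomp_def.
  have xd : gdom x = e0.
    by rewrite xE gdom_comp ?gdom_inv// gdom_comp// gcod_inv.
  have yc : gcod y = e0.
    by rewrite yE !gcod_comp ?gcod_inv// gdom_comp.
  exists (gcomp x y); last first.
    by have := gr_comp_mul ax by_; rewrite pcomp_def// xd yc.
  rewrite mx_degree_def ?gcod_comp ?gdom_comp//; congr Some.
  by rewrite xE yE (gcomp_mid ig gk kh)// gcod_inv.
have [[u ghu]|gh0] := pselect (exists u, pcomp g h = Some u).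
  rewrite ghu /= => i j /=.
  apply: fsum_closed; first exact: gr_comp_ocomp.
  move=> k; have [->|/eqP ne] := eqVneq (gr_mul (a (i, k)) (b (k, j))) 0.
    by case: (gr_comp_ocomp D (mx_degree i j u)).
  have [u' [ghu' [v uv vk]]] := term i j k ne.
  by move: ghu'; rewrite ghu => -[->]; rewrite uv.
rewrite (_ : pcomp g h = None) /=; last first.
  by case E: (pcomp g h) => [u|//]; exfalso; apply: gh0; exists u.
apply: fsfamP => -[i j] /=.
rewrite /mx_mul_fun (fsum_eq (X := fset0)) ?big_seq_fset0// => k /eqP ne.
by have [u [ghu _]] := term i j k ne; exfalso; apply: gh0; exists u.
Qed.

Lemma mx_one_comp e : mx_comp (gid e) (mx_one e).
Proof.
move=> i j; rewrite /= /mx_one_fun /=.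
case: eqP => [<-|_] /=; last by case: (gr_comp_ocomp D (mx_degree i j (gid e))).
case: eqP => [ie|_]; last by case: (gr_comp_ocomp D (mx_degree i i (gid e))).
rewrite mx_degree_def ?gcod_id ?gdom_id//= -ie gcompm1 gcompmV scod.
exact: gr_one_comp.
Qed.

Lemma mx_mul1r g a : mx_comp g a -> mx_mul (mx_one (gcod g)) a = a.
Proof.
move=> ga; apply: fsfamP => -[i j] /=.
rewrite /mx_mul_fun (fsum_eq (X := [fset i]%fset)); last first.
  move=> k; rewrite inE /= /mx_one_fun /=; case: (eqVneq i k) => [->|_] //=.
  by rewrite gr_mul0r eqxx.
rewrite big_seq_fset1 /= /mx_one_fun /= eqxx /=.
have := ga i j; case gij: mx_degree => [h|] /=; last first.
  by move=> ->; rewrite gr_mulr0.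
have [ig gj hE] := mx_degreeP gij; rewrite ig eqxx => /gr_mul1r.
by rewrite hE !gcod_comp ?gdom_comp ?gcod_inv// scod.
Qed.

Lemma mx_mulr1 g a : mx_comp g a -> mx_mul a (mx_one (gdom g)) = a.
Proof.
move=> ga; apply: fsfamP => -[i j] /=.
rewrite /mx_mul_fun (fsum_eq (X := [fset j]%fset)); last first.
  move=> k; rewrite inE /= /mx_one_fun /=; case: (eqVneq k j) => [->|_] //=.
  by rewrite gr_mulr0 eqxx.
rewrite big_seq_fset1 /= /mx_one_fun /= eqxx /=.
have := ga i j; case gij: mx_degree => [h|] /=; last first.
  by move=> ->; rewrite gr_mul0r.
have [ig gj hE] := mx_degreeP gij; rewrite -gj eqxx => /gr_mulr1.
by rewrite hE gdom_comp ?gdom_inv ?gdom_comp ?gcod_inv// scod.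
Qed.

Definition matrix_ring : grRing G :=
  GrRing mx_mulA mx_mulDl mx_mulDr mx_comp_subgroup mx_comp_direct
    mx_comp_mul mx_one_comp mx_mul1r mx_mulr1.

End MatrixRing.

Definition gr_ring_iso (G : groupoid) (R S : grRing G) : Prop :=
  exists f : R -> S,
    [/\ bijective f, {morph f : x y / x + y},
        {morph f : x y / gr_mul x y}
      & forall g a, gr_comp g a -> gr_comp g (f a)].

Definition gr_module_iso (G : groupoid) (R : grRing G) (M N : grModule R) :
  Prop := exists f : M -> N,
    [/\ bijective f, {morph f : x y / x + y},
        forall m a, f (gm_act m a) = gm_act (f m) a
      & forall g m, gm_comp g m -> gm_comp g (f m)].

Definition graded_subset (G : groupoid) (V : zmodType) (A : G -> set V)
    (N : set V) : Prop :=
  N `<=` internal_sum (fun g => A g `&` N).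

Section ModuleProperties.
Variables (G : groupoid) (R : grRing G) (M : grModule R).

Definition submodule (N : set M) : Prop :=
  subgroup N /\ forall m a, N m -> N (gm_act m a).

Definition gr_submodule (N : set M) : Prop :=
  submodule N /\ graded_subset (@gm_comp _ _ M) N.

Definition gr_simple_module : Prop :=
  (exists m : M, m <> 0) /\
  forall N : set M, gr_submodule N -> N = [set 0] \/ N = [set: M].

Definition gr_artinian_module : Prop :=
  forall N : nat -> set M, (forall n, gr_submodule (N n)) ->
    (forall n, N n.+1 `<=` N n) ->
    exists n, forall m, (n <= m)%N -> N m = N n.

Definition faithful_module : Prop :=
  [set a : R | forall m : M, gm_act m a = 0] = [set 0].

Definition pseudo_basis (I : choiceType) (x : I -> M) (g : I -> G) : Prop :=
  [/\ forall i, gm_comp (g i) (x i) /\ x i <> 0,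
      forall N : set M, submodule N -> (forall i, N (x i)) -> N = [set: M]
    & forall a : I -> R,
        (forall i, exists b, a i = gr_mul (gr_one R (gdom (g i))) b) ->
        finite_set [set i | a i != 0] ->
        \sum_(i \in [set: I]) gm_act (x i) (a i) = 0 ->
        forall i, a i = 0].

Definition pseudo_free : Prop :=
  exists (I : choiceType) (x : I -> M) (g : I -> G), pseudo_basis x g.

Definition object_shift (e : gobj G) : grModule R := shift M (gid e).

End ModuleProperties.

Section RingProperties.
Variables (G : groupoid) (R : grRing G).

Definition gr_ideal (I : set R) : Prop :=
  [/\ subgroup I,
      forall a x, I x -> I (gr_mul a x) /\ I (gr_mul x a)
    & graded_subset (@gr_comp _ R) I].

Definition gr_simple : Prop :=
  (exists a : R, a <> 0) /\
  forall I : set R, gr_ideal I -> I = [set 0] \/ I = [set: R].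

(* As for prime rings in general, the zero ring is not gr-prime. *)
Definition gr_prime : Prop :=
  (exists a : R, a <> 0) /\
  forall I J : set R, gr_ideal I -> gr_ideal J ->
    I <> [set 0] -> J <> [set 0] ->
    set_product (@gr_mul _ R) I J <> [set 0].

Definition right_artinian : Prop :=
  forall e : gobj G, gr_artinian_module (object_shift (regular R) e).

Definition right_gr_primitive : Prop :=
  exists M : grModule R, gr_simple_module M /\ faithful_module M.

Definition pfm_ring : Prop := forall M : grModule R, pseudo_free M.

Definition component_division_ring (e : gobj G) : Prop :=
  gr_one R e <> 0 /\
  forall a : R, gr_comp (gid e) a -> a <> 0 ->
    exists b : R, [/\ gr_comp (gid e) b, gr_mul a b = gr_one R e
                    & gr_mul b a = gr_one R e].

Definition gr_division_ring : Prop :=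
  (exists a : R, a <> 0) /\
  forall (g : G) (a : R), gr_comp g a -> a <> 0 ->
    exists b : R, [/\ gr_comp (ginv g) b, gr_mul a b = gr_one R (gcod g)
                    & gr_mul b a = gr_one R (gdom g)].

End RingProperties.

(* Main.v *)
Require Import Defs.
From HB Require Import structures.
From mathcomp Require Import all_boot all_order all_algebra finmap.
From mathcomp Require Import boolp classical_sets functions cardinality fsbigop.

Set Implicit Arguments.
Unset Strict Implicit.
Unset Printing Implicit Defensive.

Import GRing.Theory.

Local Open Scope classical_set_scope.
Local Open Scope ring_scope.

(** Everything is reduced to one condition on an object [e]:

    - [right_simple_at R e]: the right ideal [1_e R] is gr-simple, that is,
      [1_e] is nonzero and every nonzero homogeneous [a] in [1_e R] has a right
      inverse, [a b = 1_e];
    - [full_at R e]: the idempotent [1_e] generates [R] as a two-sided ideal.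

    Suppose that some [e] satisfies both. Then every graded module [M] is
    generated by homogeneous elements [x] of domain [e], and for such [x], if
    nonzero, [1_e R] is mapped isomorphically onto [x R]. So [M] is a sum of
    gr-simple modules generated by elements that behave like vectors over a
    division ring: the exchange property ([exchange]) holds, Zorn's lemma gives
    a maximal independent family, and that family is a pseudo-basis
    ([pseudo_basis_at]). The same exchange property shows that a chain condition
    survives the adjunction of one vector ([dcc_below_adjoin]), whence [R] is
    right artinian. Gr-simplicity of [R] is immediate from the two conditions.

    For [M = R] the pseudo-basis [x] has coordinate forms, given by left
    multiplication with elements [y] of inverse degrees ([exists_dual_basis]):
    [y_i x_j] is [1_e] or [0], and [a] is the sum of the [x_i y_i a]. Then
    [a |-> (y_i a)_i] is an isomorphism from [R_R] to a direct sum of shifts of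
    [1_e R], and [a |-> (y_i a x_j)_(i,j)] is an isomorphism from [R] to a ring
    of matrices over the graded division ring [1_e R 1_e]. The elements [x_i]
    of codomain [e] form a basis of the gr-simple module [1_e R], so there is
    exactly one.

    It remains to find such an [e] under each hypothesis.

    - If [R] is gr-prime and all modules are pseudo-free, a gr-simple module has
      a pseudo-basis with one element, and the domain of its degree is an [e]
      with [1_e R] gr-simple; applied to the quotient of [R] by the ideal of
      [1_e], pseudo-freeness and primeness force that quotient to vanish.
    - If [R] is prime (in particular gr-simple or right gr-primitive) and right
      artinian, and [R_e] is a division ring, Brauer's argument on a minimal
      graded right ideal inside [1_e R] shows that it is all of [1_e R], and a
      minimal complement, in each [1_f R], of the ideal of [1_e] is zero because
      idempotents of that ideal can be split off
      ([division_right_simple], [right_simple_full]).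
    - In a matrix ring over a graded division ring [D], if [e] is hit by exactly
      one index [i], then [1_e] is the matrix unit at [(i, i)], and
      [right_simple_at] is the division property of [D].
    - If [1_e R] is gr-simple and [R] is gr-simple, or [R_R] is a direct sum of
      shifts of [1_e R], then [1_e] clearly generates [R]. *)

(** * Homogeneous components *)

Lemma additive0 (V W : zmodType) (f : V -> W) : {morph f : x y / x + y} ->
  f 0 = 0.
Proof. by move=> fD; apply: (addrI (f 0)); rewrite -fD !addr0. Qed.

Lemma additiveN (V W : zmodType) (f : V -> W) : {morph f : x y / x + y} ->
  {morph f : x / - x}.
Proof.
by move=> fD x; apply/eqP; rewrite -addr_eq0 -fD addNr (additive0 fD).
Qed.

Lemma subgroup_ker (V W : zmodType) (f : V -> W) : {morph f : x y / x + y} ->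
  subgroup [set x | f x = 0].
Proof.
move=> fD; split => [|x y /= fx fy]; first exact: additive0.
by rewrite fD additiveN// fx fy subrr.
Qed.

Lemma subgroup_preim (V W : zmodType) (f : V -> W) (P : set W) :
  {morph f : x y / x + y} -> subgroup P -> subgroup (f @^-1` P).
Proof.
move=> fD [P0 PB]; split => /= [|x y fx fy]; first by rewrite additive0.
by rewrite fD additiveN//; exact: PB.
Qed.

Lemma subgroup_all (V : zmodType) (T : Type) (P : T -> set V) :
  (forall t, subgroup (P t)) -> subgroup [set v | forall t, P t v].
Proof.
move=> sP; split => [t|x y Px Py t]; first by case: (sP t).
by case: (sP t) => _; apply.
Qed.

Lemma subgroup0 (V : zmodType) : subgroup [set (0 : V)].
Proof. by split => // _ _ -> ->; rewrite subr0. Qed.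

Lemma eq_fsum (I : choiceType) (V : zmodType) (f h : I -> V) : f =1 h ->
  \sum_(i \in [set: I]) f i = \sum_(i \in [set: I]) h i.
Proof. by move=> /funext->. Qed.

Section Components.
Variables (I : choiceType) (V : zmodType) (A : I -> set V).

(** The homogeneous components of [v], chosen from the existence statement of
    the decomposition so that they form a function of [v]. *)
Definition hcomp (v : V) : I -> V :=
  if pselect (exists f, decomposition A v f) is left ex then projT1 (cid ex)
  else fun=> 0.

Hypothesis sA : forall i, subgroup (A i).
Hypothesis dA : internal_direct_sum A.

Lemma hcompP v : decomposition A v (hcomp v).
Proof.
rewrite /hcomp; case: pselect => [ex|nex]; first by case: cid.
by exfalso; apply: nex; have [f [df _]] := dA v; exists f.
Qed.

Lemma hcomp_unique v f : decomposition A v f -> hcomp v = f.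
Proof.
move=> df; have [f' [_ uf]] := dA v.
by rewrite -(uf _ df) -(uf _ (hcompP v)).
Qed.

Lemma hcomp_in v i : A i (hcomp v i).
Proof. by have [] := hcompP v. Qed.

Lemma hcomp_finite v : finite_set [set i | hcomp v i != 0].
Proof. by have [] := hcompP v. Qed.

Lemma hcomp_sum v : v = \sum_(i \in [set: I]) hcomp v i.
Proof. by have [] := hcompP v. Qed.

Lemma hcompB u v i : hcomp (u - v) i = hcomp u i - hcomp v i.
Proof.
suff -> : hcomp (u - v) = fun i => hcomp u i - hcomp v i by [].
apply: hcomp_unique.
have [X XP] := finite_set_sub2 (hcomp_finite u) (hcomp_finite v).
have BX j : hcomp u j - hcomp v j != 0 -> j \in X.
  move=> uv; apply: XP => /=; case: (eqVneq (hcomp u j) 0) uv => [->|];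
    last by left.
  by rewrite sub0r oppr_eq0; right.
split.
- by move=> j; case: (sA j) => _; apply; exact: hcomp_in.
- exact: (sub_finite_set BX (finite_fset X)).
- have uX j : hcomp u j != 0 -> j \in X by move=> uj; apply: XP; left.
  have vX j : hcomp v j != 0 -> j \in X by move=> vj; apply: XP; right.
  by rewrite (fsum_eq BX) sumrB -(fsum_eq uX) -(fsum_eq vX) -!hcomp_sum.
Qed.

Lemma hcomp0 i : hcomp 0 i = 0.
Proof. by rewrite -{1}(subrr (0 : V)) hcompB subrr. Qed.

Lemma hcompN v i : hcomp (- v) i = - hcomp v i.
Proof. by rewrite -[- v]sub0r hcompB hcomp0 sub0r. Qed.

Lemma hcompD i : {morph hcomp^~ i : u v / u + v}.
Proof. by move=> u v /=; rewrite -[v in LHS]opprK hcompB hcompN opprK. Qed.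

Lemma hcomp_homog i v : A i v -> hcomp v = fun j => if j == i then v else 0.
Proof.
move=> iv; apply: hcomp_unique; split.
- by move=> j; case: eqP => [->//|_]; case: (sA j).
- apply: (sub_finite_set _ (finite_set1 i)) => j /=.
  by case: (j =P i) => // _; rewrite eqxx.
- rewrite (fsum_eq (X := [fset i]%fset)) ?big_seq_fset1 ?eqxx// => j.
  by rewrite inE; case: (j == i); rewrite ?eqxx.
Qed.

Lemma hcomp_id i v : A i v -> hcomp v i = v.
Proof. by move=> /hcomp_homog->; rewrite eqxx. Qed.

Lemma hcomp_out i j v : A i v -> j <> i -> hcomp v j = 0.
Proof. by move=> /hcomp_homog-> /eqP/negPf->. Qed.

Lemma homog_ind (P : set V) : subgroup P -> (forall i v, A i v -> P v) ->
  forall v, P v.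
Proof.
move=> sP AP v; rewrite (hcomp_sum v); apply: fsum_closed => // i.
exact: AP (hcomp_in v i).
Qed.

Lemma homog_degree i j v : A i v -> A j v -> v <> 0 -> i = j.
Proof.
move=> iv jv v0; apply: contrapT => ij; apply: v0.
by rewrite -(hcomp_id iv); exact: hcomp_out jv ij.
Qed.

Lemma hcomp_neq0 v : v <> 0 -> exists i, hcomp v i <> 0.
Proof.
move=> v0; apply: contrapT => h; apply: v0; rewrite (hcomp_sum v).
rewrite (fsum_eq (X := fset0)) ?big_seq_fset0// => i /eqP hi.
by exfalso; apply: h; exists i.
Qed.

End Components.

Lemma graded_hcomp (G : groupoid) (V : zmodType) (A : G -> set V) (N : set V) :
  internal_direct_sum A -> graded_subset A N ->
  forall v g, N v -> N (hcomp A v g).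
Proof.
move=> dA gN v g /gN [f [Af ff vf]].
rewrite (@hcomp_unique _ _ A dA v f); first by case: (Af g).
by split => // h; case: (Af h).
Qed.

Lemma hcomp_graded (G : groupoid) (V : zmodType) (A : G -> set V) (N : set V) :
  internal_direct_sum A -> (forall v g, N v -> N (hcomp A v g)) ->
  graded_subset A N.
Proof.
move=> dA gN v Nv; exists (hcomp A v); split; last exact: hcomp_sum.
  by move=> g; split; [exact: hcomp_in|exact: gN].
exact: hcomp_finite.
Qed.


Lemma hcomp_morph (I : choiceType) (V W : zmodType) (A : I -> set V)
    (B : I -> set W) (f : V -> W) :
  internal_direct_sum A -> internal_direct_sum B -> {morph f : x y / x + y} ->
  (forall i v, A i v -> B i (f v)) ->
  forall v i, hcomp B (f v) i = f (hcomp A v i).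
Proof.
move=> dA dB fD fAB v i.
have f0 := additive0 fD.
suff -> : hcomp B (f v) = f \o hcomp A v by [].
apply: hcomp_unique => //; split.
- by move=> k; apply: fAB; exact: hcomp_in.
- apply: sub_finite_set (hcomp_finite dA v) => k /=.
  by apply: contraNN => /eqP->; rewrite f0.
- by rewrite {1}(hcomp_sum dA v) (fsum_morph fD (hcomp_finite dA v)).
Qed.

(** Components commute with a degree-preserving map, and an injective one thus
    reflects degrees; in particular the inverse of a graded isomorphism is
    graded. *)
Lemma inj_homog (I : choiceType) (V W : zmodType) (A : I -> set V)
    (B : I -> set W) (f : V -> W) :
  internal_direct_sum A -> (forall i, subgroup (B i)) ->
    internal_direct_sum B ->
  injective f -> {morph f : x y / x + y} ->
  (forall i v, A i v -> B i (f v)) ->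
  forall i v, B i (f v) -> A i v.
Proof.
move=> dA sB dB injf fD fAB i v Bv.
suff -> : v = hcomp A v i by exact: hcomp_in.
by apply: injf; rewrite -(hcomp_morph dA dB fD fAB) hcomp_id.
Qed.

(** * Graded rings and modules *)

Section Degrees.
Variables (G : groupoid) (R : grRing G) (M : grModule R).
Implicit Types (m : M) (a b : R) (g h : G).

Lemma gm_comp_actE g h m a : gm_comp g m -> gr_comp h a -> gdom g = gcod h ->
  gm_comp (gcomp g h) (gm_act m a).
Proof. by move=> gm ha gh; have := gm_comp_act gm ha; rewrite pcomp_def. Qed.

Lemma gm_act_eq0 g h m a : gm_comp g m -> gr_comp h a -> gdom g <> gcod h ->
  gm_act m a = 0.
Proof.
by move=> gm ha gh; have := gm_comp_act gm ha; rewrite /Defs.pcomp;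
  case: (gdom g =P gcod h) => /=.
Qed.

Lemma gm_homog_ind (P : set M) : subgroup P ->
  (forall g m, gm_comp g m -> P m) ->
  forall m, P m.
Proof. by move=> sP hP; exact: (homog_ind (@gm_comp_direct _ _ M) sP). Qed.

Lemma gr_homog_ind (P : set R) : subgroup P ->
  (forall g a, gr_comp g a -> P a) ->
  forall a, P a.
Proof. by move=> sP hP; exact: (homog_ind (@gr_comp_direct _ R) sP). Qed.

Definition mproj m : G -> M := hcomp (@gm_comp _ _ M) m.
Definition rproj a : G -> R := hcomp (@gr_comp _ R) a.

Lemma mprojP m g : gm_comp g (mproj m g).
Proof. exact: hcomp_in (@gm_comp_direct _ _ M) _ _. Qed.

Lemma rprojP a g : gr_comp g (rproj a g).
Proof. exact: hcomp_in (@gr_comp_direct _ R) _ _. Qed.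

Lemma mprojD g : {morph mproj^~ g : m n / m + n}.
Proof. exact: (hcompD (@gm_comp_subgroup _ _ M) (@gm_comp_direct _ _ M)). Qed.

Lemma rprojD g : {morph rproj^~ g : a b / a + b}.
Proof. exact: (hcompD (@gr_comp_subgroup _ R) (@gr_comp_direct _ R)). Qed.

Lemma mproj_id g m : gm_comp g m -> mproj m g = m.
Proof. exact: (hcomp_id (@gm_comp_subgroup _ _ M) (@gm_comp_direct _ _ M)). Qed.

Lemma mproj_out g h m : gm_comp g m -> h <> g -> mproj m h = 0.
Proof. exact: (hcomp_out (@gm_comp_subgroup _ _ M) (@gm_comp_direct _ _ M)).
Qed.

Lemma rproj_id g a : gr_comp g a -> rproj a g = a.
Proof. exact: (hcomp_id (@gr_comp_subgroup _ R) (@gr_comp_direct _ R)). Qed.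

Lemma rproj_out g h a : gr_comp g a -> h <> g -> rproj a h = 0.
Proof. exact: (hcomp_out (@gr_comp_subgroup _ R) (@gr_comp_direct _ R)). Qed.

Lemma mproj_neq0 m : m <> 0 -> exists g, mproj m g <> 0.
Proof. exact: (hcomp_neq0 (@gm_comp_direct _ _ M)). Qed.

Lemma gm_comp0 g : gm_comp g (0 : M).
Proof. by case: (gm_comp_subgroup M g). Qed.

Lemma gr_comp0 g : gr_comp g (0 : R).
Proof. by case: (gr_comp_subgroup R g). Qed.

Lemma gm_actBl m n a : gm_act (m - n) a = gm_act m a - gm_act n a.
Proof. by rewrite gm_actDl gm_actNl. Qed.

Lemma gm_actBr m a b : gm_act m (a - b) = gm_act m a - gm_act m b.
Proof. by rewrite gm_actDr gm_actNr. Qed.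

Lemma gm_act_suml (T : Type) (r : seq T) (F : T -> M) a :
  gm_act (\sum_(i <- r) F i) a = \sum_(i <- r) gm_act (F i) a.
Proof.
apply: (big_morph (fun x => gm_act x a)); last exact: gm_act0l.
by move=> x y; rewrite gm_actDl.
Qed.

(** A homogeneous element acts by a map that shifts degrees, so it commutes with
    taking homogeneous components. *)
Lemma mproj_act g h m a : gm_comp g m -> gcod g = gcod h ->
  mproj (gm_act m a) h = gm_act m (rproj a (gcomp (ginv g) h)).
Proof.
move=> gm gh; pose k := gcomp (ginv g) h.
have ck : gcod k = gdom g by rewrite gcod_comp ?gcod_inv ?gdom_inv.
have gk : gcomp g k = h.
  by rewrite /k gcompA ?gcod_inv ?gdom_inv// gcompmV gh gcomp1m.
apply/eqP; rewrite -subr_eq0; apply/eqP.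
move: a; apply: gr_homog_ind.
  apply: subgroup_ker => a b; rewrite gm_actDr mprojD rprojD gm_actDr.
  by rewrite opprD addrACA.
move=> l a la /=; have rl x : rproj a x = if x == l then a else 0.
  by rewrite /rproj (hcomp_homog (@gr_comp_subgroup _ R) (@gr_comp_direct _ R)
    la).
rewrite rl; have [gl|gl] := pselect (gdom g = gcod l); last first.
  rewrite (gm_act_eq0 gm la gl); case: eqP => [kl|_].
    by case: gl; rewrite -kl -ck.
  by rewrite gm_act0r subr0 mproj_id//; exact: gm_comp0.
have al := gm_comp_actE gm la gl.
case: eqP => [kl|kl]; first by rewrite mproj_id ?subrr// -gk /k kl.
rewrite gm_act0r subr0; apply: mproj_out al _ => hE; apply: kl.
by rewrite hE gcompKV.
Qed.

End Degrees.

(** * Graded submodules and graded ideals *)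

Section Submodules.
Variables (G : groupoid) (R : grRing G) (M : grModule R).
Implicit Types (m n x : M) (a b : R) (g h : G) (N S : set M).

Lemma mproj_act_out g m a h : gm_comp g m -> gcod g <> gcod h ->
  mproj (gm_act m a) h = 0.
Proof.
move=> gm gh; move: a; apply: gr_homog_ind.
  by apply: subgroup_ker => a b; rewrite gm_actDr mprojD.
move=> k a ka /=; have [gk|gk] := pselect (gdom g = gcod k); last first.
  by rewrite (gm_act_eq0 gm ka gk) (mproj_id (gm_comp0 M h)).
apply: (mproj_out (gm_comp_actE gm ka gk)) => hE; apply: gh.
by rewrite hE gcod_comp.
Qed.

Lemma mproj_act_ex g m a h : gm_comp g m -> exists k b,
  [/\ gr_comp k b, gcod k = gdom g & mproj (gm_act m a) h = gm_act m b].
Proof.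
move=> gm; have [gh|gh] := pselect (gcod g = gcod h).
  exists (gcomp (ginv g) h), (rproj a (gcomp (ginv g) h)).
  rewrite (mproj_act _ gm gh); split=> //; first exact: rprojP.
  by rewrite gcod_comp ?gcod_inv ?gdom_inv.
exists (gid (gdom g)), 0; rewrite gm_act0r gcod_id (mproj_act_out _ gm gh).
by split=> //; exact: gr_comp0.
Qed.

Lemma gr_submodule_proj N m g : gr_submodule N -> N m -> N (mproj m g).
Proof. by move=> [_ gN]; exact: (graded_hcomp (@gm_comp_direct _ _ M) gN). Qed.

Lemma gr_submoduleI N : submodule N -> (forall m g, N m -> N (mproj m g)) ->
  gr_submodule N.
Proof.
by move=> sN gN; split=> //; exact: (hcomp_graded (@gm_comp_direct _ _ M) gN).
Qed.

(** A graded submodule is determined by its homogeneous elements. *)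
Lemma gr_submodule_sub N S : gr_submodule N -> subgroup S ->
  (forall g m, gm_comp g m -> N m -> S m) -> N `<=` S.
Proof.
move=> gN sS NS m Nm.
rewrite (hcomp_sum (@gm_comp_direct _ _ M) m); apply: fsum_closed => // g.
by apply: (NS g); [exact: mprojP|exact: gr_submodule_proj].
Qed.

Lemma gr_submodule_setI N S : gr_submodule N -> gr_submodule S ->
  gr_submodule (N `&` S).
Proof.
move=> gN gS; have [[[N0 NB] NA] _] := gN; have [[[S0 SB] SA] _] := gS.
apply: gr_submoduleI => [|m g [Nm Sm]]; last by split; exact: gr_submodule_proj.
split; first by split=> // x y [Nx Sx] [Ny Sy]; split; [exact: NB|exact: SB].
by move=> m a [Nm Sm]; split; [exact: NA|exact: SA].
Qed.

Lemma gr_submodule0 : gr_submodule [set (0 : M)].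
Proof.
apply: gr_submoduleI => [|m g -> /=]; last by rewrite mproj_id//;
  exact: gm_comp0.
by split => [|m a ->]; [exact: subgroup0|rewrite /= gm_act0l].
Qed.

(** Taking the least submodule instead of the set of finite combinations spares
    all manipulation of coefficients: [pseudo_basis_at] goes back to sums. *)
Definition mspan (X : set M) : set M :=
  [set m | forall N, submodule N -> X `<=` N -> N m].

Lemma mspan_submodule X : submodule (mspan X).
Proof.
split; first split.
- by move=> N [[N0 _] _] _.
- by move=> x y Xx Xy N sN XN; have [[_ NB] _] := sN; apply: NB;
    [exact: Xx|exact: Xy].
- by move=> m a Xm N sN XN; have [_ NA] := sN; apply: NA; exact: Xm.
Qed.

Lemma mspan_gen X : X `<=` mspan X.
Proof. by move=> x Xx N _; apply. Qed.

Lemma mspan_min X N : submodule N -> X `<=` N -> mspan X `<=` N.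
Proof. by move=> sN XN m; apply. Qed.

Lemma mspan_mono X Y : X `<=` Y -> mspan X `<=` mspan Y.
Proof.
move=> XY; apply: mspan_min; first exact: mspan_submodule.
by move=> x /XY; exact: mspan_gen.
Qed.

(** Products of homogeneous elements are homogeneous, so the sums of homogeneous
    elements of the span already form a submodule. *)
Lemma mspan_graded X : (forall x, X x -> exists g, gm_comp g x) ->
  gr_submodule (mspan X).
Proof.
move=> Xh; split; first exact: mspan_submodule.
have [sX aX] := mspan_submodule X.
have sA g : subgroup (@gm_comp _ _ M g `&` mspan X).
  have [c0 cB] := gm_comp_subgroup M g; have [X0 XB] := sX.
  by split=> // x y [? ?] [? ?]; split; [exact: cB|exact: XB].
have sS := internal_sum_subgroup sA.
apply: mspan_min => [|x Xx]; last first.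
  have [g gx] := Xh _ Xx; apply: (internal_sum_comp sA (i := g)).
  by split=> //; exact: mspan_gen.
split=> // m a; apply: gm_act_ind => // g h {}m {}a [gm Xm] ha.
have [gh|gh] := pselect (gdom g = gcod h); last first.
  by rewrite (gm_act_eq0 gm ha gh); case: sS.
apply: (internal_sum_comp sA (i := gcomp g h)); split; last exact: aX.
exact: gm_comp_actE.
Qed.

Definition adjoin S x : set M :=
  [set m | exists s a, S s /\ m = s + gm_act x a].

Lemma adjoin_graded S g x : gr_submodule S -> gm_comp g x ->
  gr_submodule (adjoin S x).
Proof.
move=> gS gx; have [[[S0 SB] SA] _] := gS.
apply: gr_submoduleI => [|_ h [s [a [Ss ->]]]]; last first.
  have [_ [b [_ _ bE]]] := mproj_act_ex a h gx.
  exists (mproj s h), b; split; first exact: gr_submodule_proj.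
  by rewrite mprojD bE.
split; first split.
- by exists 0, 0; split=> //; rewrite gm_act0r addr0.
- move=> _ _ [s [a [Ss ->]]] [t [b [St ->]]]; exists (s - t), (a - b).
  by split; [exact: SB|rewrite gm_actBr opprD addrACA].
- move=> _ b [s [a [Ss ->]]]; exists (gm_act s b), (gr_mul a b).
  by split; [exact: SA|rewrite gm_actDl gm_actA].
Qed.

Lemma adjoin_sub S x : S `<=` adjoin S x.
Proof. by move=> s Ss; exists s, 0; split=> //; rewrite gm_act0r addr0. Qed.

Lemma adjoin_gen S g x : submodule S -> gm_comp g x -> adjoin S x x.
Proof.
move=> [[S0 _] _] gx; exists 0, (gr_one R (gdom g)); split=> //.
by rewrite (gm_act1 gx) add0r.
Qed.

Definition cyclic x : set M := range (gm_act x).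

Lemma cyclic_graded g x : gm_comp g x -> gr_submodule (cyclic x).
Proof.
move=> gx; suff -> : cyclic x = adjoin [set 0] x.
  exact: adjoin_graded gr_submodule0 gx.
apply/seteqP; split=> [_ [a _ <-]|_ [_ [a [-> ->]]]].
  by exists 0, a; rewrite add0r.
by rewrite add0r; exists a.
Qed.

Lemma cyclic_gen g x : gm_comp g x -> cyclic x x.
Proof. by move=> gx; exists (gr_one R (gdom g)) => //; exact: gm_act1. Qed.

End Submodules.

Section Ideals.
Variables (G : groupoid) (R : grRing G).
Implicit Types (a b c : R) (g h : G).

Lemma gr_mulBl a b c : gr_mul (a - b) c = gr_mul a c - gr_mul b c.
Proof. exact: (gm_actBl (M := regular R)). Qed.

Lemma gr_mulBr a b c : gr_mul a (b - c) = gr_mul a b - gr_mul a c.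
Proof. exact: (gm_actBr (M := regular R)). Qed.

Lemma gr_comp_mulE g h a b : gr_comp g a -> gr_comp h b -> gdom g = gcod h ->
  gr_comp (gcomp g h) (gr_mul a b).
Proof. exact: (gm_comp_actE (M := regular R)). Qed.

Lemma gr_mul_eq0 g h a b : gr_comp g a -> gr_comp h b -> gdom g <> gcod h ->
  gr_mul a b = 0.
Proof. exact: (gm_act_eq0 (M := regular R)). Qed.

Lemma gr_mul_homog g h a b : gr_comp g a -> gr_comp h b ->
  exists k, gr_comp k (gr_mul a b).
Proof.
move=> ga hb; have [gh|gh] := pselect (gdom g = gcod h).
  by exists (gcomp g h); exact: gr_comp_mulE.
by exists g; rewrite (gr_mul_eq0 ga hb gh); exact: gr_comp0.
Qed.

Lemma gr_mul1E g e a : gr_comp g a -> gcod g = e -> gr_mul (gr_one R e) a = a.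
Proof. by move=> ga <-; exact: gr_mul1r. Qed.

Lemma gr_mul1E0 g e a : gr_comp g a -> gcod g <> e -> gr_mul (gr_one R e) a = 0.
Proof.
move=> ga ne; apply: (gr_mul_eq0 (gr_one_comp R e) ga).
by rewrite gdom_id => /esym.
Qed.

Lemma gr_mulE1 g e a : gr_comp g a -> gdom g = e -> gr_mul a (gr_one R e) = a.
Proof. by move=> ga <-; exact: gr_mulr1. Qed.

Lemma gr_mulE10 g e a : gr_comp g a -> gdom g <> e -> gr_mul a (gr_one R e) = 0.
Proof.
by move=> ga ne; apply: (gr_mul_eq0 ga (gr_one_comp R e)); rewrite gcod_id.
Qed.

Lemma gr_one_idem e : gr_mul (gr_one R e) (gr_one R e) = gr_one R e.
Proof. by apply: (gr_mul1E (gr_one_comp R e)); rewrite gcod_id. Qed.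

Lemma gr_neq0_homog a : a <> 0 -> exists g, rproj a g <> 0.
Proof. exact: (mproj_neq0 (M := regular R)). Qed.

(** Object degrees are units for the composition, so multiplication by an
    element of degree an identity preserves degrees. *)
Lemma rproj_mul_object f c a h : gr_comp (gid f) c ->
  rproj (gr_mul c a) h = gr_mul c (rproj a h).
Proof.
move=> fc; apply/eqP; rewrite -subr_eq0; apply/eqP; move: a.
apply: gr_homog_ind.
  apply: subgroup_ker => a b; rewrite gr_mulDr !rprojD gr_mulDr.
  by rewrite opprD addrACA.
move=> l a la /=.
have [lf|lf] := pselect (f = gcod l).
  have cal : gr_comp l (gr_mul c a).
    have := gr_comp_mulE fc la; rewrite gdom_id => /(_ lf).
    by rewrite lf gcomp1m.
  have [->|hl] := pselect (h = l);
    first by rewrite !(rproj_id (g := l))// subrr.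
  by rewrite !(rproj_out (g := l))// gr_mulr0 subrr.
have ca : gr_mul c a = 0 by apply: gr_mul_eq0 fc la _; rewrite gdom_id.
rewrite ca (rproj_id (gr_comp0 R h)).
have [->|hl] := pselect (h = l); first by rewrite (rproj_id la) ca subrr.
by rewrite (rproj_out la hl) gr_mulr0 subrr.
Qed.

Lemma rproj_mul_one f a h :
  rproj (gr_mul a (gr_one R f)) h = gr_mul (rproj a h) (gr_one R f).
Proof.
apply/eqP; rewrite -subr_eq0; apply/eqP; move: a; apply: gr_homog_ind.
  apply: subgroup_ker => a b; rewrite gr_mulDl !rprojD gr_mulDl.
  by rewrite opprD addrACA.
move=> l a la /=; have [lf|lf] := pselect (gdom l = f).
  rewrite (gr_mulE1 la lf); have [->|hl] := pselect (h = l).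
    by rewrite (rproj_id la) (gr_mulE1 la lf) subrr.
  by rewrite (rproj_out la hl) gr_mul0r subrr.
rewrite (gr_mulE10 la lf) (rproj_id (gr_comp0 R h)).
have [->|hl] := pselect (h = l).
  by rewrite (rproj_id la) (gr_mulE10 la lf) subrr.
by rewrite (rproj_out la hl) gr_mul0r subrr.
Qed.

(** In place of a global identity: [a] is determined by the [a 1_f]. *)
Lemma gr_left_annihilator0 a : (forall b, gr_mul a b = 0) -> a = 0.
Proof.
move=> ab; apply: contrapT => a0; have [h ah] := gr_neq0_homog a0; apply: ah.
by rewrite -(gr_mulr1 (rprojP a h)) -rproj_mul_one ab (rproj_id (gr_comp0 R h)).
Qed.

Lemma gr_right_annihilator0 a : (forall b, gr_mul b a = 0) -> a = 0.
Proof.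
move=> ba; apply: contrapT => a0; have [h ah] := gr_neq0_homog a0; apply: ah.
by rewrite -(gr_mul1r (rprojP a h)) -(rproj_mul_object _ _ (gr_one_comp R _)) ba
  (rproj_id (gr_comp0 R h)).
Qed.

Lemma homog_cod g e a : gr_comp g a -> gr_mul (gr_one R e) a = a -> a <> 0 ->
  gcod g = e.
Proof.
move=> ga ea a0; apply: contrapT => ne; apply: a0.
by rewrite -ea; exact: gr_mul1E0 ga ne.
Qed.

Lemma homog_dom g e a : gr_comp g a -> gr_mul a (gr_one R e) = a -> a <> 0 ->
  gdom g = e.
Proof.
move=> ga ea a0; apply: contrapT => ne; apply: a0.
by rewrite -ea; exact: gr_mulE10 ga ne.
Qed.

Lemma rproj_cod e a h : gr_mul (gr_one R e) a = a -> rproj a h <> 0 ->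
  gcod h = e.
Proof.
move=> ea; apply: homog_cod; first exact: rprojP.
by rewrite -(rproj_mul_object _ _ (gr_one_comp R e)) ea.
Qed.

Lemma subgroup_mull (P : set R) c : subgroup P ->
  subgroup [set a | P (gr_mul c a)].
Proof. by move=> sP; apply: subgroup_preim => // a b; rewrite gr_mulDr. Qed.

Lemma subgroup_mulr (P : set R) c : subgroup P ->
  subgroup [set a | P (gr_mul a c)].
Proof. by move=> sP; apply: subgroup_preim => // a b; rewrite gr_mulDl. Qed.

Definition principal_ideal c : set R :=
  set_product (fun x y => gr_mul (gr_mul x c) y) setT setT.

Lemma principal_ideal_subgroup c : subgroup (principal_ideal c).
Proof. by apply: set_product_subgroup => // x y b; rewrite !gr_mulDl. Qed.

Lemma principal_ideal_mem c x y : principal_ideal c (gr_mul (gr_mul x c) y).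
Proof. exact: set_product_mem. Qed.

Lemma principal_ideal_ind c (P : set R) : subgroup P ->
  (forall x y, P (gr_mul (gr_mul x c) y)) -> principal_ideal c `<=` P.
Proof.
by move=> sP Pc _ [s [_ ->]]; apply: subgroup_sum => // p _; exact: Pc.
Qed.

Lemma principal_ideal_mul c a x : principal_ideal c x ->
  principal_ideal c (gr_mul a x) /\ principal_ideal c (gr_mul x a).
Proof.
have sI := principal_ideal_subgroup c; move: x; apply: principal_ideal_ind.
  have [h1 h2] := (subgroup_mull a sI, subgroup_mulr a sI).
  split; first by split; [case: h1|case: h2].
  move=> x y [ax xa] [ay ya]; split; first by case: h1 => _; apply.
  by case: h2 => _; apply.
move=> x y; split; last by rewrite -gr_mulA; exact: principal_ideal_mem.
by rewrite !gr_mulA; exact: principal_ideal_mem.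
Qed.

Lemma principal_ideal_gr_ideal g c : gr_comp g c ->
  gr_ideal (principal_ideal c).
Proof.
move=> gc; split; [exact: principal_ideal_subgroup| |].
  by move=> a x; exact: principal_ideal_mul.
set I := principal_ideal c.
have sI : subgroup I by exact: principal_ideal_subgroup.
have sA h : subgroup (@gr_comp _ R h `&` I).
  have [c0 cB] := gr_comp_subgroup R h; have [I0 IB] := sI.
  by split=> // x y [? ?] [? ?]; split; [exact: cB|exact: IB].
have sS := internal_sum_subgroup sA.
apply: principal_ideal_ind => // x y; move: x y.
apply: (gr_homog_ind (P :=
  [set x | forall y, internal_sum _ (gr_mul (gr_mul x c) y)])).
  apply: subgroup_all => y; apply: subgroup_preim => // a b.
  by rewrite !gr_mulDl.
move=> h x hx; apply: (gr_homog_ind (P := [set y | internal_sum _ _])).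
  exact: subgroup_mull.
move=> k y ky /=; have [l xcl] := gr_mul_homog hx gc.
have [l' xcyl] := gr_mul_homog xcl ky.
apply: (internal_sum_comp sA (i := l')); split=> //; exact: principal_ideal_mem.
Qed.

Lemma principal_ideal_gen g c : gr_comp g c -> principal_ideal c c.
Proof.
move=> gc; rewrite -[X in principal_ideal c X](gr_mulr1 gc).
by rewrite -[X in gr_mul X _](gr_mul1r gc); exact: principal_ideal_mem.
Qed.

Lemma gr_ideal_setT (I : set R) : gr_ideal I -> (forall e, I (gr_one R e)) ->
  I = setT.
Proof.
move=> [sI mI _] I1; apply/seteqP; split=> // a _; move: a.
apply: gr_homog_ind => // g a ga; rewrite -(gr_mul1r ga).
by have [] := mI a _ (I1 (gcod g)).
Qed.

End Ideals.

(** * Shifts and the right ideals generated by object identities *)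

Section Shifts.
Variables (G : groupoid) (R : grRing G).

Lemma shift_valD (M : grModule R) (s : G) :
  {morph @shift_val G R M s : x y / x + y}.
Proof. by []. Qed.

(** The graded submodules of a shift are the graded submodules of [M] that lie
    inside it; the next two definitions are the two directions of this
    correspondence. *)
Definition shift_image (M : grModule R) (s : G) (N : set (shift M s)) : set M :=
  [set shift_val v | v in N].

Definition shift_trace (M : grModule R) (s : G) (N : set M) : set (shift M s) :=
  [set v | N (shift_val v)].
Arguments shift_trace {M} s N.

Lemma shift_image_graded (M : grModule R) (s : G) (N : set (shift M s)) :
  gr_submodule N -> gr_submodule (shift_image N).
Proof.
move=> [[[N0 NB] NA] gN]; split.
  split; first split.
  - by exists 0.
  - move=> _ _ [x Nx <-] [y Ny <-]; exists (x - y) => //; exact: NB.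
  - by move=> _ a [x Nx <-]; exists (gm_act x a) => //; exact: NA.
set S := shift_image N.
have sS : subgroup S.
  split; first by exists 0.
  by move=> _ _ [x Nx <-] [y Ny <-]; exists (x - y) => //; exact: NB.
have sA g : subgroup (@gm_comp _ _ M g `&` S).
  have [c0 cB] := gm_comp_subgroup M g; have [S0 SB] := sS.
  by split=> // x y [? ?] [? ?]; split; [exact: cB|exact: SB].
have sI := internal_sum_subgroup sA.
move=> _ [v Nv <-]; have := gN v Nv; move: v {Nv}.
apply: (internal_sum_ind (P := [set v | internal_sum _ _])).
  exact: subgroup_preim (@shift_valD M s) sI.
move=> g v [gv Nv] /=; move: gv; rewrite /= /shift_comp /shift_family /=.
case: (Defs.pcomp s g) => [h|] /= => [hv|->]; last by case: sI.
by apply: (internal_sum_comp sA (i := h)); split=> //; exists v.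
Qed.

Lemma shift_val_mproj (M : grModule R) (s g h : G) (v : shift M s) :
  Defs.pcomp s g = Some h -> shift_val (mproj v g) = mproj (shift_val v) h.
Proof.
move=> sg; apply/eqP; rewrite -subr_eq0; apply/eqP; move: v.
apply: gm_homog_ind.
  apply: subgroup_ker => x y /=.
  by rewrite mprojD !shift_valD mprojD opprD addrACA.
move=> k v kv /=; have [kg|kg] := pselect (g = k).
  rewrite kg in sg *; rewrite (mproj_id kv) mproj_id ?subrr//.
  by move: kv; rewrite /= /shift_comp /shift_family /= sg.
rewrite (mproj_out kv kg) sub0r; apply/eqP; rewrite oppr_eq0; apply/eqP.
move: kv; rewrite /= /shift_comp /shift_family /=.
case sk: (Defs.pcomp s k) => [l|] /= => [lv|->];
  last exact: mproj_id (gm_comp0 M h).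
apply: mproj_out lv _ => hl; apply: kg.
by rewrite hl in sg; exact: pcomp_inj sg sk.
Qed.

Lemma shift_trace_graded (M : grModule R) (s : G) (N : set M) :
  gr_submodule N -> gr_submodule (shift_trace s N).
Proof.
move=> gN; have [[sN NA] _] := gN; apply: gr_submoduleI.
  split; first exact: subgroup_preim (@shift_valD M s) sN.
  by move=> v a Nv; exact: NA.
move=> v g Nv; rewrite /shift_trace /mkset; case sg: (Defs.pcomp s g) => [h|].
  by rewrite (shift_val_mproj v sg); exact: gr_submodule_proj.
have := mprojP v g; rewrite /= /shift_comp /shift_family /= sg /= => ->.
by case: sN.
Qed.

Lemma object_shiftP e g (a : R) : shift_family (M := regular R) (gid e) g a ->
  gr_comp g a /\ (gcod g <> e -> a = 0).
Proof.
rewrite /shift_family /Defs.pcomp gdom_id.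
case: (e =P gcod g) => [->|_] /=; first by rewrite gcomp1m.
by move=> ->; split=> //; exact: gr_comp0.
Qed.

Lemma object_shift_homog e g (a : R) : gr_comp g a -> gcod g = e ->
  shift_family (M := regular R) (gid e) g a.
Proof.
by move=> ga <-; rewrite /shift_family pcomp_def ?gdom_id//= gcomp1m.
Qed.

(** The shift by the identity at [e] is the right ideal [1_e R]. *)
Lemma object_shift_predP e (a : R) :
  (a \in shift_pred (M := regular R) (gid e)) <-> gr_mul (gr_one R e) a = a.
Proof.
split=> [/asboolP|aE].
  move: a; apply: internal_sum_ind.
    have := @subgroup_ker R R (fun a => gr_mul (gr_one R e) a - a).
    case=> [x y|P0 PB]; first by rewrite gr_mulDr opprD addrACA.
    split=> [|x y /= xe ye]; first by rewrite /= gr_mulr0.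
    by rewrite gr_mulBr xe ye.
  move=> g a /object_shiftP[ga a0].
  have [ge|/a0->] := pselect (gcod g = e); last by rewrite /= gr_mulr0.
  exact: gr_mul1E ga ge.
apply/asboolP; rewrite -aE {aE}; move: a.
have sS := shift_family_subgroup (regular R) (gid e).
have sI := internal_sum_subgroup sS.
apply: gr_homog_ind; first exact: (subgroup_mull _ sI).
move=> g a ga /=; have [ge|ge] := pselect (gcod g = e).
  apply: (internal_sum_comp sS (i := g)).
  by rewrite (gr_mul1E ga ge); exact: object_shift_homog.
by rewrite (gr_mul1E0 ga ge); case: sI.
Qed.

Definition to_object_shift e (a : R) (aE : gr_mul (gr_one R e) a = a) :
  object_shift (regular R) e := ShiftSort ((object_shift_predP e a).2 aE).

Lemma object_shift_valP e (v : object_shift (regular R) e) :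
  gr_mul (gr_one R e) (shift_val v) = shift_val v.
Proof. exact: (object_shift_predP e _).1 (shift_valP v). Qed.

(** Taking the component of degree the identity turns any right inverse of a
    homogeneous element into a homogeneous one. *)
Lemma homog_right_inverse g (a b : R) : gr_comp g a ->
  gr_mul a b = gr_one R (gcod g) ->
  gr_mul a (rproj b (ginv g)) = gr_one R (gcod g).
Proof.
move=> ga ab; have e1 : gcod g = gcod (gid (gcod g)) by rewrite gcod_id.
have := @mproj_act _ _ (regular R) g _ a b ga e1.
rewrite /= ab (@mproj_id _ _ (regular R) (gid (gcod g)));
  last exact: gr_one_comp.
by rewrite -(gdom_inv g) gcompm1 => <-.
Qed.

(** Elementwise form of the gr-simplicity of the right ideal [1_e R]. *)
Definition right_simple_at e :=
  gr_one R e <> 0 /\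
  forall g (a : R), gr_comp g a -> gcod g = e -> a <> 0 ->
    exists b, gr_comp (ginv g) b /\ gr_mul a b = gr_one R e.

Lemma right_simple_atP e :
  right_simple_at e <-> gr_simple_module (object_shift (regular R) e).
Proof.
split=> [[e0 inv]|[[v v0] simp]].
  split=> [|N gN].
    exists (to_object_shift (gr_one_idem R e)).
    by move=> /(congr1 (@shift_val _ _ _ _)).
  have [N0|nN0] := pselect (N = [set 0]); [by left|right].
  have [v [Nv v0]] : exists v, N v /\ v <> 0.
    apply: contrapT => h; apply: nN0; apply/seteqP; split=> [v Nv|_ ->].
      by apply: contrapT => v0; apply: h; exists v.
    by case: gN => -[[]].
  have gS := shift_image_graded gN.
  have [g ag0] : exists g, rproj (shift_val v) g <> 0.
    by apply: gr_neq0_homog => v0'; apply: v0; exact/val_inj.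
  have Sa : shift_image N (rproj (shift_val v) g).
    by apply: (gr_submodule_proj (M := regular R)) => //; exists v.
  have ge : gcod g = e.
    case: Sa => w _ wE; apply: contrapT => ne; apply: ag0.
    rewrite -wE -object_shift_valP wE (gr_mul1E0 _ ne)//; exact: rprojP.
  have [b [_ ab]] := inv g _ (rprojP _ g) ge ag0.
  apply/seteqP; split=> // w _.
  have [[_ SA] _] := gS; have := SA _ (gr_mul b (shift_val w)) Sa.
  rewrite /= gr_mulA ab object_shift_valP => -[w' Nw' /val_inj <-//].
have e0 : gr_one R e <> 0.
  move=> e0; apply: v0; apply/val_inj => /=.
  by rewrite -object_shift_valP e0 gr_mul0r.
split=> // g a ga ge a0.
have gC := @cyclic_graded _ _ (regular R) g a ga.
have [N0|NT] := simp _ (shift_trace_graded (gid e) gC).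
  have aE := gr_mul1E ga ge.
  have : shift_trace (gid e) (cyclic (M := regular R) a)
      (to_object_shift aE) by exact: (@cyclic_gen _ _ (regular R) g).
  by rewrite N0 => /(congr1 (@shift_val _ _ _ _)).
have : shift_trace (gid e) (cyclic (M := regular R) a)
    (to_object_shift (gr_one_idem R e)) by rewrite NT.
move=> [b _ /= ab]; exists (rproj b (ginv g)); split; first exact: rprojP.
by rewrite -ge in ab *; exact: homog_right_inverse.
Qed.

Definition dcc_below (M : grModule R) (S : set M) : Prop :=
  forall N : nat -> set M, (forall n, gr_submodule (N n)) ->
    (forall n, N n.+1 `<=` N n) -> (forall n, N n `<=` S) ->
    exists n, forall m, (n <= m)%N -> N m = N n.

Definition right_ideal_at e : set (regular R) :=
  [set a | gr_mul (gr_one R e) a = a].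

Lemma right_artinianP :
  right_artinian R <-> forall e, dcc_below (right_ideal_at e).
Proof.
split=> [art e N gN dN Ne|art e N gN dN].
  have [n nP] := art e (fun n => shift_trace (gid e) (N n))
    (fun n => shift_trace_graded (gid e) (gN n)) (fun n v => dN n _).
  exists n => m nm; have := nP m nm => E.
  apply/seteqP; split=> a Na; have aE := Ne _ _ Na;
    have : shift_trace (gid e) (N m) (to_object_shift aE).
  - by [].
  - by rewrite E => H; exact: H.
  - by rewrite E.
  - by move=> H; exact: H.
have [|n v [w Nw <-]|n v [w _ <-]|n nP] :=
    art e (fun n => shift_image (N n)).
- by move=> n; exact: shift_image_graded.
- by exists w => //; exact: dN.
- exact: object_shift_valP.
exists n => m nm; have E := nP m nm.
apply/seteqP; split=> v Nv.
  have : shift_image (N m) (shift_val v) by exists v.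
  by rewrite E => -[w Nw /val_inj <-].
have : shift_image (N n) (shift_val v) by exists v.
by rewrite -E => -[w Nw /val_inj <-].
Qed.

End Shifts.
Arguments right_ideal_at {G} R e.

(** * Modules over a ring with a full gr-simple right ideal [1_e R] *)

(** In terms of modules: every graded module is generated by its homogeneous
    elements of domain [e], see [full_generated]. *)
Definition full_at (G : groupoid) (R : grRing G) (e : gobj G) : Prop :=
  principal_ideal (gr_one R e) = setT.

Section Exchange.
Variables (G : groupoid) (R : grRing G) (e : gobj G) (M : grModule R).
Hypothesis simp : right_simple_at R e.

(** Steinitz exchange. In [n = s + x a] one may replace [a] by a homogeneous
    component [b]; it is nonzero as [n] is not in [S], so it has a right inverse
    [c], and [x = x b c] can be read off from [n c]. *)
Lemma exchange (S : set M) g x h n : gr_submodule S ->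
  gm_comp g x -> gdom g = e -> gm_comp h n ->
  adjoin S x n -> ~ S n -> adjoin S n x.
Proof.
move=> gS gx ge hn [s [a [Ss nE]]] nS.
have [k [b [kb kg bE]]] := mproj_act_ex a h gx.
have [_ inv] := simp; have [[[S0 SB] SA] _] := gS.
have nE' : n = mproj s h + gm_act x b by rewrite -bE -mprojD -nE mproj_id.
have Ss' : S (mproj s h) by exact: gr_submodule_proj.
have b0 : b <> 0 by move=> b0; apply: nS; rewrite nE' b0 gm_act0r addr0.
have [c [_ bc]] := inv _ _ kb (etrans kg ge) b0.
exists (- gm_act (mproj s h) c), c; split; last first.
  by rewrite nE' gm_actDl addKr -gm_actA bc -ge (gm_act1 gx).
by rewrite -sub0r; apply: SB => //; exact: SA.
Qed.

Lemma full_generated (N : set M) : full_at R e -> submodule N ->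
  (forall g m, gm_comp g m -> gdom g = e -> N m) -> N = setT.
Proof.
move=> full [sN NA] Ne; apply/seteqP; split=> // m _; move: m.
apply: gm_homog_ind => // g m gm; rewrite -(gm_act1 gm).
have : principal_ideal (gr_one R e) (gr_one R (gdom g)) by rewrite full.
move: (gr_one R (gdom g)); apply: principal_ideal_ind.
  by apply: subgroup_preim sN => a b; rewrite gm_actDr.
move=> x y /=; rewrite gm_actA; apply: NA; move: x.
apply: (gr_homog_ind (P := [set x | N (gm_act m (gr_mul x (gr_one R e)))])).
  by apply: subgroup_preim sN => a b; rewrite gr_mulDl gm_actDr.
move=> h x hx /=; have [N0 _] := sN.
have [he|he] := pselect (gdom h = e);
  last by rewrite (gr_mulE10 hx he) gm_act0r.
rewrite (gr_mulE1 hx he).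
have [gh|gh] := pselect (gdom g = gcod h);
  last by rewrite (gm_act_eq0 gm hx gh).
by apply: (Ne (gcomp g h)); [exact: gm_comp_actE|rewrite gdom_comp].
Qed.

Definition homog_at (x : M) := exists2 g, gm_comp g x & gdom g = e.

(** Independence in the sense of matroids. Unlike linear independence it needs
    no coefficients, and for homogeneous elements of domain [e] the two agree,
    since nonzero homogeneous coefficients in [1_e R] are right invertible. *)
Definition independent (X : set M) := forall x, X x -> ~ mspan (X `\ x) x.

Lemma mspan_homog_graded (X : set M) : X `<=` homog_at ->
  gr_submodule (mspan X).
Proof. by move=> Xh; apply: mspan_graded => x /Xh[g gx _]; exists g. Qed.

(** The closure operator is finitary: along a chain, the union of the spans is
    again a submodule. *)
Lemma independent_bigcup (F : set (set M)) : F `<=` independent ->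
  total_on F subset -> independent (\bigcup_(X in F) X).
Proof.
move=> Find Ftot x [X0 FX0 X0x].
suff H : mspan ((\bigcup_(X in F) X) `\ x) `<=` \bigcup_(X in F) mspan (X `\ x).
  move=> /H[X1 FX1 X1x]; have [X01|X10] := Ftot _ _ FX0 FX1.
    by exact: (Find _ FX1 _ (X01 _ X0x) X1x).
  refine (Find _ FX0 _ X0x _); move: X1x; apply: mspan_mono.
  exact: setSD.
apply: mspan_min; last first.
  move=> y [[X FX Xy] yx]; exists X => //; exact: mspan_gen.
split; first split.
- by exists X0 => //; have [[]] := mspan_submodule (X0 `\ x).
- move=> y z [Y FY Yy] [Z FZ Zz].
  have [YZ|ZY] := Ftot _ _ FY FZ.
    exists Z => //; have [[_ B] _] := mspan_submodule (Z `\ x); apply: B => //.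
    by move: y Yy; apply: mspan_mono; exact: setSD.
  exists Y => //; have [[_ B] _] := mspan_submodule (Y `\ x); apply: B => //.
  by move: z Zz; apply: mspan_mono; exact: setSD.
- by move=> y a [Y FY Yy]; exists Y => //;
    have [_] := mspan_submodule (Y `\ x); apply.
Qed.

(** If some [y] in [X] became dependent, exchange would put [m] into the span of
    [X]. *)
Lemma independent_add (X : set M) m : X `<=` homog_at -> independent X ->
  homog_at m -> ~ mspan X m -> independent (X `|` [set m]).
Proof.
move=> Xh Xind [h hm he] mX y [Xy|->] yX'; last first.
  refine (mX _); move: yX'; apply: mspan_mono => z [[//|->] mm].
  by case: mm.
have gS : gr_submodule (mspan (X `\ y)).
  by apply: mspan_homog_graded => z [/Xh].
have [g gy ge] := Xh _ Xy.
have sub : mspan ((X `|` [set m]) `\ y) `<=` adjoin (mspan (X `\ y)) m.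
  apply: mspan_min; first by case: (adjoin_graded gS hm).
  move=> z [[Xz|->] zy]; last by apply: adjoin_gen hm; case: gS.
  by apply: adjoin_sub; apply: mspan_gen.
have [s [a [Ss mE]]] := exchange gS hm he gy (sub _ yX') (Xind y Xy).
refine (mX _); rewrite mE; have [sX aX] := mspan_submodule X.
apply: (subgroupD sX); last by apply: aX; exact: mspan_gen.
exact: (mspan_mono (@subDsetl _ X [set y]) Ss).
Qed.

Lemma exists_homog_basis : full_at R e ->
  exists X : set M, [/\ X `<=` homog_at, independent X & mspan X = setT].
Proof.
move=> full.
have [|X [[Xh Xind] Xmax]] := @Zorn_bigcup M
    [set X | X `<=` homog_at /\ independent X].
  move=> F FP Ftot; split; first by move=> x [X /FP[Xh _] /Xh].
  by apply: independent_bigcup => // X /FP[].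
exists X; split=> //; apply: full_generated => //; first exact: mspan_submodule.
move=> g m gm ge; apply: contrapT => mX; apply: (Xmax (X `|` [set m])).
  split; first by move=> x; left.
  by move=> /(_ m) XmX; apply: mX; apply: mspan_gen; apply: XmX; right.
split; last by apply: independent_add => //; exists g.
by move=> x [/Xh//|->]; exists g.
Qed.

(** In a relation with a nonzero coefficient [a_j], the term [x_j a_j] lies in
    the graded span of the other [x_i]; so does [x_j] times a nonzero
    homogeneous component of [a_j], and that component has a right inverse. *)
Lemma pseudo_basis_at : full_at R e ->
  exists (I : choiceType) (x : I -> M) (g : I -> G),
    pseudo_basis x g /\ forall i, gdom (g i) = e.
Proof.
move=> /exists_homog_basis[X [Xh Xind XT]].
have /choice[g gP] : forall i : X, exists g, gm_comp g (\val i) /\ gdom g = e.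
  by move=> i; have [g gi ge] := Xh _ (set_valP i); exists g.
exists X, (fun i => \val i), g; split; last by move=> i; case: (gP i).
split.
- move=> i; split; first by case: (gP i).
  move=> i0; refine (Xind _ (set_valP i) _); rewrite /set_val i0.
  by have [[]] := mspan_submodule (X `\ 0).
- move=> N sN NX; apply/seteqP; split=> // m _.
  have : mspan X m by rewrite XT.
  move: m; apply: mspan_min => // m Xm; exact: (NX (SigSub (mem_set Xm))).
- move=> a a1 fa suma j; apply: contrapT => aj0.
  have [F FP] := finite_set_sub fa.
  have xaF i : gm_act (\val i) (a i) != 0 -> i \in F.
    by move=> xa; apply: FP => /=; apply: contraNneq xa => ->; rewrite gm_act0r.
  have jF : j \in F by apply: FP; apply/eqP.
  have [gj ge] := gP j; have [_ inv] := simp.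
  have gS : gr_submodule (mspan (X `\ \val j)).
    by apply: mspan_homog_graded => z [/Xh].
  have [[sS SA] _] := gS.
  have Sxa : mspan (X `\ \val j) (gm_act (\val j) (a j)).
    move: suma; rewrite (fsum_eq xaF) (bigD1_seq j)//= => /eqP.
    rewrite addr_eq0 => /eqP->; apply: (subgroupN sS).
    refine (subgroup_sum _ sS _) => i ij; apply: (SA); apply: mspan_gen.
    split; first exact: set_valP.
    by move=> /val_inj ijE; rewrite ijE eqxx in ij.
  have [k ak0] := gr_neq0_homog aj0.
  have ke : gcod k = e.
    apply: rproj_cod ak0; have [b ->] := a1 j.
    by rewrite ge gr_mulA gr_one_idem.
  have [c [_ ac]] := inv _ _ (rprojP _ k) ke ak0.
  have gk : gdom (g j) = gcod k by rewrite ge.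
  refine (Xind _ (set_valP j) _).
  have := gr_submodule_proj (gcomp (g j) k) gS Sxa.
  rewrite (mproj_act _ gj) ?gcod_comp// gcompKV// => /SA-/(_ c).
  by rewrite -gm_actA ac -ge (gm_act1 gj).
Qed.

(** * Descending chains *)

Lemma chain_antitone (T : Type) (N : nat -> set T) :
  (forall n, N n.+1 `<=` N n) -> forall n m, (n <= m)%N -> N m `<=` N n.
Proof.
move=> dN n m; elim: m => [|m IH]; first by rewrite leqn0 => /eqP->.
rewrite leq_eqVlt => /orP[/eqP->//|]; rewrite ltnS => /IH h x /dN; exact: h.
Qed.

Lemma dcc_below0 : dcc_below [set (0 : M)].
Proof.
move=> N gN dN N0; exists 0%N => m _.
have E n : N n = [set 0].
  by apply/seteqP; split=> [x /N0//|_ ->]; have [[[]]] := gN n.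
by rewrite !E.
Qed.

(** Let [N] be a chain of graded submodules of [S + x R]. If some term lies in
    [S], the condition on [S] applies. Otherwise exchange puts [x] into [S +
    N_k] for all [k]; then [N_k] is determined by its intersection with [S],
    and the intersections form a stationary chain. *)
Lemma dcc_below_adjoin (S : set M) g x : gr_submodule S -> dcc_below S ->
  gm_comp g x -> gdom g = e -> dcc_below (adjoin S x).
Proof.
move=> gS dS gx ge N gN dN NS.
have [[sS SA] _] := gS; have [_ SB] := sS.
have [[k0 Nk0]|nNS] := pselect (exists k, N k `<=` S).
  have [|||n nP] := dS (fun n => N (n + k0)%N).
  - by move=> n; exact: gN.
  - by move=> n; exact: dN.
  - by move=> n; apply: subset_trans Nk0; apply: chain_antitone => //;
      exact: leq_addl.
  exists (n + k0)%N => m nm; have km : (k0 <= m)%N by apply: leq_trans nm;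
    exact: leq_addl.
  by rewrite -(subnK km); apply: nP; rewrite leq_subRL// addnC.
have xN k : exists n s, [/\ N k n, S s & x = s + n].
  have [h [n [hn Nn nS]]] : exists h n, [/\ gm_comp h n, N k n & ~ S n].
    apply: contrapT => H; apply: nNS; exists k.
    apply: gr_submodule_sub => // h n hn Nn; apply: contrapT => nS.
    by apply: H; exists h, n.
  have [s [a [Ss xE]]] := exchange gS gx ge hn (NS _ _ Nn) nS.
  by exists (gm_act n a), s; split=> //; have [[_ NA] _] := gN k; exact: NA.
have [|||n nP] := dS (fun n => N n `&` S).
- by move=> n; exact: gr_submodule_setI.
- by move=> n; exact: setSI.
- by move=> n; exact: subIsetr.
exists n => m nm; apply/seteqP; split; first exact: chain_antitone.
move=> y Ny; have [s [a [Ss yE]]] := NS _ _ Ny.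
have [z [t [Nz St xE]]] := xN m.
have [[[_ nB] nA] _] := gN n; have [[sm mA] _] := gN m.
have Sy : S (y - gm_act z a).
  rewrite yE xE gm_actDl addrA addrK; apply: subgroupD => //; exact: SA.
have Ny' : N n (y - gm_act z a).
  by apply: nB => //; apply: nA; exact: (chain_antitone dN nm).
have : (N m `&` S) (y - gm_act z a) by rewrite (nP m nm).
move=> [Nm _]; rewrite -(subrK (gm_act z a) y); apply: subgroupD => //.
exact: mA.
Qed.

End Exchange.

Section Consequences.
Variables (G : groupoid) (R : grRing G) (e : gobj G).
Hypothesis simp : right_simple_at R e.
Hypothesis full : full_at R e.

Lemma pfm_at : pfm_ring R.
Proof.
move=> M; have [I [x [g [xg _]]]] := pseudo_basis_at M simp full.
by exists I, x, g.
Qed.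

(** A graded ideal [I] meets [1_e R] in [0] or in all of it. In the second case
    [1_e] is in [I]; in the first [R I = R 1_e R I] is zero. *)
Lemma gr_simple_at : gr_simple R.
Proof.
have [e0 inv] := simp.
split; first by exists (gr_one R e).
move=> I [[I0 IB] mI gI].
have [[a [Ia [ea a0]]]|nI] :=
  pselect (exists a, I a /\ gr_mul (gr_one R e) a = a /\ a <> 0).
  right; have [g ag0] := gr_neq0_homog a0.
  have Ig : I (rproj a g) by apply: (graded_hcomp (@gr_comp_direct _ R) gI).
  have ge : gcod g = e by exact: rproj_cod ea ag0.
  have [b [_ ab]] := inv _ _ (rprojP _ g) ge ag0.
  have I1 : I (gr_one R e) by rewrite -ab; case: (mI b _ Ig).
  apply/seteqP; split=> // c _;
    have : principal_ideal (gr_one R e) c by rewrite full.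
  move: c; apply: principal_ideal_ind => // x y.
  by have [_] := mI y _ (mI x _ I1).1.
left; apply/seteqP; split=> [a Ia|_ ->//].
have eI b : I b -> gr_mul (gr_one R e) b = 0.
  move=> Ib; apply: contrapT => b0; apply: nI.
  exists (gr_mul (gr_one R e) b); split;
    first by have [] := mI (gr_one R e) _ Ib.
  by rewrite gr_mulA gr_one_idem.
have cI c : gr_mul c a = 0.
  have : principal_ideal (gr_one R e) c by rewrite full.
  move: c; apply: principal_ideal_ind.
    by apply: subgroup_ker => u v; rewrite gr_mulDl.
  move=> x y /=; rewrite -!gr_mulA eI ?gr_mulr0//; exact: (mI y _ Ia).1.
exact: gr_right_annihilator0.
Qed.

(** Consider the [a] such that every graded submodule with the chain condition
    can be enlarged to one that contains [a]. They form a subgroup, which by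
    adjunction contains all [u 1_e v], hence by fullness [1_f]. *)
Lemma right_artinian_at : right_artinian R.
Proof.
apply/right_artinianP => f.
pose good (S : set (regular R)) := gr_submodule S /\ dcc_below S.
have [S [[gS dS] S1]] : exists S, good S /\ S (gr_one R f).
  suff H (a : R) : principal_ideal (gr_one R e) a ->
      forall S, good S -> exists S', [/\ good S', S `<=` S' & S' a].
    have good0 : good [set 0] by split;
      [exact: gr_submodule0|exact: dcc_below0].
    have [|S [gS _ S1]] := H (gr_one R f) _ [set 0] good0;
      first by rewrite full.
    by exists S.
  move: a; apply: principal_ideal_ind.
    split=> [S gS|a b Ha Hb S gS]; first by exists S; split=> //;
      have [[[[]]]] := gS.
    have [S1 [gS1 SS1 S1a]] := Ha _ gS; have [S2 [gS2 S12 S2b]] := Hb _ gS1.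
    exists S2; split=> //; first exact: subset_trans SS1 S12.
    by have [[[[_ B] _] _] _] := gS2; apply: B => //; exact: S12.
  move=> x y; move: x; apply: gr_homog_ind.
    split=> [S gS|a b Ha Hb S gS].
      by rewrite !gr_mul0r; exists S; split=> //; have [[[[]]]] := gS.
    have [S1 [gS1 SS1 S1a]] := Ha _ gS; have [S2 [gS2 S12 S2b]] := Hb _ gS1.
    exists S2; split=> //; first exact: subset_trans SS1 S12.
    rewrite !gr_mulBl.
    by have [[[[_ B] _] _] _] := gS2; apply: B => //; exact: S12.
  move=> g x gx /= S [gS dS]; have [ge|ge] := pselect (gdom g = e); last first.
    exists S; split=> //; rewrite (gr_mulE10 gx ge) gr_mul0r.
    by have [[[]]] := gS.
  have gA := @adjoin_graded _ _ (regular R) S g x gS gx.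
  have [[_ aA] _] := gA.
  exists (adjoin (M := regular R) S x); split.
  - by split=> //; exact: (dcc_below_adjoin (M := regular R) simp gS dS gx ge).
  - exact: (@adjoin_sub _ _ (regular R)).
  - rewrite (gr_mulE1 gx ge); apply: aA.
    by apply: (@adjoin_gen _ _ (regular R) _ g); case: gS.
move=> N gN dN Nf; apply: dS => // n a /Nf <-.
by have [[_ A] _] := gS; exact: A.
Qed.

End Consequences.

(** * Primeness and minimal right ideals *)

Section Primeness.
Variables (G : groupoid) (R : grRing G).

(** Primeness tested on homogeneous elements; it is the common consequence of
    gr-primeness and of gr-primitivity. *)
Definition homog_prime := forall g h (a b : R), gr_comp g a -> gr_comp h b ->
  a <> 0 -> b <> 0 ->
  exists k r, gr_comp k r /\ gr_mul (gr_mul a r) b <> 0.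

Lemma homog_middle (a b : R) : (exists r, gr_mul (gr_mul a r) b <> 0) ->
  exists k r, gr_comp k r /\ gr_mul (gr_mul a r) b <> 0.
Proof.
move=> [r arb]; apply: contrapT => H; apply: arb; move: r.
apply: gr_homog_ind.
  by apply: subgroup_ker => x y; rewrite gr_mulDr gr_mulDl.
by move=> k r kr /=; apply: contrapT => arb; apply: H; exists k, r.
Qed.

(** If [a R b = 0], the ideals generated by [a] and [b] have product zero. *)
Lemma gr_prime_homog : gr_prime R -> homog_prime.
Proof.
move=> [_ prime] g h a b ga hb a0 b0; apply: homog_middle.
apply: contrapT => H.
have arb r : gr_mul (gr_mul a r) b = 0.
  by apply: contrapT => arb; apply: H; exists r.
have ne0 k (c : R) : gr_comp k c -> c <> 0 -> principal_ideal c <> [set 0].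
  by move=> kc c0 E; apply: c0; have := principal_ideal_gen kc; rewrite E.
apply: (prime _ _ (principal_ideal_gr_ideal ga) (principal_ideal_gr_ideal hb)
  (ne0 _ _ ga a0) (ne0 _ _ hb b0)).
have IJ0 x : principal_ideal a x -> forall y, principal_ideal b y ->
    gr_mul x y = 0.
  move: x; apply: (principal_ideal_ind (P := [set x | forall y, _ -> _])).
    split=> [y _|x x' Hx Hx' y Jy]; first exact: gr_mul0r.
    by rewrite gr_mulBl Hx// Hx'// subrr.
  move=> x x'; apply: principal_ideal_ind.
    by apply: subgroup_ker => u v; rewrite gr_mulDr.
  move=> y y' /=; transitivity
    (gr_mul (gr_mul x (gr_mul (gr_mul a (gr_mul x' y)) b)) y').
    by rewrite !gr_mulA.
  by rewrite arb gr_mulr0 gr_mul0r.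
apply/seteqP; split=> [_ [s [sIJ ->]]|_ ->].
  rewrite /= big_seq big1// => p /sIJ[Ip Jp]; exact: IJ0.
by exists [::]; split=> //; rewrite big_nil.
Qed.

Lemma gr_simple_prime : gr_simple R -> gr_prime R.
Proof.
move=> [[a a0] simp]; split=> [|I J gI gJ I0 J0 IJ]; first by exists a.
have [//|IT] := simp _ gI; have [//|JT] := simp _ gJ.
apply: a0; move: (a); apply: gr_homog_ind; first exact: subgroup0.
move=> g b gb; have : set_product (@gr_mul _ R) I J b; last by rewrite IJ.
by rewrite -(gr_mul1r gb); apply: set_product_mem; rewrite ?IT ?JT.
Qed.

(** Let [M] be gr-simple and faithful. Choose [m] with [m a] nonzero: then
    [m a R = M], and [M b] is nonzero. *)
Lemma primitive_homog_prime : right_gr_primitive R -> homog_prime.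
Proof.
move=> [M [[_ simp] faith]] g h a b ga hb a0 b0; apply: homog_middle.
have nz (c : R) : c <> 0 -> exists m : M, gm_act m c <> 0.
  move=> c0; apply: contrapT => H; apply: c0.
  suff : [set c : R | forall m : M, gm_act m c = 0] c by rewrite faith.
  by move=> m /=; apply: contrapT => mc; apply: H; exists m.
have [k [m [km ma]]] : exists k (m : M), gm_comp k m /\ gm_act m a <> 0.
  have [m ma] := nz _ a0; apply: contrapT => H; apply: ma; move: m.
  apply: gm_homog_ind; first by apply: subgroup_ker => x y; rewrite gm_actDl.
  by move=> k m km /=; apply: contrapT => ma; apply: H; exists k, m.
have kg : gdom k = gcod g.
  by apply: contrapT => kg; apply: ma; exact: gm_act_eq0 km ga kg.
have kma := gm_comp_actE km ga kg.
have cT : cyclic (gm_act m a) = setT.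
  have [c0|//] := simp _ (cyclic_graded kma); exfalso; apply: ma.
  by have := cyclic_gen kma; rewrite c0.
have [m' mb] := nz _ b0; have : cyclic (gm_act m a) m' by rewrite cT.
move=> [r _ rE]; exists r => arb; apply: mb.
by rewrite -rE -!gm_actA gr_mulA arb gm_act0r.
Qed.

End Primeness.

Lemma dcc_minimal (G : groupoid) (R : grRing G) (M : grModule R) (S : set M)
    (Q : set (set M)) :
  dcc_below S -> (forall N, Q N -> gr_submodule N /\ N `<=` S) ->
  (exists N, Q N) ->
  exists N, Q N /\ forall N', Q N' -> N' `<=` N -> N' = N.
Proof.
move=> dS QS [N0 QN0]; apply: contrapT => H.
have /choice[F FP] : forall N : {N | Q N}, exists N' : {N | Q N},
    sval N' `<=` sval N /\ sval N' <> sval N.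
  move=> [N QN]; apply: contrapT => HN; apply: H; exists N; split=> //.
  move=> N' QN' N'N; apply: contrapT => ne; apply: HN.
  by exists (exist _ N' QN').
pose N n := sval (iter n F (exist _ N0 QN0)).
have QN n : Q (N n) by exact: (svalP (iter n F _)).
have [|||n nP] := dS N.
- by move=> n; case: (QS _ (QN n)).
- by move=> n; case: (FP (iter n F (exist _ N0 QN0))).
- by move=> n; case: (QS _ (QN n)).
have [_] := FP (iter n F (exist _ N0 QN0)); apply.
exact: (nP n.+1 (leqnSn n)).
Qed.

Section MinimalRightIdeals.
Variables (G : groupoid) (R : grRing G).
Hypothesis prime : homog_prime R.
Hypothesis art : right_artinian R.

Lemma right_ideal_at_graded e : gr_submodule (right_ideal_at R e).
Proof.
apply: gr_submoduleI => [|a h ea].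
  split; last by move=> a b; rewrite /right_ideal_at /= gr_mulA => ->.
  split=> [|a b]; rewrite /right_ideal_at /=; first exact: gr_mulr0.
  by rewrite gr_mulBr => -> ->.
by rewrite /right_ideal_at /= -(rproj_mul_object _ _ (gr_one_comp R e)) ea.
Qed.

(** Brauer's argument: if [N] is minimal in [1_e R] and [n N <> 0] with [n] in
    [N], then [n u = n] for some [u] of degree [e] in [N], and such a [u] is
    invertible in the division ring [R_e], so that [N = 1_e R]. *)
Lemma division_right_simple e : component_division_ring R e ->
  right_simple_at R e.
Proof.
move=> [e0 div].
pose Q (N : set (regular R)) := [/\ gr_submodule N, N `<=` right_ideal_at R e
  & exists n, N n /\ n <> 0].
have [||N [[gN Ne [n1 [Nn1 n10]]] Nmin]] :=
    dcc_minimal ((right_artinianP R).1 art e) (Q := Q).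
- by move=> N [gN Ne _].
- exists (right_ideal_at R e); split=> //; first exact: right_ideal_at_graded.
  by exists (gr_one R e); split=> //; exact: gr_one_idem.
have [[_ NA] _] := gN.
have Ncyc g (n : R) : gr_comp g n -> N n -> n <> 0 ->
    cyclic (M := regular R) n = N.
  move=> gn Nn n0.
  have sub : cyclic (M := regular R) n `<=` N by move=> _ [a _ <-]; exact: NA.
  apply: Nmin => //; split; first exact: (cyclic_graded (M := regular R) gn).
    exact: subset_trans sub Ne.
  by exists n; split=> //; exact: (cyclic_gen (M := regular R) gn).
have [g n0] := gr_neq0_homog n10; set n := rproj n1 g in n0.
have gn : gr_comp g n := rprojP n1 g.
have Nn : N n by exact: (gr_submodule_proj (M := regular R)).
have [k [r [kr nrn]]] := prime gn gn n0 n0.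
have [l lnr] := gr_mul_homog gn kr.
have [l' lnrn] := gr_mul_homog lnr gn.
have Nnr : N (gr_mul n r) by exact: NA.
have nr0 : gr_mul n r <> 0 by move=> nr0; apply: nrn; rewrite nr0 gr_mul0r.
have : cyclic (M := regular R) (gr_mul (gr_mul n r) n) (gr_mul n r).
  by rewrite (Ncyc _ _ lnrn)//; exact: NA.
move=> [c _ /= ncE].
have ge : gcod g = e by apply: (homog_cod gn _ n0); exact: Ne.
have le : gdom l = e.
  apply: (homog_dom lnr _ nr0); rewrite -ge.
  have [lg|lg] := pselect (gdom l = gcod g); last first.
    by case: nrn; exact: gr_mul_eq0 lnr gn lg.
  by rewrite -lg; exact: gr_mulr1.
pose u := rproj (gr_mul n c) (gid e).
have Nu : N u by apply: (gr_submodule_proj (M := regular R)) => //; exact: NA.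
have nru : gr_mul (gr_mul n r) u = gr_mul n r.
  have := @mproj_act _ _ (regular R) _ l _ (gr_mul n c) lnr erefl.
  by rewrite /= gr_mulA ncE (mproj_id (M := regular R) lnr) gcompVm le => <-.
have u0 : u <> 0 by move=> u0; apply: nr0; rewrite -nru u0 gr_mulr0.
have [b [_ ub _]] := div _ (rprojP _ _) u0.
have N1 : N (gr_one R e) by rewrite -ub; exact: NA.
split=> // h a ha he a0.
have Na : N a by rewrite -(gr_mul1E ha he); exact: NA.
move: N1; rewrite -(Ncyc _ _ ha Na a0) => -[d _ /= ad].
exists (rproj d (ginv h)); split; first exact: rprojP.
by rewrite -he in ad *; exact: homog_right_inverse.
Qed.

(** The degree of a nonzero homogeneous idempotent is an idempotent of the
    groupoid, and these are the identities. *)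
Lemma idem_degree d (p : R) : gr_comp d p -> p <> 0 -> gr_mul p p = p ->
  d = gid (gcod d).
Proof.
move=> dp p0 pp.
have dd : gdom d = gcod d.
  by apply: contrapT => ne; apply: p0; rewrite -pp;
    exact: (gr_mul_eq0 dp dp ne).
have := gr_comp_mulE dp dp dd; rewrite pp => ddp.
have dE : gcomp d d = d.
  exact: (homog_degree (@gr_comp_subgroup _ R) (@gr_comp_direct _ R) ddp dp p0).
by rewrite -dd -(gcompVm d) -{3}dE gcompKV.
Qed.

(** Inside any nonzero graded [K] in [1_f R] primeness finds a copy of [1_e R],
    and that copy is generated by an idempotent of degree [f]: take [k] in
    [K 1_e] and [t] with [k t k] nonzero; if [b] is a right inverse of [t k],
    then [k b t] is idempotent. *)
Lemma exists_idempotent e f (K : set (regular R)) :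
  right_simple_at R e -> gr_submodule K -> K `<=` right_ideal_at R f ->
  (exists c, K c /\ c <> 0) ->
  exists p : R, [/\ gr_comp (gid f) p, K p, principal_ideal (gr_one R e) p,
    p <> 0 & gr_mul p p = p].
Proof.
move=> [e0 inv] gK Kf [c1 [Kc1 c10]]; have [[_ KA] _] := gK.
have [g c0] := gr_neq0_homog c10; set c := rproj c1 g in c0.
have gc : gr_comp g c := rprojP c1 g.
have Kc : K c by exact: (gr_submodule_proj (M := regular R)).
have [l [r [lr]]] := prime gc (gr_one_comp R e) c0 e0.
set k := gr_mul _ _ => k0.
have Kk : K k by apply: (KA); exact: KA.
have Jk : principal_ideal (gr_one R e) k.
  apply: (principal_ideal_mul _ _).1.
  exact: principal_ideal_gen (gr_one_comp R e).
have [l1 h1] := gr_mul_homog gc lr.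
have [m mk] : exists m, gr_comp m k := gr_mul_homog h1 (gr_one_comp R e).
have me : gdom m = e.
  by apply: (homog_dom mk _ k0); rewrite /k -gr_mulA gr_one_idem.
clearbody k; have [s [t [st ktk]]] := prime mk mk k0 k0.
have tk0 : gr_mul t k <> 0 by move=> tk; apply: ktk;
  rewrite -gr_mulA tk gr_mulr0.
have sm : gdom s = gcod m.
  by apply: contrapT => ne; apply: tk0; exact: gr_mul_eq0 st mk ne.
have se : gcod s = e.
  rewrite -me; apply/esym; apply: contrapT => ne; apply: ktk.
  by rewrite (gr_mul_eq0 mk st ne) gr_mul0r.
have [|b [hb tkb]] := inv _ _ (gr_comp_mulE st mk sm) _ tk0.
  by rewrite gcod_comp.
pose p := gr_mul (gr_mul k b) t.
have tpk : gr_mul (gr_mul t p) k = gr_mul t k.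
  rewrite /p !gr_mulA tkb -gr_mulA; apply: (gr_mul1E (gr_comp_mulE st mk sm)).
  by rewrite gcod_comp.
have p0 : p <> 0.
  by move=> p0; apply: tk0; rewrite -tpk p0 gr_mulr0 gr_mul0r.
have pp : gr_mul p p = p.
  transitivity (gr_mul (gr_mul k b) (gr_mul (gr_mul (gr_mul t k) b) t)).
    by rewrite /p !gr_mulA.
  rewrite tkb gr_mulA -[gr_mul (gr_mul k b) _]gr_mulA (gr_mulE1 hb)//.
  by rewrite gdom_inv gcod_comp.
have Kp : K p by apply: (KA); exact: KA.
have [d1 hd1] := gr_mul_homog mk hb.
have [d hd] : exists d, gr_comp d p := gr_mul_homog hd1 st.
have dE := idem_degree hd p0 pp.
have df : gcod d = f by apply: (homog_cod hd _ p0); exact: Kf.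
exists p; split=> //; first by rewrite -df -dE.
apply: (principal_ideal_mul _ _).2; exact: (principal_ideal_mul _ _).2.
Qed.

(** A minimal complement of the ideal in [1_f R] must vanish, since an
    idempotent of the ideal could be split off it. *)
Lemma right_simple_full e : right_simple_at R e -> full_at R e.
Proof.
move=> simp; have eR := gr_one_comp R e.
apply: (gr_ideal_setT (principal_ideal_gr_ideal eR)) => f.
have [sJ mJ _] := principal_ideal_gr_ideal eR.
set J := principal_ideal _ in sJ mJ *.
pose Q (K : set (regular R)) := [/\ gr_submodule K, K `<=` right_ideal_at R f
  & exists k, K k /\ J (gr_one R f - k)].
have [||K [[gK Kf [k [Kk Jk]]] Kmin]] :=
    dcc_minimal ((right_artinianP R).1 art f) (Q := Q).
- by move=> N [gN Ne _].
- exists (right_ideal_at R f); split=> //; first exact: right_ideal_at_graded.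
  exists (gr_one R f); rewrite subrr; split; first exact: gr_one_idem.
  by case: sJ.
have [k0|k0] := pselect (k = 0);
  first by rewrite -[gr_one R f]subr0 -[in X in _ - X]k0.
have [|p [fp Kp Jp p0 pp]] := exists_idempotent simp gK Kf; first by exists k.
exfalso; apply: p0; have [[[K0 KB] KA] _] := gK.
pose K' : set (regular R) := [set a | K a /\ gr_mul p a = 0].
suff K'K : K' = K by have : K' p by [rewrite K'K]; case=> _; rewrite pp.
apply: Kmin => [|a [//]]; split=> [|a [/Kf//]|].
- apply: gr_submoduleI => [|a h [Ka pa]]; last first.
    split; first exact: (gr_submodule_proj (M := regular R)).
    by rewrite -(rproj_mul_object _ _ fp) pa (rproj_id (gr_comp0 R h)).
  split; last by move=> a b [Ka pa]; split;
    [exact: KA|rewrite /= gr_mulA pa gr_mul0r].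
  split; first by split=> //; exact: gr_mulr0.
  by move=> a b [Ka pa] [Kb pb]; split;
    [exact: KB|rewrite gr_mulBr pa pb subrr].
- exists (k - gr_mul p k); split; first split.
  + by apply: KB => //; exact: KA.
  + by rewrite gr_mulBr gr_mulA pp subrr.
  + by rewrite opprB addrA addrAC; apply: subgroupD => //; exact: (mJ _ _ Jp).2.
Qed.

End MinimalRightIdeals.

(** * Graded quotients and gr-prime rings with pseudo-free modules *)

Lemma exists_quotient_group (V : zmodType) (N : set V) : subgroup N ->
  exists (Q : zmodType) (pi : V -> Q),
    [/\ {morph pi : x y / x + y}, forall q, exists v, pi v = q
      & forall v, pi v = 0 <-> N v].
Proof.
move=> [N0 NB]; pose P : {pred V} := [pred v | `[< N v >]].
have clP : zmod_closed P.
  split; first exact/asboolP.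
  by move=> x y /asboolP Nx /asboolP Ny; apply/asboolP; exact: NB.
pose S : zmodClosed V := HB.pack P (GRing.isZmodClosed.Build V P clP).
pose Q : zmodType := Quotient.quot S.
pose pi : V -> Q := \pi_(Quotient.quot S)%qT.
have piD : {morph pi : x y / x + y} by move=> x y; rewrite /pi !piE.
have pi0 := additive0 piD.
exists Q, pi; split=> // [q|v]; first by exists (repr q); exact: reprK.
have E : (pi v == pi 0) = (v \in S).
  by rewrite -[v in RHS]subr0 Quotient.idealrBE.
rewrite -{1}pi0; split=> [/eqP|Nv]; first by rewrite E => /asboolP.
by apply/eqP; rewrite E; exact/asboolP.
Qed.

Section QuotientModule.
Variables (G : groupoid) (R : grRing G) (M : grModule R) (N : set M).
Hypothesis gN : gr_submodule N.
Variables (Q : zmodType) (pi : M -> Q) (s : Q -> M).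
Hypothesis piD : {morph pi : x y / x + y}.
Hypothesis piK : cancel s pi.
Hypothesis pi_ker : forall m, pi m = 0 <-> N m.

Let pi0 : pi 0 = 0. Proof. exact: additive0. Qed.

Let piN m : pi (- m) = - pi m. Proof. exact: additiveN. Qed.

Let pi_act m n a : pi m = pi n -> pi (gm_act m a) = pi (gm_act n a).
Proof.
move=> mn; apply/eqP; rewrite -subr_eq0 -piN -piD -gm_actBl; apply/eqP/pi_ker.
have [[_ NA] _] := gN; apply: NA; apply/pi_ker.
by rewrite piD piN mn subrr.
Qed.

Definition quot_act (q : Q) (a : R) : Q := pi (gm_act (s q) a).

Definition quot_comp (g : G) : set Q := pi @` gm_comp g.

Lemma quot_actE m a : pi (gm_act m a) = quot_act (pi m) a.
Proof. by apply: pi_act; rewrite piK. Qed.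

Lemma quot_actA q a b : quot_act q (gr_mul a b) = quot_act (quot_act q a) b.
Proof. by rewrite -[q]piK -!quot_actE gm_actA. Qed.

Lemma quot_actDl q r a : quot_act (q + r) a = quot_act q a + quot_act r a.
Proof. by rewrite -[q]piK -[r]piK -piD -!quot_actE gm_actDl piD. Qed.

Lemma quot_actDr q a b : quot_act q (a + b) = quot_act q a + quot_act q b.
Proof. by rewrite -[q]piK -!quot_actE gm_actDr piD. Qed.

Lemma quot_comp_subgroup g : subgroup (quot_comp g).
Proof.
have [c0 cB] := gm_comp_subgroup M g; split; first by exists 0.
move=> _ _ [m gm <-] [n gn <-]; exists (m - n); first exact: cB.
by rewrite piD piN.
Qed.

(** Lift a vanishing sum of homogeneous classes to homogeneous representatives:
    their sum is in [N], and [N] is graded, so each of them is. *)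
Lemma quot_comp_direct : internal_direct_sum quot_comp.
Proof.
apply: internal_direct_sumI; first exact: quot_comp_subgroup.
  move=> q; rewrite -[q]piK; move: (s q).
  have sI := internal_sum_subgroup quot_comp_subgroup.
  apply: gm_homog_ind; first exact: subgroup_preim piD sI.
  by move=> g m gm; apply: (internal_sum_comp quot_comp_subgroup (i := g));
    exists m.
move=> f [Qf ff f0].
have /choice[h hP] : forall g, exists m, gm_comp g m /\ pi m = f g /\
  (f g = 0 -> m = 0).
  move=> g; have [m gm mf] := Qf g.
  have [fg0|fg0] := pselect (f g = 0); last by exists m.
  by exists 0; rewrite pi0; split=> //; exact: gm_comp0.
have hf : finite_set [set g | h g != 0].
  apply: sub_finite_set ff => g /=; apply: contraNN => /eqP fg.
  by apply/eqP; case: (hP g) => _ [_]; apply.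
pose m := \sum_(g \in [set: G]) h g.
have Nm : N m.
  apply/pi_ker; rewrite /m (fsum_morph piD hf) [RHS]f0.
  by apply: eq_fsum => g; have [_ []] := hP g.
move=> g; have [_ [<- _]] := hP g; apply/pi_ker.
suff -> : h g = mproj m g by exact: gr_submodule_proj.
rewrite /mproj (@hcomp_unique _ _ _ (@gm_comp_direct _ _ M) m h)//.
by split=> // k; case: (hP k).
Qed.

Lemma quot_comp_act g h q a : quot_comp g q -> gr_comp h a ->
  ocomponent quot_comp (Defs.pcomp g h) (quot_act q a).
Proof.
move=> [m gm <-] ha; rewrite -quot_actE; have := gm_comp_act gm ha.
by case: (Defs.pcomp g h) => [k|] /= => [kma|->];
  [exists (gm_act m a)|exact: pi0].
Qed.

Lemma quot_act_full : set_product quot_act setT setT = setT.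
Proof.
apply/seteqP; split=> // q _; rewrite -[q]piK; move: (s q).
have sP : subgroup (set_product quot_act setT setT).
  by apply: set_product_subgroup => //; exact: quot_actDl.
apply: gm_homog_ind; first exact: subgroup_preim piD sP.
by move=> g m gm; rewrite /= -(gm_act1 gm) quot_actE; exact: set_product_mem.
Qed.

Definition quotient_module : grModule R :=
  GrModule quot_actA quot_actDl quot_actDr quot_comp_subgroup quot_comp_direct
    quot_comp_act quot_act_full.

End QuotientModule.

Lemma exists_quotient (G : groupoid) (R : grRing G) (M : grModule R)
    (N : set M) :
  gr_submodule N -> exists (Q : grModule R) (pi : M -> Q),
    [/\ {morph pi : x y / x + y},
        forall m a, pi (gm_act m a) = gm_act (pi m) a,
        forall g m, gm_comp g m -> gm_comp g (pi m),
        forall q, exists m, pi m = q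
      & forall m, pi m = 0 <-> N m].
Proof.
move=> gN; have [[sN _] _] := gN.
have [Q [pi [piD surj ker]]] := exists_quotient_group sN.
have [s sK] := choice surj.
exists (quotient_module gN piD sK ker), pi; split=> //.
- exact: (quot_actE gN piD sK ker).
- by move=> g m gm; exists m.
Qed.

Lemma pseudo_basis_free (G : groupoid) (R : grRing G) (M : grModule R)
    (I : choiceType) (x : I -> M) (g : I -> G) i b :
  pseudo_basis x g -> gr_mul (gr_one R (gdom (g i))) b = b ->
  gm_act (x i) b = 0 -> b = 0.
Proof.
move=> [_ _ free] b1 xb.
have := free (fun j => if j == i then b else 0).
move=> /(_ _ _ _ i); rewrite eqxx; apply.
- move=> j; case: eqP => [->|_]; first by exists b.
  by exists 0; rewrite gr_mulr0.
- apply: (sub_finite_set _ (finite_set1 i)) => j /=.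
  by case: (j =P i) => // _; rewrite eqxx.
- rewrite (fsum_eq (X := [fset i]%fset)) ?big_seq_fset1 ?eqxx// => j.
  by rewrite inE; case: (j == i); rewrite ?gm_act0r ?eqxx.
Qed.

Section PrimePfm.
Variables (G : groupoid) (R : grRing G).

(** Zorn's lemma, applied to the graded right ideals that contain [1_h] for
    [h] other than [f] but not [1_f]: a larger graded right ideal than a maximal
    one contains all [1_h], hence is [R], so the quotient is gr-simple. *)
Lemma exists_simple_module f : gr_one R f <> 0 ->
  exists M : grModule R, gr_simple_module M.
Proof.
move=> f0.
pose good (N : set (regular R)) := [/\ gr_submodule N,
  forall h, h <> f -> N (gr_one R h) & ~ N (gr_one R f)].
have good0 : good [set a | gr_mul (gr_one R f) a = 0].
  split=> [|h hf /=|]; last by rewrite /= gr_one_idem.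
    apply: gr_submoduleI => [|a h /= fa].
      split; first by apply: subgroup_ker => a b; exact: gr_mulDr.
      by move=> a b /= fa; rewrite gr_mulA fa gr_mul0r.
    by rewrite /= -(rproj_mul_object _ _ (gr_one_comp R f)) fa
      (rproj_id (gr_comp0 R h)).
  by apply: gr_mul1E0 (gr_one_comp R h) _; rewrite gcod_id.
(* The empty set is admitted because it is the union of the empty chain. *)
have [|N [gNP Nmax]] := @Zorn_bigcup (regular R) [set N | N = set0 \/ good N].
  move=> F FP Ftot.
  have goodF X x : F X -> X x -> good X.
    by move=> FX Xx; case: (FP _ FX) => // X0; rewrite X0 in Xx.
  have [[X [FX [x Xx]]]|nF] := pselect (exists X, F X /\ exists x, X x);
    last first.
    left; apply/seteqP; split=> // x [X FX Xx].
    by apply: nF; exists X; split=> //; exists x.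
  have [gX X1 nXf] := goodF _ _ FX Xx.
  right; split.
  - apply: gr_submoduleI; last first.
      move=> a h [Y FY Ya]; exists Y => //.
      by have [gY _ _] := goodF _ _ FY Ya; exact: gr_submodule_proj.
    split; last first.
      move=> a b [Y FY Ya]; exists Y => //.
      by have [[[_ YA] _] _ _] := goodF _ _ FY Ya; exact: YA.
    split; first by exists X => //; have [[[]]] := gX.
    move=> a b [Y FY Ya] [Z FZ Zb].
    have [[[[_ YB] _] _] _ _] := goodF _ _ FY Ya.
    have [[[[_ ZB] _] _] _ _] := goodF _ _ FZ Zb.
    have [YZ|ZY] := Ftot _ _ FY FZ.
      by exists Z => //; apply: ZB => //; exact: YZ.
    by exists Y => //; apply: YB => //; exact: ZY.
  - by move=> h hf; exists X => //; exact: X1.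
  - by move=> [Y FY Yf]; have [_ _] := goodF _ _ FY Yf.
have [gN N1 nNf] : good N.
  case: gNP => // N0; exfalso; apply: (Nmax _ _ (or_intror good0)).
  rewrite N0; split=> // /(_ 0) H; apply: H; exact: gr_mulr0.
have [Q [pi [piD piA pih surj ker]]] := exists_quotient gN.
exists Q; split.
  by exists (pi (gr_one R f)) => /ker.
move=> N' gN'; have [[sN' N'A] _] := gN'.
pose L : set (regular R) := pi @^-1` N'.
have gL : gr_submodule L.
  apply: gr_submoduleI => [|a h La].
    split; first exact: subgroup_preim.
    by move=> a b La; rewrite /L /preimage /mkset piA; exact: N'A.
  rewrite /L /preimage /mkset /mproj.
  rewrite -(hcomp_morph (@gm_comp_direct _ _ (regular R))
    (@gm_comp_direct _ _ Q))//.
  exact: (gr_submodule_proj (M := Q)).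
have NL : N `<=` L.
  by move=> a /ker; rewrite /L /preimage /mkset => ->; case: sN'.
have [[sL LA] _] := gL.
have [Lf|nLf] := pselect (L (gr_one R f)).
  right; apply/seteqP; split=> // q _; have [a <-] := surj q.
  suff : L a by [].
  move: a; apply: gr_homog_ind => // g a ga.
  rewrite -(gr_mul1r ga); apply: (LA); have [->//|gf] := pselect (gcod g = f).
  by apply: NL; exact: N1.
left; apply/seteqP; split=> [q N'q|_ ->]; last by case: sN'.
have [a aq] := surj q; have La : L a by rewrite /L /preimage /mkset aq.
rewrite /= -aq; apply/ker; apply: contrapT => nNa; apply: (Nmax L); last first.
  by right; split=> // h hf; apply: NL; exact: N1.
by split=> // /(_ a La).
Qed.

(** A pseudo-basis element [x] of a gr-simple module generates it freely, so
    that [a |-> x a] identifies [1_e R] with that module. *)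
Lemma pfm_right_simple : (exists a : R, a <> 0) -> pfm_ring R ->
  exists e, right_simple_at R e.
Proof.
move=> [a a0] pfm.
have [f f0] : exists f, gr_one R f <> 0.
  apply: contrapT => H; apply: a0; move: (a).
  apply: gr_homog_ind; first exact: subgroup0.
  move=> g b gb; rewrite -(gr_mul1r gb) (_ : gr_one R _ = 0) /= ?gr_mul0r//.
  by apply: contrapT => ne; apply: H; exists (gcod g).
have [M [[m m0] simp]] := exists_simple_module f0.
have [I [x [g pbx]]] := pfm M.
have [xh gen _] := pbx; have [i _] : exists i : I, True.
  apply: contrapT => H; have N0 : [set (0 : M)] = setT.
    apply: gen => [|i]; last by exfalso; apply: H; exists i.
    by have [] := gr_submodule0 M.
  by apply: m0; have : [set (0 : M)] m by rewrite N0.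
have [gx x0] := xh i; exists (gdom (g i)).
have inj b : gr_mul (gr_one R (gdom (g i))) b = b -> gm_act (x i) b = 0 ->
  b = 0.
  exact: pseudo_basis_free pbx.
split=> [e0|h b hb he b0].
  by apply: x0; rewrite -(gm_act1 gx) e0 gm_act0r.
have xb0 : gm_act (x i) b <> 0.
  by move=> xb; apply: b0; apply: inj => //; exact: (gr_mul1E hb he).
have xbh := gm_comp_actE gx hb (esym he).
have [C0|CT] := simp _ (cyclic_graded xbh).
  by exfalso; apply: xb0; have := cyclic_gen xbh; rewrite C0.
have : cyclic (gm_act (x i) b) (x i) by rewrite CT.
move=> [c _ xbc]; exists (rproj c (ginv h)); split; first exact: rprojP.
rewrite -he; apply: homog_right_inverse => //.
apply/eqP; rewrite -subr_eq0; apply/eqP; apply: inj.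
  rewrite he gr_mulBr gr_mulA gr_one_idem (gr_mul1E hb he)//.
by rewrite gm_actBr gm_actA xbc he (gm_act1 gx) subrr.
Qed.

(** A pseudo-basis element [z] of [R / J], where [J] is the ideal generated by
    [1_e], is killed by [J]; hence [1_h J = 0] for [h] its domain, which
    contradicts primeness. *)
Lemma prime_pfm_full e : homog_prime R -> pfm_ring R -> gr_one R e <> 0 ->
  full_at R e.
Proof.
move=> prime pfm e0; have eR := gr_one_comp R e.
have [sJ mJ gJ] := principal_ideal_gr_ideal eR.
set J := principal_ideal _ in sJ mJ gJ *.
have gJ' : gr_submodule (M := regular R) J.
  by split=> //; split=> // a b /(mJ b)[].
have [Q [pi [piD piA pih surj ker]]] := exists_quotient gJ'.
have [I [x [g pbx]]] := pfm Q.
have [xh gen _] := pbx; have noI (i : I) : False.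
  have [gx x0] := xh i; set h := gdom (g i).
  have h0 : gr_one R h <> 0.
    by move=> h0; apply: x0; rewrite -(gm_act1 gx) h0 gm_act0r.
  have [k [r [kr hre]]] := prime _ _ _ _ (gr_one_comp R h) eR h0 e0.
  set b := gr_mul _ _ in hre.
  have Jb : J b by apply: (mJ _ _ _).1; exact: principal_ideal_gen eR.
  have hb : gr_mul (gr_one R h) b = b by rewrite /b !gr_mulA gr_one_idem.
  have xb : gm_act (x i) b = 0.
    have [y <-] := surj (x i); rewrite -piA; apply/ker.
    exact: (mJ y _ Jb).1.
  by apply: hre; exact: pseudo_basis_free pbx hb xb.
have Q0 : [set (0 : Q)] = setT.
  by apply: gen => [|i]; [have [] := gr_submodule0 Q|case: (noI i)].
apply/seteqP; split=> // a _; apply/ker.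
have : [set (0 : Q)] (pi a) by rewrite Q0.
by [].
Qed.

End PrimePfm.

(** * Dual bases *)

(** Reduces expansions in a pseudo-basis to homogeneous elements. *)
Lemma subgroup_fsum_expansion (I : choiceType) (V W : zmodType)
    (c : I -> V -> W) (t : I -> W -> V) :
  (forall i, {morph c i : x y / x + y}) ->
  (forall i, {morph t i : x y / x + y}) ->
  subgroup [set v | finite_set [set i | c i v != 0] /\
                    v = \sum_(i \in [set: I]) t i (c i v)].
Proof.
move=> cD tD; have c0 i := additive0 (cD i); have t0 i := additive0 (tD i).
have cB i x y : c i (x - y) = c i x - c i y by rewrite cD (additiveN (cD i)).
have tB i x y : t i (x - y) = t i x - t i y by rewrite tD (additiveN (tD i)).
split.
  split; first by apply: (sub_finite_set _ (@finite_set0 I)) => i /=;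
    rewrite c0 eqxx.
  by rewrite (fsum_eq (X := fset0)) ?big_seq_fset0// => i; rewrite c0 t0 eqxx.
move=> x y [fx xE] [fy yE]; have [X XP] := finite_set_sub2 fx fy.
have cX i : c i (x - y) != 0 -> i \in X.
  rewrite cB => xy; apply: XP => /=.
  case: (eqVneq (c i x) 0) xy => [->|]; last by left.
  by rewrite sub0r oppr_eq0; right.
split; first exact: (sub_finite_set cX (finite_fset X)).
have tX z i : (c i z != 0 -> i \in X) -> t i (c i z) != 0 -> i \in X.
  by move=> h tz; apply: h; apply: contraNneq tz => ->; rewrite t0.
rewrite (fsum_eq (X := X)); last by move=> i; apply: tX; exact: cX.
under eq_bigr do rewrite cB tB.
have xX i : c i x != 0 -> i \in X by move=> cx; apply: XP; left.
have yX i : c i y != 0 -> i \in X by move=> cy; apply: XP; right.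
by rewrite sumrB {1}xE {1}yE (fsum_eq (fun i => tX x i (xX i)))
  (fsum_eq (fun i => tX y i (yX i))).
Qed.

Lemma pseudo_basis_span (G : groupoid) (R : grRing G) (M : grModule R)
    (I : choiceType) (x : I -> M) (g : I -> G) : pseudo_basis x g ->
  forall m, exists c : I -> R, finite_set [set i | c i != 0] /\
    m = \sum_(i \in [set: I]) gm_act (x i) (c i).
Proof.
move=> [xh gen _] m.
pose S := [set m | exists c : I -> R, finite_set [set i | c i != 0] /\
    m = \sum_(i \in [set: I]) gm_act (x i) (c i)].
suff ST : S = setT by have : S m by rewrite ST.
apply: gen => [|i].
  have xX (c : I -> R) (X : {fset I}) : (forall i, c i != 0 -> i \in X) ->
      forall i, gm_act (x i) (c i) != 0 -> i \in X.
    by move=> cX i xc; apply: cX; apply: contraNneq xc => ->; rewrite gm_act0r.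
  split; first split.
  - exists (fun=> 0); split.
      by apply: (sub_finite_set _ (@finite_set0 I)) => i /=; rewrite eqxx.
    rewrite (fsum_eq (X := fset0)) ?big_seq_fset0// => i.
    by rewrite gm_act0r eqxx.
  - move=> _ _ [c [fc ->]] [d [fd ->]].
    have [X XP] := finite_set_sub2 fc fd.
    have cX i : c i != 0 -> i \in X by move=> ci; apply: XP; left.
    have dX i : d i != 0 -> i \in X by move=> di; apply: XP; right.
    have cdX i : c i - d i != 0 -> i \in X.
      case: (eqVneq (c i) 0) => [->|/cX//]; by rewrite sub0r oppr_eq0;
        exact: dX.
    exists (fun i => c i - d i); split;
      first exact: (sub_finite_set cdX (finite_fset X)).
    rewrite (fsum_eq (xX _ _ cX)) (fsum_eq (xX _ _ dX)) (fsum_eq (xX _ _ cdX))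
      -sumrB.
    by apply: eq_bigr => i _; rewrite gm_actBr.
  - move=> _ a [c [fc ->]]; have [X XP] := finite_set_sub fc.
    have caX i : gr_mul (c i) a != 0 -> i \in X.
      by move=> ca; apply: XP; apply: contraNneq ca => ->; rewrite gr_mul0r.
    exists (fun i => gr_mul (c i) a); split;
      first exact: (sub_finite_set caX (finite_fset X)).
    rewrite (fsum_eq (xX _ _ XP)) (fsum_eq (xX _ _ caX)) gm_act_suml.
    by apply: eq_bigr => i _; rewrite gm_actA.
exists (fun j => if j == i then gr_one R (gdom (g i)) else 0); split.
  apply: (sub_finite_set _ (finite_set1 i)) => j /=.
  by case: (j =P i) => // _; rewrite eqxx.
have [gx _] := xh i.
rewrite (fsum_eq (X := [fset i]%fset)) ?big_seq_fset1 ?eqxx ?(gm_act1 gx)//.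
move=> j.
by rewrite inE; case: (j == i); rewrite ?gm_act0r ?eqxx.
Qed.

(** The family [x] is a homogeneous basis of the right module [R] and [y] is
    the family of its coordinate forms, seen as left multiplications. *)
Record dual_basis (G : groupoid) (R : grRing G) (e : gobj G) (I : choiceType)
    (g : I -> G) (x y : I -> R) : Prop := DualBasis {
  db_dom : forall i, gdom (g i) = e;
  db_x : forall i, gr_comp (g i) (x i);
  db_y : forall i, gr_comp (ginv (g i)) (y i);
  db_ortho : forall i j, gr_mul (y i) (x j) = if i == j then gr_one R e else 0;
  db_finite : forall f, finite_set [set i | gcod (g i) = f];
  db_expand : forall a, finite_set [set i | gr_mul (y i) a != 0] /\
    a = \sum_(i \in [set: I]) gr_mul (x i) (gr_mul (y i) a)
}.

(** The coordinates of [1_f] in a pseudo-basis, taken for [f] the codomain of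
    the [i]th basis element, give the [i]th dual element. *)
Lemma exists_dual_basis (G : groupoid) (R : grRing G) (e : gobj G)
    (I : choiceType) (x : I -> regular R) (g : I -> G) :
  pseudo_basis x g -> (forall i, gdom (g i) = e) ->
  exists y, dual_basis e g x y.
Proof.
move=> pb ge; have [xh _ free] := pb.
have gx i : gr_comp (g i) (x i) by have [] := xh i.
have [c cP] := choice (fun f => pseudo_basis_span pb (gr_one R f)).
pose y i : R := rproj (c (gcod (g i)) i) (ginv (g i)).
have gy i : gr_comp (ginv (g i)) (y i) := rprojP _ _.
have ey i a : gr_mul (gr_one R e) (gr_mul (y i) a) = gr_mul (y i) a.
  by rewrite gr_mulA (gr_mul1E (gy i))// gcod_inv.
pose u f i : R := if gcod (g i) == f then gr_mul (x i) (y i) else 0.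
have uE f : finite_set [set i | c f i != 0] /\
    gr_one R f = \sum_(i \in [set: I]) u f i.
  have [cf one_f] := cP f; split=> //.
  have id_f : gcod (gid f) = f by rewrite gcod_id.
  have xf : finite_set [set i | gr_mul (x i) (c f i) != 0].
    apply: sub_finite_set cf => i /=; apply: contraNN => /eqP->.
    by rewrite gr_mulr0.
  rewrite -[LHS](rproj_id (gr_one_comp R f)) {1}one_f.
  rewrite (fsum_morph (phi := fun a : R => rproj a (gid f)) _ xf);
    last exact: rprojD.
  apply: eq_fsum => i; rewrite /u.
  case: (gcod (g i) =P f) => [fi|ne].
    have := @mproj_act _ _ (regular R) (g i) (gid f) _ (c f i) (gx i).
    rewrite id_f => /(_ fi) E; rewrite [LHS]E /y fi.
    suff -> : gcomp (ginv (g i)) (gid f) = ginv (g i) by [].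
    by rewrite -fi -(gdom_inv (g i)) gcompm1.
  by apply: (mproj_act_out (M := regular R) _ (gx i)); rewrite id_f.
have expand1 f a : gr_mul (gr_one R f) a =
    \sum_(i \in [set: I]) gr_mul (u f i) a.
  have [cf one_f] := uE f; have [X XP] := finite_set_sub cf.
  have uX i : u f i != 0 -> i \in X.
    rewrite /u; case: (gcod (g i) =P f) => [fi|_]; last by rewrite eqxx.
    move=> xy; apply: XP => /=; apply: contraNneq xy => c0.
    by rewrite /y fi c0 (rproj_id (gr_comp0 R _)) gr_mulr0.
  rewrite one_f (fsum_eq uX) gr_mul_suml (fsum_eq (X := X))// => i ua.
  by apply: uX; apply: contraNneq ua => ->; rewrite gr_mul0r.
have ufin f : finite_set [set i | u f i != 0].
  have [cf _] := uE f; apply: sub_finite_set cf => i /=.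
  rewrite /u; case: (gcod (g i) =P f) => [fi|_]; last by rewrite eqxx.
  by apply: contraNN => /eqP c0;
    rewrite /y fi c0 (rproj_id (gr_comp0 R _)) gr_mulr0.
have ortho i j : gr_mul (y i) (x j) = if i == j then gr_one R e else 0.
  have [ij|ij] := pselect (gcod (g i) = gcod (g j)); last first.
    rewrite (gr_mul_eq0 (gy i) (gx j)) ?gdom_inv//.
    by case: eqP => // ijE; rewrite ijE in ij.
  pose d k : R := (if gcod (g k) == gcod (g j) then gr_mul (y k) (x j) else 0)
    - (if k == j then gr_one R e else 0).
  suff : d i = 0 by rewrite /d ij eqxx => /eqP; rewrite subr_eq0 => /eqP.
  have [cf one_f] := uE (gcod (g j)); have [X XP] := finite_set_sub cf.
  have yX k : gcod (g k) = gcod (g j) -> y k <> 0 -> k \in X.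
    move=> kj yk; apply: XP => /=; apply: contra_notN yk => /eqP c0.
    by rewrite /y kj c0 (rproj_id (gr_comp0 R _)).
  have dX k : d k != 0 -> k \in (j |` X)%fset.
    rewrite /d !inE; case: (k =P j) => //= _; rewrite subr0.
    case: (gcod (g k) =P gcod (g j)) => [kj dk|_]; last by rewrite eqxx.
    by apply: yX => // yk; rewrite yk gr_mul0r eqxx in dk.
  apply: (free d) => [k||].
  - exists (d k); rewrite ge /d gr_mulBr; congr (_ - _).
      by case: eqP => _; rewrite ?gr_mulr0 ?ey.
    by case: eqP => _; rewrite ?gr_mulr0 ?gr_one_idem.
  - exact: (sub_finite_set dX (finite_fset _)).
  rewrite (fsum_eq (X := (j |` X)%fset)); last first.
    by move=> k xd; apply: dX; apply: contraNneq xd => ->; rewrite /= gr_mulr0.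
  under eq_bigr do rewrite /= /d gr_mulBr.
  rewrite sumrB; apply/eqP; rewrite subr_eq0; apply/eqP; transitivity (x j).
    have := expand1 (gcod (g j)) (x j); rewrite (gr_mul1r (gx j)) => {2}->.
    rewrite (fsum_eq (X := (j |` X)%fset)); last first.
      move=> k; rewrite /u; case: (gcod (g k) =P gcod (g j)) => [kj uk|_];
        last by rewrite gr_mul0r eqxx.
      rewrite !inE; apply/orP; right; apply: yX => // yk.
      by rewrite yk gr_mulr0 gr_mul0r eqxx in uk.
    apply: eq_bigr => k _; rewrite /u; case: (gcod (g k) =P gcod (g j)) => _;
      last by rewrite gr_mulr0 gr_mul0r.
    by rewrite gr_mulA.
  rewrite (bigD1_seq j) ?fset_uniq ?inE ?eqxx//= (gr_mulE1 (gx j) (ge j)).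
  by rewrite big1 ?addr0// => k /negPf->; rewrite gr_mulr0.
exists y; split=> // [f|a].
  have [cf _] := uE f; apply: sub_finite_set cf => i /= fi.
  have e0 : gr_one R e <> 0.
    move=> e0; have [xi x0] := xh i; apply: x0.
    by rewrite -(gr_mulE1 xi (ge i)) e0 gr_mulr0.
  apply: contra_notN e0 => /eqP c0; have := ortho i i; rewrite eqxx => <-.
  by rewrite /y fi c0 (rproj_id (gr_comp0 R _)) gr_mul0r.
suff : [set a | finite_set [set i | gr_mul (y i) a != 0] /\
    a = \sum_(i \in [set: I]) gr_mul (x i) (gr_mul (y i) a)] a by [].
move: a; apply: gr_homog_ind.
  apply: (@subgroup_fsum_expansion I R R
    (fun i => gr_mul (y i)) (fun i => gr_mul (x i))) => i a b;
    exact: gr_mulDr.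
move=> h a ha /=.
have yu i : gr_mul (x i) (gr_mul (y i) a) = gr_mul (u (gcod h) i) a.
  rewrite /u; case: eqP => [_|ne]; first by rewrite gr_mulA.
  by rewrite (gr_mul_eq0 (gy i) ha) ?gdom_inv// gr_mulr0 gr_mul0r.
split; last first.
  rewrite -[LHS](gr_mul1r ha) expand1.
  by apply: eq_fsum => i; rewrite yu.
have [cf _] := uE (gcod h); apply: sub_finite_set cf => i /= ya.
apply: contraNneq ya => c0.
have [hi|hi] := pselect (gcod (g i) = gcod h); last first.
  by rewrite (gr_mul_eq0 (gy i) ha) ?gdom_inv.
by rewrite /y hi c0 (rproj_id (gr_comp0 R _)) gr_mul0r.
Qed.

Lemma dual_basis_at (G : groupoid) (R : grRing G) (e : gobj G) :
  right_simple_at R e -> full_at R e ->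
  exists (I : choiceType) (g : I -> G) (x y : I -> R), dual_basis e g x y.
Proof.
move=> simp full.
have [I [x [g [pb ge]]]] := pseudo_basis_at (regular R) simp full.
by have [y xy] := exists_dual_basis pb ge; exists I, g, x, y.
Qed.

(** * The regular module as a direct sum of shifts *)

(** For [s] with codomain [e], all degrees of [1_e R] have the form [s g], so
    the shift by [s] keeps the whole module and only relabels degrees. *)
Lemma object_shift_pred_full (G : groupoid) (R : grRing G) (e : gobj G) s
    (v : object_shift (regular R) e) : gcod s = e ->
  v \in shift_pred (M := object_shift (regular R) e) s.
Proof.
move=> se; apply/asboolP; move: v.
have sS := shift_family_subgroup (object_shift (regular R) e) s.
have sI := internal_sum_subgroup sS.
apply: gm_homog_ind => // h v hv.
have [v0|v0] := pselect (v = 0); first by rewrite v0; case: sI.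
have he : gcod h = e.
  apply: contrapT => ne; apply: v0; apply/val_inj => /=.
  by have [_ ] := object_shiftP hv; apply.
apply: (internal_sum_comp sS (i := gcomp (ginv s) h)).
have sh : gcomp s (gcomp (ginv s) h) = h.
  by rewrite gcompA ?gcod_inv ?gdom_inv ?se// gcompmV se -he gcomp1m.
rewrite /shift_family pcomp_def ?sh//.
by rewrite gcod_comp ?gcod_inv ?gdom_inv ?se.
Qed.

Definition to_summand (G : groupoid) (R : grRing G) (e : gobj G) s
    (se : gcod s = e) (v : object_shift (regular R) e) :
  shift (object_shift (regular R) e) s :=
  ShiftSort (object_shift_pred_full v se).

Section DualBasis.
Variables (G : groupoid) (R : grRing G) (e : gobj G) (I : choiceType).
Variables (g : I -> G) (x y : I -> R).
Hypothesis xy : dual_basis e g x y.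

Lemma db_y_left i a : gr_mul (gr_one R e) (gr_mul (y i) a) = gr_mul (y i) a.
Proof. by rewrite gr_mulA (gr_mul1E (db_y xy i))// gcod_inv (db_dom xy). Qed.

Lemma db_x_right i a : gr_mul (gr_mul a (x i)) (gr_one R e) = gr_mul a (x i).
Proof. by rewrite -gr_mulA (gr_mulE1 (db_x xy i))// (db_dom xy). Qed.

Lemma db_eq0 a : (forall i, gr_mul (y i) a = 0) -> a = 0.
Proof.
move=> ya; have [_ ->] := db_expand xy a.
by rewrite (fsum_eq (X := fset0)) ?big_seq_fset0// => i;
  rewrite ya gr_mulr0 eqxx.
Qed.

Lemma db_expand_mul a b : gr_mul a b =
  \sum_(i \in [set: I]) gr_mul (gr_mul a (x i)) (gr_mul (y i) b).
Proof.
have [fy {1}->] := db_expand xy b.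
have xyf : finite_set [set i | gr_mul (x i) (gr_mul (y i) b) != 0].
  by apply: sub_finite_set fy => i /=; apply: contraNN => /eqP->;
    rewrite gr_mulr0.
rewrite (fsum_morph (phi := gr_mul a) _ xyf); last by move=> u v;
  exact: gr_mulDr.
by apply: eq_fsum => i; rewrite gr_mulA.
Qed.

Let summand i := shift (object_shift (regular R) e) (ginv (g i)).

Let inv_cod i : gcod (ginv (g i)) = e.
Proof. by rewrite gcod_inv (db_dom xy). Qed.

Let coord i (a : R) : summand i :=
  to_summand (inv_cod i) (to_object_shift (db_y_left i a)).

Let underlying i (v : summand i) : R := shift_val (shift_val v).

Let underlying_inj i : injective (@underlying i).
Proof. by move=> u v uv; apply/val_inj/val_inj. Qed.

Let underlyingP i (v : summand i) :
  gr_mul (gr_one R e) (underlying v) = underlying v.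
Proof. exact: object_shift_valP. Qed.

Let coordsP a : finite_set [set i | coord i a != 0].
Proof.
have [ya _] := db_expand xy a; apply: sub_finite_set ya => i /=.
by apply: contraNN => /eqP ya0; apply/eqP/underlying_inj.
Qed.

(** The map [a |-> (y_i a)_i] has inverse [v |-> sum of x_i v_i]. *)
Lemma regular_iso_direct_sum : gr_module_iso (regular R) (direct_sum summand).
Proof.
pose phi (a : regular R) : direct_sum summand := FsFam (coordsP a).
have phiD : {morph phi : a b / a + b}.
  by move=> a b; apply: fsfamP => i; apply: underlying_inj; exact: gr_mulDr.
have phi_inj : injective phi.
  move=> a b ab; apply/eqP; rewrite -subr_eq0; apply/eqP; apply: db_eq0 => i.
  have E : underlying (phi a i) = underlying (phi b i) by rewrite ab.
  by rewrite gr_mulBr (E : gr_mul (y i) a = gr_mul (y i) b) subrr.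
have phi_surj v : exists a, phi a = v.
  move: v; apply: fsfam_ind.
    split.
      by exists 0; apply: fsfamP => i; apply: underlying_inj; exact: gr_mulr0.
    move=> _ _ [a <-] [b <-]; exists (a - b).
    by apply: fsfamP => i; apply: underlying_inj; exact: gr_mulBr.
  move=> i v; exists (gr_mul (x i) (underlying v)).
  apply: fsfamP => j; apply: underlying_inj; rewrite /= /underlying /=.
  rewrite gr_mulA (db_ortho xy); case: (eqVneq j i) => [->|ji].
    by rewrite dfwith_in; exact: underlyingP.
  by rewrite dfwith_out 1?eq_sym// gr_mul0r.
exists phi; split=> //.
- have [psi psiK] := choice phi_surj; exists psi => // a; exact: phi_inj.
- by move=> a b; apply: fsfamP => i; apply: underlying_inj; exact: gr_mulA.
move=> k a ka /= i; rewrite /= /shift_comp /shift_family /=.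
have yi := db_y xy i.
rewrite /Defs.pcomp; case: (gdom (ginv (g i)) =P gcod k) => /= ik.
  have c : gcod (gcomp (ginv (g i)) k) = e by rewrite gcod_comp.
  by apply: object_shift_homog => //; exact: gr_comp_mulE.
by apply/val_inj => /=; exact: (gr_mul_eq0 yi ka ik).
Qed.

End DualBasis.

(** * The corner ring [1_e R 1_e] *)

Section Corner.
Variables (G : groupoid) (R : grRing G) (e : gobj G).

Definition corner_pred : {pred R} :=
  [pred a | `[< gr_mul (gr_one R e) a = a /\ gr_mul a (gr_one R e) = a >]].

Lemma corner_pred_closed : zmod_closed corner_pred.
Proof.
split; first by apply/asboolP; rewrite gr_mulr0 gr_mul0r.
move=> a b /asboolP[ea ae] /asboolP[eb be]; apply/asboolP.
by rewrite gr_mulBr gr_mulBl ea eb ae be.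
Qed.

HB.instance Definition _ := GRing.isZmodClosed.Build R corner_pred
  corner_pred_closed.

Record corner_sort : Type :=
  Corner { corner_val :> R; corner_valP : corner_val \in corner_pred }.

HB.instance Definition _ := [isSub for corner_val].
HB.instance Definition _ := [Choice of corner_sort by <:].
HB.instance Definition _ := [SubChoice_isSubZmodule of corner_sort by <:].

Lemma corner_mul_closed (a b : corner_sort) : gr_mul a b \in corner_pred.
Proof.
have /asboolP[ea _] := corner_valP a; have /asboolP[_ be] := corner_valP b.
by apply/asboolP; rewrite gr_mulA ea -gr_mulA be.
Qed.

Definition corner_mul (a b : corner_sort) : corner_sort :=
  Corner (corner_mul_closed a b).

Lemma corner_one_closed f :
  (if f == e then gr_one R e else 0) \in corner_pred.
Proof.
apply/asboolP; case: eqP => _; first by rewrite gr_one_idem.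
by rewrite gr_mulr0 gr_mul0r.
Qed.

Definition corner_one f : corner_sort := Corner (corner_one_closed f).

(** For a nonzero element of the corner this forces [g] to be an endomorphism of
    [e], see [corner_degree]. *)
Definition corner_comp (g : G) : set corner_sort :=
  [set a | gr_comp g (corner_val a)].

Lemma corner_degree g (a : corner_sort) : corner_comp g a -> a <> 0 ->
  gcod g = e /\ gdom g = e.
Proof.
move=> ga a0; have /asboolP[ea ae] := corner_valP a.
have a0' : corner_val a <> 0 by move=> E; apply: a0; apply/val_inj.
by split; [exact: homog_cod ga ea a0'|exact: homog_dom ga ae a0'].
Qed.

Lemma corner_proj_closed a :
  gr_mul (gr_mul (gr_one R e) a) (gr_one R e) \in corner_pred.
Proof.
apply/asboolP; split; first by rewrite !gr_mulA gr_one_idem.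
by rewrite -gr_mulA gr_one_idem.
Qed.

Definition corner_proj a : corner_sort := Corner (corner_proj_closed a).

Lemma corner_projD : {morph corner_proj : a b / a + b}.
Proof. by move=> a b; apply/val_inj; rewrite /= gr_mulDr gr_mulDl. Qed.

Lemma corner_projK (a : corner_sort) : corner_proj (corner_val a) = a.
Proof.
have /asboolP[ea ae] := corner_valP a.
by apply/val_inj; rewrite /= ea ae.
Qed.

Lemma corner_proj_comp g a : gr_comp g a -> corner_comp g (corner_proj a).
Proof.
move=> ga; rewrite /corner_comp /mkset /=.
have [ge|ge] := pselect (gcod g = e); last first.
  by rewrite (gr_mul1E0 ga ge) gr_mul0r; exact: gr_comp0.
rewrite (gr_mul1E ga ge).
have [de|de] := pselect (gdom g = e); last first.
  by rewrite (gr_mulE10 ga de); exact: gr_comp0.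
by rewrite (gr_mulE1 ga de).
Qed.

Lemma corner_comp_subgroup g : subgroup (corner_comp g).
Proof.
have [c0 cB] := gr_comp_subgroup R g.
by split=> [|a b ga gb]; [exact: c0|exact: cB].
Qed.

Lemma corner_comp_direct : internal_direct_sum corner_comp.
Proof.
have sC := corner_comp_subgroup; have sI := internal_sum_subgroup sC.
apply: internal_direct_sumI => // [a|f [Cf ff f0] g].
  rewrite -(corner_projK a); move: (corner_val a).
  apply: gr_homog_ind; first exact: subgroup_preim corner_projD sI.
  move=> g b gb; apply: (internal_sum_comp sC (i := g)).
  exact: corner_proj_comp.
apply/val_inj.
have vD : {morph corner_val : a b / a + b} by [].
apply: (internal_direct_sum_indep (@gr_comp_subgroup _ R) (@gr_comp_direct _ R)
  (h := Some) (f := fun h => corner_val (f h))) => //.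
- by move=> j k i [->] [->].
- by rewrite -(fsum_morph vD ff) -f0.
Qed.

Lemma corner_comp_mul g h a b : corner_comp g a -> corner_comp h b ->
  ocomponent corner_comp (Defs.pcomp g h) (corner_mul a b).
Proof.
move=> ga hb; have := gr_comp_mul ga hb.
by case: (Defs.pcomp g h) => [k //|/= ab]; apply/val_inj.
Qed.

Lemma corner_one_comp f : corner_comp (gid f) (corner_one f).
Proof.
rewrite /corner_comp /mkset /=; case: eqP => [->|_]; first exact: gr_one_comp.
exact: gr_comp0.
Qed.

Lemma corner_mul1r g a : corner_comp g a ->
  corner_mul (corner_one (gcod g)) a = a.
Proof.
move=> ga; apply/val_inj => /=.
have [->|a0] := pselect (a = 0); first by rewrite gr_mulr0.
have [ge _] := corner_degree ga a0; rewrite ge eqxx.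
by have /asboolP[] := corner_valP a.
Qed.

Lemma corner_mulr1 g a : corner_comp g a ->
  corner_mul a (corner_one (gdom g)) = a.
Proof.
move=> ga; apply/val_inj => /=.
have [->|a0] := pselect (a = 0); first by rewrite gr_mul0r.
have [_ ge] := corner_degree ga a0; rewrite ge eqxx.
by have /asboolP[] := corner_valP a.
Qed.

Lemma corner_mulA : associative corner_mul.
Proof. by move=> a b c; apply/val_inj; exact: gr_mulA. Qed.

Lemma corner_mulDl : left_distributive corner_mul +%R.
Proof. by move=> a b c; apply/val_inj; exact: gr_mulDl. Qed.

Lemma corner_mulDr : right_distributive corner_mul +%R.
Proof. by move=> a b c; apply/val_inj; exact: gr_mulDr. Qed.

Definition corner_ring : grRing G :=
  GrRing corner_mulA corner_mulDl corner_mulDr corner_comp_subgroup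
    corner_comp_direct corner_comp_mul corner_one_comp corner_mul1r
    corner_mulr1.

Lemma corner_supp : gr_supp corner_ring `<=` [set g | gcod g = e /\ gdom g = e].
Proof.
move=> g gs; apply: contrapT => ge; apply: gs.
apply/seteqP; split=> [a ga|_ ->]; last by case: (corner_comp_subgroup g).
by apply: contrapT => a0; apply: ge; exact: corner_degree ga a0.
Qed.

(** Right inverses suffice: a right inverse [b] of [a] has itself a right
    inverse [c], and then [a = a b c = c]. *)
Lemma corner_division : right_simple_at R e -> gr_division_ring corner_ring.
Proof.
move=> [e0 inv]; split.
  exists (corner_one e) => /(congr1 corner_val) /=; rewrite eqxx.
  exact: e0.
move=> g a ga a0; have [ge de] := corner_degree ga a0.
have inv' h (b : corner_sort) : corner_comp h b -> b <> 0 ->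
    exists c : corner_sort, corner_comp (ginv h) c /\
      corner_mul b c = corner_one e.
  move=> hb b0; have [he de'] := corner_degree hb b0.
  have b0' : corner_val b <> 0 by move=> E; apply: b0; apply/val_inj.
  have [c [hc bc]] := inv _ _ hb he b0'.
  exists (corner_proj c); split; first exact: corner_proj_comp.
  have /asboolP[_ be] := corner_valP b.
  by apply/val_inj; rewrite /= !gr_mulA be bc gr_one_idem eqxx.
have one0 : corner_one e <> 0.
  by move=> /(congr1 corner_val) /=; rewrite eqxx.
have [b [gb ab]] := inv' _ _ ga a0.
have b0 : b <> 0.
  move=> b0; apply: one0; rewrite -ab b0; apply/val_inj; exact: gr_mulr0.
have [c [_ bc]] := inv' _ _ gb b0.
exists b; rewrite ge de; split=> //=.
suff -> : a = c by [].
have ic : gcod (ginv g) = e by rewrite gcod_inv.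
have /asboolP[_ ae] := corner_valP a.
have /asboolP[ec _] := corner_valP c.
apply/val_inj; have := congr1 corner_val bc; rewrite /= eqxx => bc'.
have := congr1 corner_val ab; rewrite /= eqxx => ab'.
by rewrite -ae -bc' gr_mulA ab' ec.
Qed.

End Corner.

Section MatrixIso.
Variables (G : groupoid) (R : grRing G) (e : gobj G) (I : choiceType).
Variables (g : I -> G) (x y : I -> R).
Hypothesis simp : right_simple_at R e.
Hypothesis xy : dual_basis e g x y.

Let D := corner_ring R e.
Let s i := ginv (g i).

Lemma db_inv_cod i : gcod (s i) = e.
Proof. by rewrite gcod_inv (db_dom xy). Qed.

Lemma db_d_finite : d_finite s.
Proof.
move=> f; apply: sub_finite_set (db_finite xy f) => i /=.
by rewrite gdom_inv.
Qed.

Let entry (a : R) (p : I * I) : D :=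
  corner_proj e (gr_mul (gr_mul (y p.1) a) (x p.2)).

Let entryE a i j : corner_val (entry a (i, j)) = gr_mul (gr_mul (y i) a) (x j).
Proof. by rewrite /= gr_mulA (db_y_left xy) (db_x_right xy). Qed.

Let entryP a i j (u : D) :
  corner_val u = gr_mul (gr_mul (y i) a) (x j) -> entry a (i, j) = u.
Proof. by move=> uE; rewrite /entry /= -uE; exact: corner_projK. Qed.

Let entryD : forall p, {morph entry^~ p : a b / a + b}.
Proof.
move=> [i j] a b; apply: entryP.
rewrite [LHS](_ : _ =
  corner_val (entry a (i, j)) + corner_val (entry b (i, j)))//.
by rewrite !entryE gr_mulDr gr_mulDl.
Qed.

Let entriesP a : finite_set [set p | entry a p != 0].
Proof.
have e0 p := additive0 (entryD p).
move: a; apply: gr_homog_ind.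
  split; first by apply: (sub_finite_set _ (@finite_set0 _)) => p /=;
    rewrite e0 eqxx.
  move=> a b fa fb; have [X XP] := finite_set_sub2 fa fb.
  apply: (sub_finite_set _ (finite_fset X)) => p /= ab; apply: XP => /=.
  have [a0|a0] := eqVneq (entry a p) 0; last by left.
  right; apply: contraNneq ab => b0.
  by apply/eqP; have := entryD p (a - b) b; rewrite subrK a0 b0 addr0.
move=> h a ha.
apply: (sub_finite_set _
  (finite_setX (db_finite xy (gcod h)) (db_finite xy (gdom h)))).
move=> [i j] /= aij.
have aij' : gr_mul (gr_mul (y i) a) (x j) <> 0.
  move=> E; case/eqP: aij; apply: entryP; exact: esym.
have ih : gcod (g i) = gcod h.
  apply: contrapT => ne; apply: aij'.
  by rewrite (gr_mul_eq0 (db_y xy i) ha) ?gr_mul0r// gdom_inv.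
split=> //=; apply: contrapT => ne; apply: aij'.
have yah := gr_comp_mulE (db_y xy i) ha (etrans (gdom_inv _) ih).
apply: (gr_mul_eq0 yah (db_x xy j)); rewrite gdom_comp ?gdom_inv// => E.
by apply: ne; rewrite E.
Qed.

Let M := matrix_ring (@corner_supp G R e) db_inv_cod db_d_finite.

Let phi (a : R) : M := FsFam (entriesP a).

Let phiD : {morph phi : a b / a + b}.
Proof. by move=> a b; apply: fsfamP => p; exact: entryD. Qed.

Let phi_inj : injective phi.
Proof.
move=> a b ab; apply/eqP; rewrite -subr_eq0; apply/eqP.
have E i j : gr_mul (gr_mul (y i) (a - b)) (x j) = 0.
  have : entry a (i, j) = entry b (i, j).
    by have := congr1 (fun c : M => Defs.fsval c (i, j)) ab.
  move=> /(congr1 (@corner_val G R e)); rewrite !entryE => abE.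
  by rewrite gr_mulBr gr_mulBl abE subrr.
apply: (db_eq0 xy) => i; apply: gr_left_annihilator0 => c.
rewrite (db_expand_mul xy) (fsum_eq (X := fset0)) ?big_seq_fset0// => j.
by rewrite E gr_mul0r eqxx.
Qed.

Let phi_surj (u : M) : exists a, phi a = u.
Proof.
move: u; apply: fsfam_ind.
  have phi0 := additive0 phiD.
  split; first by exists 0.
  move=> _ _ [a <-] [b <-]; exists (a - b).
  by apply: (addIr (phi b)); rewrite -phiD !subrK.
move=> [i j] u; exists (gr_mul (gr_mul (x i) (corner_val u)) (y j)).
have /asboolP[eu ue] := corner_valP u.
apply: fsfamP => -[k l]; apply: entryP.
transitivity (gr_mul (gr_mul (gr_mul (y k) (x i)) (corner_val u))
    (gr_mul (y j) (x l))); last by rewrite !gr_mulA.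
rewrite !(db_ortho xy) /=; case: (eqVneq (i, j) (k, l)) => [[<- <-]|ne].
  by rewrite dfwith_in !eqxx eu ue.
rewrite dfwith_out//; case: (eqVneq k i) => [ki|_]; last by rewrite !gr_mul0r.
case: (eqVneq j l) => [jl|_]; last by rewrite gr_mulr0.
by rewrite ki jl eqxx in ne.
Qed.

Let phiM : {morph phi : a b / gr_mul a b}.
Proof.
move=> a b; apply: fsfamP => -[i j]; apply: entryP; rewrite /= /mx_mul_fun /=.
have vD : {morph (@corner_val G R e) : u v / u + v} by [].
rewrite (fsum_morph vD); last first.
  have [fy _] := db_expand xy (gr_mul b (x j));
    apply: sub_finite_set fy => k /=.
  apply: contraNN => /eqP yb; apply/eqP/val_inj.
  rewrite [LHS](_ : _ = gr_mul (corner_val (entry a (i, k)))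
    (corner_val (entry b (k, j))))//.
  by rewrite !entryE -[X in gr_mul _ X]gr_mulA yb gr_mulr0.
rewrite gr_mulA -[RHS]gr_mulA (db_expand_mul xy); apply: eq_fsum => k.
rewrite [LHS](_ : _ = gr_mul (corner_val (entry a (i, k)))
  (corner_val (entry b (k, j))))//.
by rewrite !entryE -[X in gr_mul _ X]gr_mulA.
Qed.

Let phi_comp h a : gr_comp h a -> gr_comp (g0 := M) h (phi a).
Proof.
move=> ha; change (mx_comp s h (phi a)) => i j.
case E: mx_degree => [k|] /=.
  have [ih hj ->] := mx_degreeP E;
    rewrite /corner_comp /mkset -/(entry a (i, j)) entryE.
  have yah := gr_comp_mulE (db_y xy i) ha ih.
  have invK : ginv (s j) = g j.
    rewrite -[LHS]gcompm1 gdom_inv (db_inv_cod j) -(db_dom xy j).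
    rewrite -(gcompVm (g j)) gcompA ?gdom_inv ?gcod_inv ?gdom_inv//.
    by rewrite gcompVm gdom_inv gcomp1m.
  rewrite invK; apply: (gr_comp_mulE yah (db_x xy j)).
  by rewrite gdom_comp// hj gdom_inv.
rewrite -/(entry a (i, j)); apply: entryP; apply/esym.
have [ih|ih] := pselect (gdom (s i) = gcod h); last first.
  by rewrite (gr_mul_eq0 (db_y xy i) ha ih) gr_mul0r.
have yah := gr_comp_mulE (db_y xy i) ha ih.
have [hj|hj] := pselect (gdom h = gdom (s j)).
  by have := mx_degree_def ih hj; rewrite E.
apply: (gr_mul_eq0 yah (db_x xy j)); rewrite gdom_comp// => hj'; apply: hj.
by rewrite gdom_inv hj'.
Qed.

(** The map [a |-> (y_i a x_j)] is multiplicative since the sum of the [x_k y_k]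
    acts as the identity, and its inverse maps a matrix [u] to the sum of the
    [x_i u_ij y_j]. *)
Lemma matrix_ring_iso :
  gr_ring_iso R (matrix_ring (@corner_supp G R e) db_inv_cod db_d_finite).
Proof.
exists phi; split=> //.
have [psi psiK] := choice phi_surj; exists psi => // a; exact: phi_inj.
Qed.

(** [1_e R] is gr-simple and each basis element of codomain [e] generates it, so
    there is one such element. *)
Lemma db_unique_index : exists! i, gdom (s i) = e.
Proof.
have [e0 inv] := simp.
have [i ie] : exists i, gcod (g i) = e.
  apply: contrapT => H; apply: e0; apply: (db_eq0 xy) => i.
  apply: (gr_mul_eq0 (db_y xy i) (gr_one_comp R e)).
  by rewrite gdom_inv gcod_id => ie; apply: H; exists i.
exists i; split=> [|j]; rewrite gdom_inv// => je.
have one_ne k : gr_mul (y k) (x k) = gr_one R e by rewrite (db_ortho xy) eqxx.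
have xi0 : x i <> 0 by move=> x0; apply: e0; rewrite -(one_ne i) x0 gr_mulr0.
have [c [_ xc]] := inv _ _ (db_x xy i) ie xi0.
apply: contrapT => ij; apply: e0.
rewrite -(one_ne j) -(gr_mul1E (db_x xy j) je) -xc !gr_mulA (db_ortho xy).
by case: eqP => [ji|_]; [case: ij|rewrite !gr_mul0r].
Qed.

End MatrixIso.

(** * Matrix rings over graded division rings *)

Lemma right_simple_atI (G : groupoid) (R : grRing G) (e : gobj G) :
  gr_one R e <> 0 ->
  (forall g (a : R), gr_comp g a -> gcod g = e -> a <> 0 ->
    exists b, gr_mul a b = gr_one R e) ->
  right_simple_at R e.
Proof.
move=> e0 inv; split=> // g a ga ge a0; have [b ab] := inv g a ga ge a0.
exists (rproj b (ginv g)); split; first exact: rprojP.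
by rewrite -ge in ab *; exact: homog_right_inverse.
Qed.

Section MatrixOverDivision.
Variables (G : groupoid) (D : grRing G) (e0 e : gobj G).
Hypothesis suppD : gr_supp D `<=` [set g | gcod g = e0 /\ gdom g = e0].
Variables (I : choiceType) (s : I -> G).
Hypothesis scod : forall i, gcod (s i) = e0.
Hypothesis sfin : d_finite s.
Hypothesis divD : gr_division_ring D.
Variable i0 : I.
Hypothesis i0e : gdom (s i0) = e.
Hypothesis i0_unique : forall i, gdom (s i) = e -> i = i0.

Let M := matrix_ring suppD scod sfin.

Let unit_mx (i j : I) (u : D) : M :=
  @fs_single (I * I)%type (fun=> gr_sort D : zmodType) (i, j) u.

Let unit_mxE i j u k l :
  (unit_mx i j u : fsfam _) (k, l) = if (k == i) && (l == j) then u else 0.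
Proof.
rewrite /=; case: (eqVneq (i, j) (k, l)) => [[-> ->]|ne].
  by rewrite dfwith_in !eqxx.
rewrite dfwith_out//; case: eqP => //= ki; case: eqP => //= lj.
by rewrite ki lj eqxx in ne.
Qed.

Let D1 (u : D) : gr_mul u (gr_one D e0) = u.
Proof.
move: u; apply: gr_homog_ind => [|g u gu].
  have := @subgroup_ker D D (fun a => gr_mul a (gr_one D e0) - a).
  case=> [x y|P0 PB]; first by rewrite gr_mulDl opprD addrACA.
  split=> [|x y xe ye]; first exact: gr_mul0r.
  by rewrite gr_mulBl xe ye.
have [->|u0] := pselect (u = 0); first exact: gr_mul0r.
apply: (gr_mulE1 gu); apply: (proj2 (suppD _)) => E.
by apply: u0; have : [set (0 : D)] u by rewrite -E.
Qed.

Let one_neq0 : gr_one D e0 <> 0.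
Proof.
by move=> E; have [[u u0] _] := divD; apply: u0; rewrite -(D1 u) E gr_mulr0.
Qed.

Let one_unit : gr_one M e = unit_mx i0 i0 (gr_one D e0).
Proof.
apply: fsfamP => -[k l]; rewrite [RHS]unit_mxE /= /mx_one_fun /=.
have [->|kl] := eqVneq k l => /=.
  rewrite andbb; case: (gdom (s l) =P e) => [/i0_unique->|le];
    first by rewrite eqxx.
  by case: eqP => // li; case: le; rewrite li.
by case: eqP => //= ki; case: eqP => // li; rewrite ki li eqxx in kl.
Qed.

Let mul_unit_mx (a : M) i j u k l :
  (gr_mul a (unit_mx i j u) : fsfam _) (k, l) =
    if l == j then gr_mul ((a : fsfam _) (k, i)) u else 0.
Proof.
rewrite /= /mx_mul_fun (fsum_eq (X := [fset i]%fset)) => [|m].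
  rewrite big_seq_fset1 -/(unit_mx i j u (i, l)) unit_mxE /= eqxx.
  by case: eqP => //= _; rewrite gr_mulr0.
rewrite /= inE -[_ (m, l)]/((unit_mx i j u : fsfam _) (m, l)) unit_mxE.
by case: (m == i) => //=; rewrite gr_mulr0 eqxx.
Qed.

(** A homogeneous matrix [a] whose degree has codomain [e] is supported in the
    row [i0]. If it is nonzero, it has a nonzero homogeneous entry [a_(i0,q)],
    with inverse [w] in [D]; then [a] times the matrix with entry [w] at [(q,
    i0)] is [1_e]. *)
Lemma matrix_right_simple : right_simple_at M e.
Proof.
apply: right_simple_atI.
  rewrite one_unit => /(congr1 (fun a : M => (a : fsfam _) (i0, i0))).
  by rewrite unit_mxE !eqxx /=; exact: one_neq0.
move=> g a ga ge a0.
have a_row k l : (a : fsfam _) (k, l) <> 0 -> k = i0.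
  move=> akl; have := ga k l; case E: mx_degree => [h|] //= _.
  by have [kg _ _] := mx_degreeP E; apply: i0_unique; rewrite kg.
have [q aq] : exists q, (a : fsfam _) (i0, q) <> 0.
  apply: contrapT => H; apply: a0; apply: fsfamP => -[k l].
  apply: contrapT => akl; apply: H; exists l.
  by rewrite -(a_row _ _ akl).
have [h [ha hc]] : exists h, gr_comp h ((a : fsfam _) (i0, q)) /\ gcod h = e0.
  have := ga i0 q; case E: mx_degree => [h|] //= ha; exists h; split=> //.
  have [ig gq ->] := mx_degreeP E.
  by rewrite !gcod_comp ?gdom_comp ?gcod_inv// scod.
have [_ inv] := divD; have [w [_ aw _]] := inv _ _ ha aq.
exists (unit_mx q i0 w); rewrite one_unit; apply: fsfamP => -[k l].
rewrite mul_unit_mx unit_mxE; case: (l =P i0) => [_|_]; last by rewrite andbF.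
rewrite andbT; case: (k =P i0) => [->|ki]; first by rewrite aw hc.
rewrite (_ : (a : fsfam _) (k, q) = 0) ?gr_mul0r//.
by apply: contrapT => akq; apply: ki; exact: a_row akq.
Qed.

(** The matrix unit at [(i, j)] factors through the index [i0]. *)
Lemma matrix_full : full_at M e.
Proof.
apply/seteqP; split=> // a _; move: a.
apply: fsfam_ind; first exact: principal_ideal_subgroup.
move=> [i j] u; rewrite -[fs_single _]/(unit_mx i j u).
suff -> : unit_mx i j u =
    gr_mul (gr_mul (unit_mx i i0 u) (gr_one M e)) (unit_mx i0 j (gr_one D e0)).
  exact: principal_ideal_mem.
apply: fsfamP => -[k l]; rewrite one_unit mul_unit_mx.
rewrite (mul_unit_mx (unit_mx i i0 u)) eqxx !unit_mxE eqxx andbT.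
case: (l == j); last by rewrite andbF.
by rewrite andbT; case: (k == i); rewrite ?gr_mul0r// !D1.
Qed.

End MatrixOverDivision.

(** Multiplicativity and gradedness force an isomorphism to map [1_e] to [1_e];
    the rest is transport. *)
Lemma iso_right_simple_full (G : groupoid) (R S : grRing G) e :
  gr_ring_iso R S -> right_simple_at S e -> full_at S e ->
  right_simple_at R e /\ full_at R e.
Proof.
move=> [f [[f' fK f'K] fD fM fh]] [e0 inv] full.
have f0 := additive0 fD.
have f'h := inj_homog (@gr_comp_direct _ R) (@gr_comp_subgroup _ S)
  (@gr_comp_direct _ S) (can_inj fK) fD fh.
have f1 : f (gr_one R e) = gr_one S e.
  have h1 : gr_comp (gid e) (f' (gr_one S e)).
    by apply: f'h; rewrite f'K; exact: gr_one_comp.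
  have := fM (gr_one R e) (f' (gr_one S e)).
  rewrite f'K (gr_mul1E h1) ?gcod_id// f'K => ->.
  apply/esym/(gr_mulE1 (fh _ _ (gr_one_comp R e))).
  by rewrite gdom_id.
split.
  apply: right_simple_atI => [E|g a ga ge a0].
    by apply: e0; rewrite -f1 E.
  have fa0 : f a <> 0 by rewrite -f0 => /(can_inj fK).
  have [b [_ ab]] := inv _ _ (fh _ _ ga) ge fa0.
  by exists (f' b); apply: (can_inj fK); rewrite fM f'K f1.
apply/seteqP; split=> // a _; rewrite -[a]fK.
have : principal_ideal (gr_one S e) (f a) by rewrite full.
move: (f a); apply: (principal_ideal_ind (P :=
  [set b | principal_ideal _ (f' b)])).
  apply: subgroup_preim (principal_ideal_subgroup _).
  by move=> u v; apply: (can_inj fK); rewrite fD !f'K.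
move=> u v /=; rewrite (_ : f' _ = gr_mul (gr_mul (f' u) (gr_one R e)) (f' v)).
  exact: principal_ideal_mem.
by apply: (can_inj fK); rewrite !fM !f'K f1.
Qed.

(** * The equivalences *)

Lemma gid_inv (G : groupoid) (e : gobj G) : ginv (gid e) = gid e.
Proof.
by rewrite -[LHS]gcompm1 gdom_inv gcod_id gcompVm gdom_id.
Qed.

Section FullSimple.
Variables (G : groupoid) (R : grRing G) (e : gobj G).
Hypothesis simp : right_simple_at R e.

Lemma gr_simple_full : gr_simple R -> full_at R e.
Proof.
move=> [_ simpR]; have [e0 _] := simp; have eR := gr_one_comp R e.
have [E|//] := simpR _ (principal_ideal_gr_ideal eR).
by exfalso; apply: e0; have := principal_ideal_gen eR; rewrite E.
Qed.

(** In a shift of [1_e R] every element is a multiple of the one that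
    corresponds to [1_e]. *)
Lemma direct_sum_full (J : choiceType) (t : J -> G) :
  gr_module_iso (regular R)
    (direct_sum (fun j => shift (object_shift (regular R) e) (t j))) ->
  full_at R e.
Proof.
move=> [f [[f' fK f'K] fD fA _]].
have f'D : {morph f' : u v / u + v}.
  by move=> u v; apply: (can_inj fK); rewrite fD !f'K.
have f'A u a : f' (gm_act u a) = gr_mul (f' u) a.
  by apply: (can_inj fK); rewrite f'K fA f'K.
have sJ := principal_ideal_subgroup (gr_one R e).
apply/seteqP; split=> // a _; rewrite -[a]fK; move: (f a).
apply: dsum_ind; first exact: subgroup_preim f'D sJ.
move=> g j v gv.
pose single (u : shift (object_shift (regular R) e) (t j)) : direct_sum
  (fun k => shift (object_shift (regular R) e) (t k)) :=
  @fs_single J (fun k => gm_sort (shift (object_shift (regular R) e) (t k)))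
    j u.
rewrite /preimage /mkset -/(single v); have [tj|tj] := pselect (gcod (t j) = e).
  pose w := to_summand tj (to_object_shift (gr_one_idem R e)).
  have wE : single v = gm_act (gm_act (single w) (gr_one R e))
      (shift_val (shift_val v)).
    apply: fsfamP => k /=; case: (eqVneq j k) => [<-|jk].
      rewrite !dfwith_in; apply/val_inj/val_inj => /=.
      by rewrite gr_one_idem object_shift_valP.
    by rewrite !dfwith_out//; apply/val_inj/val_inj => /=; rewrite !gr_mul0r.
  by rewrite wE !f'A; exact: principal_ideal_mem.
have -> : v = 0.
  apply/val_inj/val_inj; move: gv; rewrite /= /shift_comp /shift_family.
  case E: (Defs.pcomp (t j) g) => [h|] /= => [hv|->//].
  have [tg hE] := pcomp_eq E; have [_ ] := object_shiftP hv; apply.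
  by rewrite -hE gcod_comp.
by rewrite /single fs_single0 (additive0 f'D); case: sJ.
Qed.

Lemma component_division_at : component_division_ring R e.
Proof.
have [e0 _] := simp; split=> // a ea a0.
have aE : a \in @corner_pred G R e.
  by apply/asboolP; rewrite (gr_mul1E ea) ?gcod_id// (gr_mulE1 ea) ?gdom_id.
have [_ inv] := corner_division simp.
have [|b [eb ab ba]] := inv (gid e) (Corner aE) ea.
  by move=> /(congr1 (@corner_val _ _ _)).
exists (corner_val b); split.
- by rewrite -[X in gr_comp X]gid_inv.
- by have := congr1 (@corner_val _ _ _) ab; rewrite /= gcod_id eqxx.
- by have := congr1 (@corner_val _ _ _) ba; rewrite /= gdom_id eqxx.
Qed.

(** The module is [1_e R]: if [1_e R a = 0] then [R a = R 1_e R a = 0]. *)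
Lemma primitive_at : full_at R e -> right_gr_primitive R.
Proof.
move=> full; exists (object_shift (regular R) e).
split; first exact/right_simple_atP.
apply/seteqP; split=> [a /= va|_ -> v]; last exact: gm_act0r.
apply: gr_right_annihilator0 => b.
have : principal_ideal (gr_one R e) b by rewrite full.
move: b; apply: (principal_ideal_ind (P := [set b | gr_mul b a = 0])).
  by apply: subgroup_ker => u v; rewrite gr_mulDl.
move=> u v /=; have ev : gr_mul (gr_one R e) (gr_mul (gr_one R e) v) =
    gr_mul (gr_one R e) v by rewrite gr_mulA gr_one_idem.
have := congr1 (@shift_val _ _ _ _) (va (to_object_shift ev)) => /= E.
by rewrite -!gr_mulA [gr_mul (gr_one R e) _]gr_mulA E gr_mulr0.
Qed.

End FullSimple.

Theorem theorem7p3 (G : groupoid) (R : grRing G) :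
  [<-> gr_simple R /\ pfm_ring R;
       gr_prime R /\ pfm_ring R;
       exists (e0 e : gobj G) (D : grRing G)
              (suppD : (gr_supp D `<=`
                         [set g | gcod g = e0 /\ gdom g = e0])%classic)
              (I : choiceType) (s : I -> G)
              (scod : forall i, gcod (s i) = e0) (sfin : d_finite s),
         gr_division_ring D /\ inhabited I /\
         gr_ring_iso R (matrix_ring suppD scod sfin) /\
         (exists! i : I, gdom (s i) = e);
       gr_simple R /\
         (exists e : gobj G, gr_simple_module (object_shift (regular R) e));
       exists e : gobj G,
         gr_simple_module (object_shift (regular R) e) /\
         exists (J : choiceType) (t : J -> G),
           gr_module_iso (regular R)
             (direct_sum (fun j => shift (object_shift (regular R) e) (t j)));
       gr_simple R /\ right_artinian R /\
         (exists e : gobj G, component_division_ring R e);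
       right_gr_primitive R /\ right_artinian R /\
         (exists e : gobj G, component_division_ring R e)].
Proof.
have prime_division : homog_prime R -> right_artinian R ->
    (exists e, component_division_ring R e) ->
    exists e, right_simple_at R e /\ full_at R e.
  move=> prime art [e div]; have simp := division_right_simple prime art div.
  by exists e; split=> //; exact: right_simple_full.
tfae.
- by move=> [/gr_simple_prime].
- move=> [[ne primeR] pfm]; have [e simp] := pfm_right_simple ne pfm.
  have full : full_at R e.
    by apply: prime_pfm_full => //; [exact: gr_prime_homog|case: simp].
  have [I [g [x [y xy]]]] := dual_basis_at simp full.
  have [i [ie iu]] := db_unique_index simp xy.
  exists e, e, (corner_ring R e), (@corner_supp G R e), I,
    (fun i => ginv (g i)), (db_inv_cod xy), (db_d_finite xy).
  split; first exact: corner_division.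
  split; first by exists.
  split; first exact: matrix_ring_iso.
  by exists i.
- move=> [e0 [e [D [suppD [I [s [scod [sfin [divD [_ [iso
    [i [ie iu]]]]]]]]]]]]].
  have iu' j : gdom (s j) = e -> j = i by move=> /iu->.
  have [simp full] := iso_right_simple_full iso
    (matrix_right_simple suppD scod sfin divD ie iu')
    (matrix_full suppD scod sfin ie iu').
  split; first exact: gr_simple_at simp full.
  by exists e; exact/right_simple_atP.
- move=> [simpR [e /right_simple_atP simp]].
  have full := gr_simple_full simp simpR.
  exists e; split; first exact/right_simple_atP.
  have [I [g [x [y xy]]]] := dual_basis_at simp full.
  by exists I, (fun i => ginv (g i)); exact: regular_iso_direct_sum xy.
- move=> [e [/right_simple_atP simp [J [t iso]]]].
  have full := direct_sum_full iso.
  split; first exact: gr_simple_at simp full.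
  split; first exact: right_artinian_at simp full.
  by exists e; exact: component_division_at.
- move=> [simpR [art div]]; split=> //.
  have prime := gr_prime_homog (gr_simple_prime simpR).
  have [e [simp full]] := prime_division prime art div.
  exact: primitive_at simp full.
- move=> [prim [art div]].
  have [e [simp full]] := prime_division (primitive_homog_prime prim) art div.
  split; first exact: gr_simple_at simp full.
  exact: pfm_at simp full.
Qed.
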